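(* Let $\Delta_\infty^d(-1)$, $\Box_\infty^d(-1)$ and $\Diamond_\infty^d(-1)$ denote the ideal regular simplex, cube and crosspolytope in $d$-dimensional hyperbolic space of curvature $-1$, and let $\omega_{d+1}=\frac{2\pi^{(d+1)/2}}{\Gamma((d+1)/2)}$. 1. If $d\ge2$ is even, then $$\operatorname{Vol}_{d,-1}\bigl(\Delta_\infty^d(-1)\bigr)=\frac{\omega_{d+1}}{2\,\mathrm i^d\sqrt{2\pi}}\int_{-\infty}^\infty\left[\Phi\left(\frac{\mathrm i y}{\sqrt d}\right)^{d+1}+\Phi\left(-\frac{\mathrm i y}{\sqrt d}\right)^{d+1}\right]e^{-y^2/2}\,dy.$$ 2. For every integer $d\ge2$, $$\operatorname{Vol}_{d,-1}\bigl(\Box_\infty^d(-1)\bigr)=\frac{\omega_{d+1}}{\mathrm i^d\sqrt{2\pi}}\int_0^\infty\left(2\Phi\left(\frac{\mathrm i y}{\sqrt d}\right)-1\right)^d e^{-y^2/2}\,dy.$$ 3. If $d\ge2$ is even, then $$\operatorname{Vol}_{d,-1}\bigl(\Diamond_\infty^d(-1)\bigr)=\frac{\omega_{d+1}}{\mathrm i^d}\left[\frac12-\frac{2^d}{\pi}\int_0^\infty\frac1y\operatorname{Im}\left[\Phi\left(\frac{\mathrm i y}{\sqrt{d-1}}\right)^d\right]e^{-y^2/2}\,dy\right],$$ where the integrand at $y=0$ is understood by continuous extension. Although the right-hand sides involve complex quantities, they are real.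
   Context: Hyperbolic space of curvature $-1$ is realized by the Klein model: the open unit ball $\mathbb B^d(-1)=\{x\in\mathbb R^d:\|x\|<1\}$, with Riemannian volume $$\operatorname{Vol}_{d,-1}(B)=\int_{B\cap\mathbb B^d(-1)}\frac{dy_1\cdots dy_d}{(1-\|y\|^2)^{(d+1)/2}}$$ for Borel sets $B$ in the closed unit ball. The ideal regular polytopes, realized with centre at the origin, are: $\Delta_\infty^d(-1)$, a Euclidean regular $d$-simplex inscribed in the unit sphere; $\Box_\infty^d(-1)=[-1/\sqrt d,1/\sqrt d]^d$; and $\Diamond_\infty^d(-1)=\operatorname{conv}\{\pm e_1,\ldots,\pm e_d\}$, where $e_1,\dots,e_d$ is the standard basis of $\mathbb R^d$. $\Phi$ is the entire function $\Phi(z)=\frac12+\frac1{\sqrt{2\pi}}\int_0^z e^{-t^2/2}\,dt$, $z\in\mathbb C$, and $\mathrm i=\sqrt{-1}$. *)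

(* Defs.v *)
From HB Require Import structures.
From mathcomp Require Import all_boot all_order all_algebra.
From mathcomp Require Import complex.
From mathcomp Require Import all_classical all_reals all_analysis.

Set Implicit Arguments.
Unset Strict Implicit.
Unset Printing Implicit Defensive.
Import Order.TTheory GRing.Theory Num.Theory.
Import numFieldNormedType.Exports.

Local Open Scope classical_set_scope.
Local Open Scope complex_scope.
Local Open Scope ring_scope.

(* Lebesgue measure on R^n. MathComp-Analysis equips n.-tuple R with the
   product sigma-algebra but not with a measure: we iterate the binary product
   of sigma-finite measures, transported along (x, t) |-> x :: t. *)

Section lebesgue_cons.
Context (R : realType) (n : nat).
Let T := measurableTypeR R.
Variable m : {sigma_finite_measure set (n.-tuple T) -> \bar R}.

Definition cons_pair (p : T * n.-tuple T) : n.+1.-tuple T :=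
  [tuple of p.1 :: p.2].

Lemma measurable_cons_pair : measurable_fun setT cons_pair.
Proof. exact: (measurable_cons measurable_fst measurable_snd). Qed.

Definition lebesgue_cons : set (n.+1.-tuple T) -> \bar R :=
  pushforward (product_measure1 (@lebesgue_measure R) m) cons_pair.

Let push : {measure set (n.+1.-tuple T) -> \bar R} :=
  measure_function_pushforward__canonical__measure_function_Measure
    (product_measure1 (@lebesgue_measure R) m) measurable_cons_pair.

Let lebesgue_cons0 : lebesgue_cons set0 = 0%E.
Proof. exact: (measure0 push). Qed.

Let lebesgue_cons_ge0 A : (0 <= lebesgue_cons A)%E.
Proof. exact: (measure_ge0 push). Qed.

Let lebesgue_cons_sigma_additive : semi_sigma_additive lebesgue_cons.
Proof. exact: (@measure_semi_sigma_additive _ _ _ push). Qed.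

HB.instance Definition _ := isMeasure.Build _ _ _ lebesgue_cons
  lebesgue_cons0 lebesgue_cons_ge0 lebesgue_cons_sigma_additive.

Let lebesgue_cons_sigma_finite : sigma_finite setT lebesgue_cons.
Proof.
have /sigma_finiteP[F [FT ndF Foo]] := sigma_finiteT (@lebesgue_measure R).
have /sigma_finiteP[G [GT ndG Goo]] := sigma_finiteT m.
pose uncons (t : n.+1.-tuple T) : T * n.-tuple T :=
  (thead t, [tuple of behead t]).
exists (fun i => uncons @^-1` (F i `*` G i)).
  apply/seteqP; split => [t _|//].
  have : setT (uncons t).1 by [].
  have : setT (uncons t).2 by [].
  rewrite FT GT => -[j _ Gj] [i _ Fi].
  exists (maxn i j) => //; split.
    by move: Fi; exact/subsetPset/ndF/leq_maxl.
  by move: Gj; exact/subsetPset/ndG/leq_maxr.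
move=> i; have [mF Foo'] := Foo i; have [mG Goo'] := Goo i; split.
  rewrite -[X in measurable X]setTI.
  apply: (measurable_fun_pair (measurable_tnth _)
    (@measurable_behead _ _ n)) => //.
  exact: measurableX.
rewrite /lebesgue_cons /pushforward.
rewrite (_ : cons_pair @^-1` _ = F i `*` G i); last first.
  have cK p : uncons (cons_pair p) = p.
    by case: p => x t; congr pair; apply/val_inj.
  by apply/funext => p; rewrite -[in RHS](cK p).
by rewrite product_measure1E// lte_mul_pinfty// ge0_fin_numE.
Qed.

HB.instance Definition _ := Measure_isSigmaFinite.Build _ _ _ lebesgue_cons
  lebesgue_cons_sigma_finite.

End lebesgue_cons.

Fixpoint lebesgue_tuple (R : realType) (n : nat) :
    {sigma_finite_measure set (n.-tuple (measurableTypeR R)) -> \bar R} :=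
  match n with
  | 0 => dirac [tuple]
  | n'.+1 => lebesgue_cons (lebesgue_tuple R n')
  end.

Section hyperbolic_volume.
Context (R : realType) (d : nat).

(* The norm that MathComp-Analysis puts on 'rV[R]_d is the sup norm. *)
Definition enorm (x : 'rV[R]_d) : R := Num.sqrt (\sum_k x 0 k ^+ 2).

Definition row_of_tuple (t : d.-tuple (measurableTypeR R)) : 'rV[R]_d :=
  \row_k tnth t k.

Definition hyp_vol (B : set 'rV[R]_d) : \bar R :=
  (\int[lebesgue_tuple R d]_(t in row_of_tuple @^-1`
       (B `&` [set x | (enorm x < 1)%R]))
    ((1 - enorm (row_of_tuple t) ^+ 2) `^ (d.+1%:R / 2))^-1%:E)%E.

Definition convex_hull (A : set 'rV[R]_d) : set 'rV[R]_d :=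
  smallest (@convex_set R 'rV[R]_d) A.

Definition ideal_regular_simplex_vertices (v : 'I_d.+1 -> 'rV[R]_d) : Prop :=
  [/\ forall i, enorm (v i) = 1, \sum_i v i = 0 &
      exists2 l : R, 0 < l & forall i j, i != j -> enorm (v i - v j) = l].

Definition ideal_cube : set 'rV[R]_d :=
  [set x | forall k, - (Num.sqrt d%:R)^-1 <= x 0 k <= (Num.sqrt d%:R)^-1].

Definition ideal_crosspolytope : set 'rV[R]_d :=
  convex_hull [set x | exists i : 'I_d, x = delta_mx 0 i \/ x = - delta_mx 0 i].

End hyperbolic_volume.

Section special_functions.
Context (R : realType).
Local Notation leb := (@lebesgue_measure R).

Definition Gamma (x : R) : R :=
  \int[leb]_(t in `]0, +oo[) (t `^ (x - 1) * expR (- t)).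

(* Surface area of the unit sphere of R^n. *)
Definition omega (n : nat) : R := 2 * pi `^ (n%:R / 2) / Gamma (n%:R / 2).

Definition Cintegrable (D : set R) (f : R -> R[i]) : Prop :=
  leb.-integrable D (fun x => (complex.Re (f x))%:E) /\
  leb.-integrable D (fun x => (complex.Im (f x))%:E).

Definition Cintegral (D : set R) (f : R -> R[i]) : R[i] :=
  (\int[leb]_(x in D) complex.Re (f x)) +i*
  (\int[leb]_(x in D) complex.Im (f x)).

Definition expC (z : R[i]) : R[i] :=
  (expR (complex.Re z))%:C * (cos (complex.Im z) +i* sin (complex.Im z)).

(* The integral from 0 to z is taken along the segment t = s z, 0 <= s <= 1. *)
Definition Phi (z : R[i]) : R[i] :=
  2^-1 + ((Num.sqrt (2 * pi))^-1)%:C *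
         (z * Cintegral `[0, 1] (fun s => expC (- (s%:C * z) ^+ 2 / 2))).

Definition right_ext0 (f : R -> R) (y : R) : R :=
  if y == 0 then lim (f x @[x --> 0^'+]) else f y.

Definition simplex_integrand (d : nat) (y : R) : R[i] :=
  (Phi ('i%C * (y / Num.sqrt d%:R)%:C) ^+ d.+1 +
   Phi (- ('i%C * (y / Num.sqrt d%:R)%:C)) ^+ d.+1) *
  (expR (- y ^+ 2 / 2))%:C.

Definition cube_integrand (d : nat) (y : R) : R[i] :=
  (2 * Phi ('i%C * (y / Num.sqrt d%:R)%:C) - 1) ^+ d *
  (expR (- y ^+ 2 / 2))%:C.

Definition crosspolytope_integrand (d : nat) : R -> R :=
  right_ext0 (fun y => y^-1 *
    complex.Im (Phi ('i%C * (y / Num.sqrt d.-1%:R)%:C) ^+ d) *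
    expR (- y ^+ 2 / 2)).

End special_functions.

(* Main.v *)
Require Import Defs.
From HB Require Import structures.
From mathcomp Require Import all_boot all_order all_algebra.
From mathcomp Require Import complex.
From mathcomp Require Import all_classical all_reals all_analysis measurable_realfun.
From mathcomp Require Import ring lra.
Import Order.TTheory GRing.Theory Num.Theory.
Import numFieldNormedType.Exports.
Local Open Scope classical_set_scope.
Local Open Scope complex_scope.
Local Open Scope ring_scope.

Set Implicit Arguments.
Unset Strict Implicit.
Unset Printing Implicit Defensive.

(* Since the integral over r >= 0 of r^d exp(-a r^2/2) is C a^(-(d+1)/2), the
   volume of B equals C^-1 times the integral of r^d exp(-(1-|y|^2) r^2/2) over
   y in B and r >= 0, with omega_(d+1) C = (2 pi)^((d+1)/2).

   For the cube, the integral over y factorizes into one-dimensional ones.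

   For the simplex and the crosspolytope, affine coordinates and the change of
   variables t = r y turn the volume into the value at k = -1 of
     nu(k) = integral of w(t_1 + ... + t_n) exp(-k |t|^2/2) over the orthant,
   where w is the Gaussian (simplex, n = d+1) or its tail (crosspolytope,
   n = d).  For k > 0, writing w as a Fourier transform factorizes the orthant
   integral into powers of
     A(u) = integral of exp(i u x - x^2/2) over x >= 0
          = sqrt(2 pi) exp(-u^2/2) Phi(i u),
   so that k^(d/2) nu(k) is, up to a constant, a Laplace transform in k of the
   real or imaginary part of A(u)^n.  For even d the factor k^(d/2) is a
   polynomial; comparing the Taylor coefficients at k = 0+ of both sides and
   summing the series at k = -1 gives the formulas. *)

(** * Linear substitutions in iterated Lebesgue integrals *)

(** At k = -1 the orthant integral is borderline: along a coordinate axis the Gaussian decay of w is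
    cancelled by exp(|t|^2/2), and the factorization into powers of A(u) is available only for k >
    0. The continuation is therefore one-sided. All moments of the weight are finite, so both sides
    have Taylor expansions at k = 0+ with explicit remainders, and no holomorphy in k is used. At k
    = -1 positivity of the weight lets monotone convergence produce the value, so finiteness of the
    volume is a conclusion and not an assumption. On the Laplace side the factor exp(u^2/2) must be
    beaten. Only the real part of A(u) is Gaussian; the imaginary part decays like 1/u. The real
    part of an odd power and the imaginary part of an even power contain the real part as a factor
    in every monomial, and this single factor absorbs exp(u^2/2). Even d thus serves twice: it makes
    k^(d/2) a polynomial, and it makes the density integrable. The cube involves neither point and
    allows every d. *)

Section affine_substitution.
Context (R : realType).
Local Notation leb := (@lebesgue_measure R).
Implicit Types a b c : R.

Lemma measurable_affine a b :
  measurable_fun setT ((fun x => a * x + b) : measurableTypeR R -> measurableTypeR R).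
Proof. by apply: measurable_funD => //; exact: measurable_funM. Qed.

(** Lebesgue measure is determined by its values on half-open intervals, so these suffice; a
    negative slope exchanges the closed and the open end but keeps the length. *)
Lemma lebesgue_measure_affine a b (A : set R) : a != 0 -> measurable A ->
  leb A = (`|a|%:E * leb ((fun x : R => (a * x + b)%R) @^-1` A))%E.
Proof.
move=> a0 mA.
pose na : {nonneg R} := NngNum (normr_ge0 a).
pose mu : {measure set (measurableTypeR R) -> \bar R} :=
  mscale na (measure_function_pushforward__canonical__measure_function_Measure
    leb (measurable_affine a b)).
suff : forall A, measurable A -> leb A = mu A by move=> /(_ A mA) ->.
apply: lebesgue_measure_unique => _ [[x y] _ <-] /=.
rewrite /mscale /= /pushforward.
have [a_lt0|a_gt0|/eqP] := ltrgtP a 0; last by rewrite (negbTE a0).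
- have -> : (fun x0 : R => a * x0 + b) @^-1` `]x, y] =
      `[(y - b) / a, (x - b) / a[%classic.
    apply/seteqP; split => z /=; rewrite !in_itv/=.
      by rewrite ler_ndivrMr// ltr_ndivlMr// mulrC lerBrDr ltrBlDr andbC.
    by rewrite ler_ndivrMr// ltr_ndivlMr// mulrC lerBrDr ltrBlDr andbC.
  rewrite !lebesgue_measure_itv/= !lte_fin.
  rewrite ltr_ndivrMr// divfK ?lt_eqF// ltrD2r.
  case: ifPn => _; last by rewrite mule0.
  rewrite -!EFinB -EFinM; congr EFin; rewrite ltr0_norm//; field.
  by rewrite lt_eqF.
- have -> : (fun x0 : R => a * x0 + b) @^-1` `]x, y] =
      `](x - b) / a, (y - b) / a]%classic.
    apply/seteqP; split => z /=; rewrite !in_itv/=.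
      by rewrite ler_pdivlMr// ltr_pdivrMr// mulrC lerBrDr ltrBlDr.
    by rewrite ler_pdivlMr// ltr_pdivrMr// mulrC lerBrDr ltrBlDr.
  rewrite !lebesgue_measure_itv/= !lte_fin.
  rewrite ltr_pdivrMr// divfK ?gt_eqF// ltrD2r.
  case: ifPn => _; last by rewrite mule0.
  rewrite -!EFinB -EFinM; congr EFin; rewrite gtr0_norm//; field.
  by rewrite gt_eqF.
Qed.

(** By the previous lemma [leb] is [|a|] times its own image under the affine map; the formula is
    integration against an image measure. *)
Lemma ge0_integral_affine a b (f : R -> \bar R) : a != 0 ->
  measurable_fun setT f -> (forall x, (0 <= f x)%E) ->
  (\int[leb]_x f (a * x + b)%R = `|a|^-1%:E * \int[leb]_x f x)%E.
Proof.
move=> a0 mf f0.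
pose na : {nonneg R} := NngNum (normr_ge0 a).
pose push : {measure set (measurableTypeR R) -> \bar R} :=
  measure_function_pushforward__canonical__measure_function_Measure
    leb (measurable_affine a b).
pose mu : {measure set (measurableTypeR R) -> \bar R} := mscale na push.
have -> : (\int[leb]_x f x = \int[mu]_x f x)%E.
  apply: eq_measure_integral => A mA _.
  exact: (@lebesgue_measure_affine a b).
rewrite /mu ge0_integral_mscale// muleA.
rewrite ge0_integral_pushforward//; last exact: measurable_affine.
by rewrite preimage_setT -EFinM mulVf ?normr_eq0// mul1e.
Qed.

Lemma ge0_integral_scale_itv0y a (f : R -> \bar R) : 0 < a ->
  measurable_fun setT f -> (forall x, (0 <= f x)%E) ->
  (\int[leb]_(x in `[0%R, +oo[) f (a * x)%R
     = a^-1%:E * \int[leb]_(x in `[0%R, +oo[) f x)%E.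
Proof.
move=> a0 mf f0.
rewrite integral_mkcond [in RHS]integral_mkcond.
have := @ge0_integral_affine a 0 (f \_ `[0%R, +oo[) (lt0r_neq0 a0).
rewrite gtr0_norm// => <-.
- apply: eq_integral => x _; rewrite addr0 !patchE; congr (if _ then _ else _).
  by apply/idP/idP; rewrite !inE/= !in_itv/= !andbT pmulr_rge0.
- exact/(measurable_restrictT _ _).1/measurable_funTS.
- by move=> x; rewrite patchE; case: ifP.
Qed.

End affine_substitution.

(** * Iterated integrals over product sets *)

Section tuple_integral.
Context (R : realType).
Local Notation T := (measurableTypeR R).
Local Notation leb := (@lebesgue_measure R).
Local Notation ltuple := (lebesgue_tuple R).

Definition box (A : set R) n : set (n.-tuple T) :=
  [set t | forall k, A (tnth t k)].
Arguments box A n : clear implicits.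

Lemma measurable_box (A : set R) n : measurable A -> measurable (box A n).
Proof.
move=> mA.
have -> : box A n = \bigcap_(k in [set: 'I_n]) ((fun t : n.-tuple T => tnth t k) @^-1` A).
  by apply/seteqP; split => t At k; [move=> _; exact: At|exact: At].
apply: fin_bigcap_measurable => // k _.
by rewrite -[X in measurable X]setTI; exact: measurable_tnth.
Qed.

Lemma boxT n : box setT n = setT.
Proof. by apply/seteqP; split. Qed.

Lemma box_cons (A : set R) n (x : T) (t : n.-tuple T) :
  box A n.+1 [tuple of x :: t] <-> A x /\ box A n t.
Proof.
split=> [At|[Ax At] k].
  split; first exact: (At ord0).
  by move=> k; have := At (lift ord0 k); rewrite tnthS.
by case: (unliftP ord0 k) => [j ->|->]; rewrite ?tnthS ?tnth0.
Qed.

Lemma measurable_fun_consl n (x : T) :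
  measurable_fun setT (fun t : n.-tuple T => [tuple of x :: t]).
Proof. exact: measurable_cons. Qed.

Lemma measurable_fun_consr n (t : n.-tuple T) :
  measurable_fun setT (fun x : T => [tuple of x :: t]).
Proof. exact: measurable_cons. Qed.

Lemma measurable_fun_thead n : measurable_fun setT (fun t : n.+1.-tuple T => thead t).
Proof. exact: measurable_tnth. Qed.

Lemma tuple_integral_uncurry n (f : n.+1.-tuple T -> \bar R) :
  measurable_fun setT f -> (forall t, (0 <= f t)%E) ->
  (\int[ltuple n.+1]_t f t =
   \int[product_measure1 leb (ltuple n)]_p f (cons_pair p))%E.
Proof.
move=> mf f0.
rewrite /= /lebesgue_cons ge0_integral_pushforward//; first exact: measurable_cons_pair.
Qed.

Lemma ge0_integral_tupleS n (f : n.+1.-tuple T -> \bar R) :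
  measurable_fun setT f -> (forall t, (0 <= f t)%E) ->
  (\int[ltuple n.+1]_t f t =
   \int[leb]_x \int[ltuple n]_t f [tuple of x :: t])%E.
Proof.
move=> mf f0; rewrite tuple_integral_uncurry// fubini_tonelli1//.
by apply: measurableT_comp => //; exact: measurable_cons_pair.
Qed.

Lemma ge0_integral_tupleSr n (f : n.+1.-tuple T -> \bar R) :
  measurable_fun setT f -> (forall t, (0 <= f t)%E) ->
  (\int[ltuple n.+1]_t f t =
   \int[ltuple n]_t \int[leb]_x f [tuple of x :: t])%E.
Proof.
move=> mf f0; rewrite tuple_integral_uncurry// fubini_tonelli2//.
by apply: measurableT_comp => //; exact: measurable_cons_pair.
Qed.

Lemma ge0_integral_boxS (A : set R) n (f : n.+1.-tuple T -> \bar R) :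
  measurable A -> measurable_fun setT f -> (forall t, (0 <= f t)%E) ->
  (\int[ltuple n.+1]_(t in box A n.+1) f t =
   \int[leb]_(x in A) \int[ltuple n]_(t in box A n) f [tuple of x :: t])%E.
Proof.
move=> mA mf f0; rewrite integral_mkcond ge0_integral_tupleS; last 2 first.
- by apply/(measurable_restrictT _ _).1; [exact: measurable_box|exact: measurable_funTS].
- by move=> t; rewrite patchE; case: ifP.
rewrite [RHS]integral_mkcond; apply: eq_integral => x _.
rewrite patchE; case: ifPn => [|/negP] xA.
  rewrite [RHS]integral_mkcond; apply: eq_integral => t _; rewrite !patchE.
  congr (if _ then _ else _); apply/idP/idP; rewrite !inE => /=.
    by move=> /box_cons[].
  by move=> ?; apply/box_cons; split => //; rewrite inE in xA.
apply: integral0_eq => t _; rewrite patchE ifF//; apply/negP.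
by rewrite inE => /box_cons[Ax _]; apply: xA; rewrite inE.
Qed.

Lemma ge0_integral_boxSr (A : set R) n (f : n.+1.-tuple T -> \bar R) :
  measurable A -> measurable_fun setT f -> (forall t, (0 <= f t)%E) ->
  (\int[ltuple n.+1]_(t in box A n.+1) f t =
   \int[ltuple n]_(t in box A n) \int[leb]_(x in A) f [tuple of x :: t])%E.
Proof.
move=> mA mf f0; rewrite integral_mkcond ge0_integral_tupleSr; last 2 first.
- by apply/(measurable_restrictT _ _).1; [exact: measurable_box|exact: measurable_funTS].
- by move=> t; rewrite patchE; case: ifP.
rewrite [RHS]integral_mkcond; apply: eq_integral => t _.
rewrite patchE; case: ifPn => [|/negP] tA.
  rewrite [RHS]integral_mkcond; apply: eq_integral => x _; rewrite !patchE.
  congr (if _ then _ else _); apply/idP/idP; rewrite !inE => /=.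
    by move=> /box_cons[].
  by move=> ?; apply/box_cons; split => //; rewrite inE in tA.
apply: integral0_eq => x _; rewrite patchE ifF//; apply/negP.
by rewrite inE => /box_cons[_ Ax]; apply: tA; rewrite inE.
Qed.

Lemma integral_tuple0 (A : set R) (f : 0.-tuple T -> \bar R) :
  (\int[ltuple 0]_(t in box A 0) f t = f [tuple])%E.
Proof.
have -> : box A 0 = setT by apply/seteqP; split => // t _ [].
rewrite (_ : f = cst (f [tuple])); last first.
  by apply/funext => t; rewrite (tuple0 t).
by rewrite /= integral_dirac//= diracE in_setT mul1e.
Qed.

Lemma ge0_integral_box_prod (A : set R) n (h : R -> R) :
  measurable A -> measurable_fun setT h -> (forall x, 0 <= h x) ->
  (\int[leb]_(x in A) (h x)%:E < +oo)%E ->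
  (\int[ltuple n]_(t in box A n) (\prod_(k < n) h (tnth t k))%:E
    = ((\int[leb]_(x in A) h x) ^+ n)%:E)%E.
Proof.
move=> mA mh h0 hoo.
have hfin : (\int[leb]_(x in A) (h x)%:E)%E = (\int[leb]_(x in A) h x)%:E.
  by rewrite /Rintegral fineK// ge0_fin_numE// integral_ge0// => x _; rewrite lee_fin.
have mprod m : measurable_fun setT (fun t : m.-tuple T => \prod_(k < m) h (tnth t k)).
  apply: (@measurable_prod _ _ _ _ _ (index_enum 'I_m) (fun k t => h (tnth t k))) => k _.
  by apply: measurableT_comp => //; exact: measurable_tnth.
elim: n => [|n IH]; first by rewrite integral_tuple0 big_ord0.
have mb := @measurable_box A n mA.
rewrite ge0_integral_boxS//; last 2 first.
- apply/measurable_EFinP. exact: mprod.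
- by move=> t; rewrite lee_fin prodr_ge0.
transitivity (\int[leb]_(x in A) ((h x)%:E * ((\int[leb]_(x in A) h x) ^+ n)%:E))%E.
  apply: eq_integral => x _; rewrite -IH -ge0_integralZl//; last 3 first.
  - apply/measurable_EFinP/measurable_funTS; exact: mprod.
  - by move=> t _; rewrite lee_fin prodr_ge0.
  - by rewrite lee_fin.
  apply: eq_integral => t _; rewrite -EFinM; congr EFin.
  by rewrite big_ord_recl/= tnth0; congr (_ * _); apply: eq_bigr => k _; rewrite tnthS.
rewrite ge0_integralZr//; last 3 first.
- exact/measurable_EFinP/measurable_funTS.
- by move=> x _; rewrite lee_fin.
- by rewrite lee_fin exprn_ge0// Rintegral_ge0.
by rewrite hfin -EFinM exprS.
Qed.

End tuple_integral.
Arguments box {R} A n.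

(** * Linear changes of variables in R^n *)

Section linear_substitution.
Context (R : realType).
Local Notation T := (measurableTypeR R).
Local Notation leb := (@lebesgue_measure R).
Local Notation ltuple := (lebesgue_tuple R).

(** Integration takes place on tuples while matrices act on rows; this inverse of [row_of_tuple]
    moves between the two. *)
Definition tuple_of_row n (x : 'rV[R]_n) : n.-tuple T := [tuple x 0 k | k < n].

Lemma tuple_of_rowK n : cancel (@tuple_of_row n) (@row_of_tuple R n).
Proof. by move=> x; apply/rowP => k; rewrite mxE tnth_mktuple. Qed.

Lemma row_of_tupleK n : cancel (@row_of_tuple R n) (@tuple_of_row n).
Proof. by move=> t; apply: eq_from_tnth => k; rewrite tnth_mktuple mxE. Qed.

Lemma measurable_fun_tuple_of_row d (X : measurableType d) n (f : X -> 'rV[R]_n) :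
  (forall k, measurable_fun setT (fun x => f x 0 k)) ->
  measurable_fun setT (fun x => tuple_of_row (f x)).
Proof.
move=> mf; apply/measurable_fun_tnthP => k.
rewrite (_ : _ \o _ = (fun x => f x 0 k)); first exact: mf.
by apply/funext => x; rewrite /= tnth_mktuple.
Qed.

Lemma measurable_row_translate n (v : 'rV[R]_n) :
  measurable_fun setT (fun t => tuple_of_row (row_of_tuple t + v)).
Proof.
apply: measurable_fun_tuple_of_row => k.
under [X in measurable_fun _ X]eq_fun do rewrite !mxE.
by apply: measurable_funD => //; exact: measurable_tnth.
Qed.

Lemma measurable_row_mulmx n m (A : 'M[R]_(n, m)) :
  measurable_fun setT (fun t => tuple_of_row (row_of_tuple t *m A)).
Proof.
apply: measurable_fun_tuple_of_row => k.
under [X in measurable_fun _ X]eq_fun do rewrite !mxE.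
apply: measurable_sum => j.
under [X in measurable_fun _ X]eq_fun do rewrite !mxE.
by apply: measurable_funM => //; exact: measurable_tnth.
Qed.

Lemma tuple_of_row_cons n (x : 'rV[R]_(1 + n)) :
  tuple_of_row x = [tuple of x 0 0 :: tuple_of_row (rsubmx x)] :> n.+1.-tuple T.
Proof.
apply: eq_from_tnth => k; rewrite tnth_mktuple.
case: (unliftP ord0 k) => [j ->|->]; rewrite ?tnthS ?tnth0//.
by rewrite tnth_mktuple mxE; congr (x _ _); apply/val_inj.
Qed.

Lemma row_of_tuple_cons n (x : R) (t : n.-tuple T) :
  row_of_tuple [tuple of x :: t] = row_mx x%:M (row_of_tuple t) :> 'rV_(1 + n).
Proof.
apply/rowP => k; rewrite !mxE.
by case: splitP => j kj; rewrite !mxE ?ord1//= ?mulr1n (tnth_nth 0)/= kj ?ord1//= -tnth_nth.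
Qed.

Lemma ge0_integral_translate n (v : 'rV[R]_n) (f : n.-tuple T -> \bar R) :
  measurable_fun setT f -> (forall t, (0 <= f t)%E) ->
  (\int[ltuple n]_t f (tuple_of_row (row_of_tuple t + v)) = \int[ltuple n]_t f t)%E.
Proof.
elim: n v f => [|n IH] v f mf f0.
  by apply: eq_integral => t _; congr f; rewrite tuple0 [RHS]tuple0.
have E (x : R) (t : n.-tuple T) :
    tuple_of_row (row_of_tuple [tuple of x :: t] + v) =
    [tuple of x + v 0 0 :: tuple_of_row (row_of_tuple t + rsubmx (v : 'rV_(1 + n)))].
  rewrite tuple_of_row_cons; congr [tuple of _ :: _].
    by rewrite !mxE tnth0.
  by congr tuple_of_row; rewrite row_of_tuple_cons linearD/= row_mxKr.
rewrite [in RHS](ge0_integral_tupleS mf f0) [LHS]ge0_integral_tupleS; first last.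
- by move=> t; exact: f0.
- by apply: (measurableT_comp mf); exact: measurable_row_translate.
under eq_integral => x _ do under eq_integral => t _ do rewrite E.
transitivity (\int[leb]_x \int[ltuple n]_t f [tuple of (x + v 0 0)%R :: t])%E.
  apply: eq_integral => x _.
  rewrite (IH _ (fun t => f [tuple of (x + v 0 0)%R :: t]))//.
  by apply: (measurableT_comp mf); exact: measurable_fun_consl.
have := @ge0_integral_affine R 1 (v 0 0)
  (fun x => \int[ltuple n]_t f [tuple of x :: t])%E (oner_neq0 _).
rewrite normr1 invr1 mul1e => <-.
- by apply: eq_integral => x _; rewrite mul1r.
- apply: (@measurable_fun_fubini_tonelli_F _ _ _ _ _ _ (fun p => f (cons_pair p))) => //.
  by apply: (measurableT_comp mf); exact: measurable_cons_pair.
- by move=> x; exact: integral_ge0.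
Qed.

(** One round of Gaussian elimination in block form. A column shear makes the corner entry nonzero,
    and a row shear then clears the rest of the first column. *)
Lemma pivot_decomposition n (A : 'M[R]_(1 + n)) : A \in unitmx ->
  exists a r B c c', A = block_mx (1%:M : 'M[R]_1) 0 c 1%:M *m block_mx a%:M r 0 B *m
                         block_mx (1%:M : 'M[R]_1) 0 c' 1%:M.
Proof.
move=> Au.
have [c'' M00] : exists c'' : 'cV[R]_n,
    (A *m block_mx (1%:M : 'M[R]_1) 0 c'' 1%:M) 0 0 != 0.
  have E c'' : (A *m block_mx (1%:M : 'M[R]_1) 0 c'' 1%:M) 0 0 =
      A 0 0 + (ursubmx A *m c'') 0 0.
    rewrite -{1}(submxK A) mulmx_block !mulmx1 -(lshift0 n 0) block_mxEul mxE.
    by rewrite !mxE lshift0.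
  have [A00|A00] := eqVneq (A 0 0) 0; last first.
    by exists 0; rewrite E mulmx0 mxE addr0.
  have [j Aj] : exists j, ursubmx A 0 j != 0.
    apply/existsP; apply: contraTT Au; rewrite negb_exists => /forallP A0.
    rewrite unitmxE unitfE negbK (expand_det_row _ 0); apply/eqP/big1 => j _.
    rewrite -[j](@splitK 1 n); case: (fintype.split _) => k /=.
      by rewrite (ord1 k) lshift0 A00 mul0r.
    by have /negPn/eqP := A0 k; rewrite !mxE lshift0 => ->; rewrite mul0r.
  (* This shear adds the column of a nonzero entry of the first row to the first column. *)
  by exists (delta_mx j 0); rewrite E A00 add0r -colE mxE.
set M := A *m _ in M00.
(* The lower right block is the Schur complement of the pivot. *)
exists (M 0 0), (ursubmx M), (drsubmx M - dlsubmx M *m ursubmx M *m (M 0 0)^-1%:M).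
exists ((M 0 0)^-1 *: dlsubmx M), (- c'').
rewrite mulmx_block !mul1mx !mul0mx !addr0.
rewrite -!scalemxAl.
rewrite !mul_mx_scalar scalerA mulVf// scale1r [X in block_mx _ _ _ X]addrC subrK.
have -> : block_mx (M 0 0)%:M (ursubmx M) (dlsubmx M) (drsubmx M) = M.
  rewrite -[RHS]submxK; congr block_mx; apply/matrixP => i j.
  by rewrite !ord1 !mxE mulr1n lshift0.
rewrite /M -mulmxA mulmx_block !mul1mx !mulmx1 !mul0mx !mulmx0 !addr0 !add0r subrr.
by rewrite -scalar_mx_block mulmx1.
Qed.

Lemma pivot_unitmx n (a : R) (r : 'rV[R]_n) (B : 'M[R]_n) (c c' : 'cV[R]_n) :
  block_mx (1%:M : 'M[R]_1) 0 c 1%:M *m block_mx a%:M r 0 B *m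
    block_mx (1%:M : 'M[R]_1) 0 c' 1%:M \in unitmx -> a != 0 /\ B \in unitmx.
Proof.
rewrite unitmxE !det_mulmx det_ublock !det_lblock !det1 !mul1r mulr1 det_scalar1.
by rewrite unitrM unitfE -unitmxE => /andP[].
Qed.

(** The formula for one matrix, kept as a predicate: it is stable under products, hence only the
    factors of [pivot_decomposition] need a proof. *)
Let linear_substitution n (A : 'M[R]_n) := forall f : n.-tuple T -> \bar R,
  measurable_fun setT f -> (forall t, (0 <= f t)%E) ->
  (\int[ltuple n]_t f (tuple_of_row (row_of_tuple t *m A)) =
   `|\det A|^-1%:E * \int[ltuple n]_t f t)%E.

Let linear_substitutionM n (A B : 'M[R]_n) :
  linear_substitution A -> linear_substitution B -> linear_substitution (A *m B).
Proof.
move=> LA LB f mf f0.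
rewrite det_mulmx normrM invfM EFinM -muleA -LB// -LA//.
- by apply: eq_integral => t _; rewrite tuple_of_rowK mulmxA.
- by apply: (measurableT_comp mf); exact: measurable_row_mulmx.
Qed.

(** The shear translates the first coordinate by a linear form in the others, so the first
    coordinate is integrated innermost. *)
Let linear_substitution_shear n (c : 'cV[R]_n) :
  @linear_substitution (1 + n) (block_mx (1%:M : 'M[R]_1) 0 c 1%:M).
Proof.
move=> f mf f0; rewrite det_lblock !det1 mulr1 normr1 invr1 mul1e.
rewrite [in RHS](ge0_integral_tupleSr mf f0) [LHS]ge0_integral_tupleSr; first last.
- by move=> t; exact: f0.
- by apply: (measurableT_comp mf); exact: measurable_row_mulmx.
apply: eq_integral => t _.
pose s : R := (row_of_tuple t *m c) 0 0.
have := @ge0_integral_affine R 1 s (fun x => f [tuple of x :: t]) (oner_neq0 _).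
rewrite normr1 invr1 mul1e => <- //.
- apply: eq_integral => x _; congr f.
  rewrite row_of_tuple_cons mul_row_block mulmx1 mulmx0 add0r mulmx1 tuple_of_row_cons.
  rewrite row_mxKr row_of_tupleK mul1r; congr [tuple of _ :: _].
  by rewrite -(lshift0 n 0) row_mxEl mxE [x%:M _ _]mxE mulr1n.
- by apply: (measurableT_comp mf); exact: measurable_fun_consr.
Qed.

(** For a fixed first coordinate the others undergo [B] followed by a translation; afterwards the
    first coordinate is scaled by [a]. *)
Let linear_substitution_pivot n (a : R) (r : 'rV[R]_n) (B : 'M[R]_n) : a != 0 ->
  linear_substitution B -> @linear_substitution (1 + n) (block_mx a%:M r 0 B).
Proof.
move=> a0 LB f mf f0; rewrite det_ublock det_scalar1.
rewrite [in RHS](ge0_integral_tupleS mf f0) [LHS]ge0_integral_tupleS; first last.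
- by move=> t; exact: f0.
- by apply: (measurableT_comp mf); exact: measurable_row_mulmx.
have E (x : R) (t : n.-tuple T) :
    tuple_of_row (@row_of_tuple R (1 + n) [tuple of x :: t] *m block_mx a%:M r 0 B) =
    [tuple of a * x + 0 :: tuple_of_row (row_of_tuple t *m B + x *: r)].
  rewrite row_of_tuple_cons mul_row_block mulmx0 addr0 tuple_of_row_cons row_mxKr.
  rewrite !mul_scalar_mx; congr [tuple of _ :: _].
    by rewrite -(lshift0 n 0) row_mxEl !mxE mulr1n addr0 mulrC.
  by rewrite [in LHS]addrC.
under eq_integral => x _ do under eq_integral => t _ do rewrite E.
have mfx x : measurable_fun setT (fun t : n.-tuple T => f [tuple of x :: t]).
  by apply: (measurableT_comp mf); exact: measurable_fun_consl.
rewrite normrM invfM EFinM -muleA muleCA.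
have mF : measurable_fun setT (fun x => \int[ltuple n]_t f [tuple of x :: t])%E.
  apply: (@measurable_fun_fubini_tonelli_F _ _ _ _ _ _ (fun p => f (cons_pair p))) => //.
  by apply: (measurableT_comp mf); exact: measurable_cons_pair.
rewrite -(@ge0_integral_affine R a 0)//; last by move=> x; exact: integral_ge0.
rewrite -ge0_integralZl//; last 2 first.
- apply: (measurableT_comp mF).
  exact: measurable_affine.
- by move=> x _; exact: integral_ge0.
apply: eq_integral => x _.
have mfr : measurable_fun setT (fun t : n.-tuple T =>
    f [tuple of (a * x + 0)%R :: tuple_of_row (row_of_tuple t + x *: r)]).
  by apply: (measurableT_comp (mfx _)); exact: measurable_row_translate.
rewrite -(ge0_integral_translate (x *: r) (mfx (a * x + 0)) (fun=> f0 _)).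
have /= <- := LB _ mfr (fun=> f0 _).
by apply: eq_integral => t _; rewrite tuple_of_rowK.
Qed.

Lemma ge0_integral_linear n (A : 'M[R]_n) (f : n.-tuple T -> \bar R) :
  A \in unitmx -> measurable_fun setT f -> (forall t, (0 <= f t)%E) ->
  (\int[ltuple n]_t f (tuple_of_row (row_of_tuple t *m A)) =
   `|\det A|^-1%:E * \int[ltuple n]_t f t)%E.
Proof.
suff L : forall n (A : 'M[R]_n), A \in unitmx -> linear_substitution A.
  by move=> Au mf f0; exact: L.
elim=> {n A f} [|n IH] A Au.
  move=> g mg g0; rewrite det_mx00 normr1 invr1 mul1e.
  by apply: eq_integral => t _; congr g; rewrite tuple0 [RHS]tuple0.
have [a [r [B [c [c' AE]]]]] := @pivot_decomposition n A Au.
rewrite AE; apply: linear_substitutionM; last exact: linear_substitution_shear.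
apply: linear_substitutionM; first exact: linear_substitution_shear.
move: Au; rewrite AE => /pivot_unitmx[a0 Bu].
by apply: linear_substitution_pivot => //; exact: IH.
Qed.

End linear_substitution.

(** * Homotheties and the unit sphere *)

Section tuple_sphere_scaling.
Context (R : realType).
Local Notation T := (measurableTypeR R).
Local Notation leb := (@lebesgue_measure R).
Local Notation ltuple := (lebesgue_tuple R).

Lemma ge0_integral_tuple_scale n (r : R) (f : n.-tuple T -> \bar R) : 0 < r ->
  measurable_fun setT f -> (forall t, (0 <= f t)%E) ->
  (\int[ltuple n]_t f (tuple_of_row (r *: row_of_tuple t)) =
   (r ^- n)%:E * \int[ltuple n]_t f t)%E.
Proof.
move=> r0 mf f0; have := @ge0_integral_linear R n r%:M f.
rewrite det_scalar unitmxE det_scalar ger0_norm ?exprn_ge0 ?ltW//.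
rewrite unitfE expf_neq0 ?gt_eqF// => /(_ isT mf f0) <-.
by apply: eq_integral => t _; rewrite mul_mx_scalar.
Qed.

Lemma measurable_sum_sqr n :
  measurable_fun setT (fun t : n.-tuple T => \sum_(k < n) tnth t k ^+ 2 : T).
Proof.
by apply: measurable_sum => k; apply: measurable_funX; exact: measurable_tnth.
Qed.

Lemma measurable_sum_tuple n :
  measurable_fun setT (fun t : n.-tuple T => \sum_(k < n) tnth t k : T).
Proof. by apply: measurable_sum => k; exact: measurable_tnth. Qed.

Lemma sum_tuple_cons n (h : R -> R) (x : R) (t : n.-tuple T) :
  \sum_(k < n.+1) h (tnth [tuple of x :: t] k) = h x + \sum_(k < n) h (tnth t k).
Proof. by rewrite big_ord_recl tnth0; under eq_bigr do rewrite tnthS. Qed.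

(** Once the other coordinates are fixed, at most two values of the first one put the point on the
    sphere. *)
Lemma lebesgue_tuple_sphere n :
  ltuple n.+1 [set t | \sum_k tnth t k ^+ 2 = 1] = 0%E.
Proof.
set S : set (n.+1.-tuple T) := [set t | _].
have mS : measurable S.
  rewrite -[S]setTI; apply: (@measurable_sum_sqr n.+1 _ [set 1]) => //.
have -> : ltuple n.+1 S = (\int[ltuple n.+1]_t (\1_S t)%:E)%E.
  by rewrite integral_indic// setIT.
rewrite ge0_integral_tupleSr//; last exact/measurable_EFinP.
apply: integral0_eq => t _.
set c := \sum_k tnth t k ^+ 2.
have finS : finite_set [set x : R | x ^+ 2 = 1 - c].
  apply: (@sub_finite_set _ _ [set Num.sqrt (1 - c); - Num.sqrt (1 - c)]) => // x /= <-.
  by rewrite sqrtr_sqr; case: (ger0P x) => _; rewrite ?opprK; [left|right].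
rewrite (_ : (fun x => _) = EFin \o \1_[set x : R | x ^+ 2 = 1 - c]); last first.
  apply/funext => x /=; congr EFin; rewrite !indicE; congr (nat_of_bool _)%:R.
  apply/idP/idP; rewrite !inE /S/= (sum_tuple_cons (fun x => x ^+ 2)) -/c => E.
    by rewrite -E addrK.
  by rewrite E subrK.
rewrite integral_indic//; last exact/countable_measurable/finite_set_countable.
by rewrite setIT; apply/countable_lebesgue_measure0/finite_set_countable.
Qed.

End tuple_sphere_scaling.

(** * Integrals of products of complex functions of single coordinates *)

Section complex_product.
Context (R : realType).
Local Notation T := (measurableTypeR R).
Local Notation leb := (@lebesgue_measure R).
Local Notation ltuple := (lebesgue_tuple R).

Lemma integral_tuple_mul n (f : R -> R) (g : n.-tuple T -> R) :
  leb.-integrable setT (EFin \o f) -> (ltuple n).-integrable setT (EFin \o g) ->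
  (ltuple n.+1).-integrable setT
    (fun t => (f (thead t) * g [tuple of behead t])%:E) /\
  \int[ltuple n.+1]_t (f (thead t) * g [tuple of behead t]) =
    \int[leb]_x f x * \int[ltuple n]_t g t.
Proof.
move=> intf intg.
have /integrableP[/measurable_EFinP mf foo] := intf.
have /integrableP[/measurable_EFinP mg goo] := intg.
set h := fun t => _.
have hE x (t : n.-tuple T) : h [tuple of x :: t] = (f x * g t)%:E.
  by rewrite /h theadE; congr (_ * g _)%:E; apply/val_inj.
have mh : measurable_fun setT h.
  apply/measurable_EFinP/measurable_funM.
    by apply: (measurableT_comp mf); exact: measurable_fun_thead.
  by apply: (measurableT_comp mg); exact: measurable_behead.
have mh' : measurable_fun setT (h \o @cons_pair R n).
  by apply: (measurableT_comp mh); exact: measurable_cons_pair.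
have hoo : (\int[leb]_x \int[ltuple n]_t `|h [tuple of x :: t]| < +oo)%E.
  rewrite (_ : (fun x => _) = (fun x => `|(f x)%:E| * \int[ltuple n]_t `|(g t)%:E|)%E).
    rewrite ge0_integralZr//; last exact: integral_ge0.
      apply: lte_mul_pinfty => //; first exact: integral_ge0.
      by rewrite ge0_fin_numE//; exact: integral_ge0.
    by apply: measurableT_comp => //; exact/measurable_EFinP.
  apply/funext => x; rewrite -ge0_integralZl//; last first.
    by apply: measurableT_comp => //; exact/measurable_EFinP.
  by apply: eq_integral => t _; rewrite hE EFinM abseM.
have inth : (ltuple n.+1).-integrable setT h.
  apply/integrableP; split => //.
  by rewrite ge0_integral_tupleS//; exact: measurableT_comp.
split=> //.
have int2 : (product_measure1 leb (ltuple n)).-integrable setT (h \o @cons_pair R n).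
  exact/integrable12ltyP.
rewrite /Rintegral -fineM; [|exact: integrable_fin_num..].
congr fine.
rewrite [LHS]integral_pushforward//; last exact: measurable_cons_pair.
rewrite preimage_setT -integral12_prod_meas1//.
transitivity (\int[leb]_x ((f x)%:E * \int[ltuple n]_t (g t)%:E))%E.
  apply: eq_integral => x _; rewrite -integralZl//.
  by apply: eq_integral => t _; rewrite /fubini_F -EFinM -hE.
by rewrite -(fineK (integrable_fin_num measurableT intg)) integralZr.
Qed.

Definition tuple_cprod (h1 h2 : R -> R) n (t : n.-tuple T) : R[i] :=
  \prod_(k < n) (h1 (tnth t k) +i* h2 (tnth t k)).

Lemma tuple_cprodS (h1 h2 : R -> R) n (t : n.+1.-tuple T) :
  tuple_cprod h1 h2 t =
  (h1 (thead t) +i* h2 (thead t)) * tuple_cprod h1 h2 [tuple of behead t].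
Proof.
rewrite /tuple_cprod big_ord_recl; congr (_ * _); apply: eq_bigr => k _.
suff -> : tnth t (lift ord0 k) = tnth [tuple of behead t] k by [].
by rewrite [in LHS](tuple_eta t) tnthS.
Qed.

(** Multiplication mixes real and imaginary parts, so the integrability of both is carried through
    the induction together with the formula. *)
Let integral_tuple_cprodT (h1 h2 : R -> R) n :
  leb.-integrable setT (EFin \o h1) -> leb.-integrable setT (EFin \o h2) ->
  [/\ (ltuple n).-integrable setT (fun t => (complex.Re (tuple_cprod h1 h2 t))%:E),
      (ltuple n).-integrable setT (fun t => (complex.Im (tuple_cprod h1 h2 t))%:E) &
      (\int[ltuple n]_t complex.Re (tuple_cprod h1 h2 t)) +i*
      (\int[ltuple n]_t complex.Im (tuple_cprod h1 h2 t)) =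
      ((\int[leb]_x h1 x) +i* (\int[leb]_x h2 x)) ^+ n].
Proof.
move=> i1 i2; elim: n => [|n [iRe iIm E]].
  have Q (f : 0.-tuple T -> R) : (\int[ltuple 0]_t (f t)%:E)%E = (f [tuple])%:E.
    by have := integral_tuple0 setT (EFin \o f); rewrite boxT.
  have Qi (f : 0.-tuple T -> R) : (ltuple 0).-integrable setT (fun t => (f t)%:E).
    apply/integrableP; split; last by rewrite (Q (fun t => `|f t|)) ltry.
    rewrite (_ : (fun t => _) = cst (f [tuple])%:E); first exact: measurable_cst.
    by apply/funext => t; rewrite (tuple0 t).
  split; [exact: Qi|exact: Qi|].
  by rewrite /Rintegral !Q/= /tuple_cprod !big_ord0.
have [aR aRE] := integral_tuple_mul i1 iRe.
have [aI aIE] := integral_tuple_mul i1 iIm.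
have [bR bRE] := integral_tuple_mul i2 iRe.
have [bI bIE] := integral_tuple_mul i2 iIm.
have ReE (t : n.+1.-tuple T) : complex.Re (tuple_cprod h1 h2 t) =
    h1 (thead t) * complex.Re (tuple_cprod h1 h2 [tuple of behead t]) -
    h2 (thead t) * complex.Im (tuple_cprod h1 h2 [tuple of behead t]).
  by rewrite tuple_cprodS; case: (tuple_cprod _ _ _).
have ImE (t : n.+1.-tuple T) : complex.Im (tuple_cprod h1 h2 t) =
    h1 (thead t) * complex.Im (tuple_cprod h1 h2 [tuple of behead t]) +
    h2 (thead t) * complex.Re (tuple_cprod h1 h2 [tuple of behead t]).
  by rewrite tuple_cprodS; case: (tuple_cprod _ _ _).
split.
- under eq_fun do rewrite ReE EFinB.
  exact: integrableB.
- under eq_fun do rewrite ImE EFinD.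
  exact: integrableD.
under eq_Rintegral do rewrite ReE.
rewrite RintegralB// aRE bIE exprS -E.
under [X in _ +i* X]eq_Rintegral do rewrite ImE.
by rewrite RintegralD// aIE bRE.
Qed.

Lemma integral_tuple_cprod (A : set R) (h1 h2 : R -> R) n : measurable A ->
  leb.-integrable A (EFin \o h1) -> leb.-integrable A (EFin \o h2) ->
  [/\ (ltuple n).-integrable (box A n) (fun t => (complex.Re (tuple_cprod h1 h2 t))%:E),
      (ltuple n).-integrable (box A n) (fun t => (complex.Im (tuple_cprod h1 h2 t))%:E) &
      (\int[ltuple n]_(t in box A n) complex.Re (tuple_cprod h1 h2 t)) +i*
      (\int[ltuple n]_(t in box A n) complex.Im (tuple_cprod h1 h2 t)) =
      ((\int[leb]_(x in A) h1 x) +i* (\int[leb]_(x in A) h2 x)) ^+ n].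
Proof.
move=> mA i1 i2.
have {}i1 := (@integrable_mkcond _ _ _ leb A (EFin \o h1) mA).1 i1.
have {}i2 := (@integrable_mkcond _ _ _ leb A (EFin \o h2) mA).1 i2.
have mb := @measurable_box R A n mA.
rewrite restrict_EFin in i1; rewrite restrict_EFin in i2.
have [iRe iIm E] := integral_tuple_cprodT n i1 i2.
(* A single coordinate outside [A] annihilates the product, so restricting every factor to [A]
   restricts the product to the box. *)
have PE (t : n.-tuple T) : tuple_cprod (h1 \_ A) (h2 \_ A) t =
    if t \in box A n then tuple_cprod h1 h2 t else 0.
  case: ifPn => [|/negP]; rewrite inE => tA.
    by apply: eq_bigr => k _; rewrite !patchE mem_set//; exact: tA.
  move/existsNP: tA => [k kA]; rewrite /tuple_cprod (bigD1 k)//= !patchE.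
  by rewrite memNset// mul0r.
split.
- apply/integrable_mkcond => //; rewrite restrict_EFin.
  rewrite (_ : _ \_ _ = (fun t => complex.Re (tuple_cprod (h1 \_ A) (h2 \_ A) t)))//.
  by apply/funext => t; rewrite PE patchE; case: ifP.
- apply/integrable_mkcond => //; rewrite restrict_EFin.
  rewrite (_ : _ \_ _ = (fun t => complex.Im (tuple_cprod (h1 \_ A) (h2 \_ A) t)))//.
  by apply/funext => t; rewrite PE patchE; case: ifP.
have e1 : \int[leb]_(x in A) h1 x = \int[leb]_x (h1 \_ A) x by exact: Rintegral_mkcond.
have e2 : \int[leb]_(x in A) h2 x = \int[leb]_x (h2 \_ A) x by exact: Rintegral_mkcond.
rewrite e1 e2 -E; congr (_ +i* _).
- rewrite Rintegral_mkcond; apply: eq_Rintegral => t _.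
  by rewrite PE patchE; case: ifP.
- rewrite Rintegral_mkcond; apply: eq_Rintegral => t _.
  by rewrite PE patchE; case: ifP.
Qed.

End complex_product.

(** * Gaussian integrals *)

Section integrable_real.
Context d (T : measurableType d) (R : realType) (mu : {measure set T -> \bar R}).
Context (D : set T) (mD : measurable D).
Implicit Types f g : T -> R.

Lemma integrableZlR (c : R) f : mu.-integrable D (EFin \o f) ->
  mu.-integrable D (EFin \o (fun x => c * f x)).
Proof. by move=> /(integrableZl mD c). Qed.

Lemma integrableDR f g : mu.-integrable D (EFin \o f) ->
  mu.-integrable D (EFin \o g) -> mu.-integrable D (EFin \o (fun x => f x + g x)).
Proof. by move=> i1 i2; exact: (integrableD mD i1 i2). Qed.

Lemma integrableBR f g : mu.-integrable D (EFin \o f) ->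
  mu.-integrable D (EFin \o g) -> mu.-integrable D (EFin \o (fun x => f x - g x)).
Proof. by move=> i1 i2; exact: (integrableB mD i1 i2). Qed.

Lemma integrable_le_norm f g : measurable_fun D f ->
  (forall x, D x -> `|f x| <= g x) -> mu.-integrable D (EFin \o g) ->
  mu.-integrable D (EFin \o f).
Proof.
move=> mf fg; apply: le_integrable => //; first exact/measurable_EFinP.
by move=> x Dx /=; rewrite lee_fin (le_trans (fg _ Dx))// ler_norm.
Qed.

End integrable_real.

Section gaussian.
Context (R : realType).
Local Notation leb := (@lebesgue_measure R).

Definition gauss (x : R) : R := expR (- x ^+ 2 / 2).

Lemma gauss_ge0 x : 0 <= gauss x. Proof. exact: expR_ge0. Qed.

Lemma gauss_le1 x : gauss x <= 1.
Proof. by rewrite /gauss -[leRHS]expR0 ler_expR mulNr oppr_le0 divr_ge0// sqr_ge0. Qed.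

Lemma gauss0 : gauss 0 = 1.
Proof. by rewrite /gauss expr0n/= oppr0 mul0r expR0. Qed.

Lemma continuous_gauss : continuous gauss.
Proof.
move=> x; apply: (@continuous_comp _ _ _ (fun x : R => - x ^+ 2 / 2) expR).
  by apply: cvgMl; apply: cvgN; exact: exprn_continuous.
exact: continuous_expR.
Qed.

Lemma measurable_gauss : measurable_fun setT gauss.
Proof. by apply: continuous_measurable_fun; exact: continuous_gauss. Qed.

Lemma is_derive_gauss (x : R) : is_derive x 1 gauss (- x * gauss x).
Proof.
rewrite /gauss; apply: is_derive_eq.
by rewrite !scaler0 add0r /GRing.scale/= mulr1; field.
Qed.

Lemma integral_gauss : (\int[leb]_(x in `[0%R, +oo[) (gauss x)%:E)%E =
  (Num.sqrt (pi / 2))%:E.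
Proof.
have s2 : 0 < Num.sqrt 2 :> R by rewrite sqrtr_gt0.
have E : (fun x => (gauss x)%:E) = (fun x => (gauss_fun ((Num.sqrt 2)^-1 * x))%:E).
  apply/funext => x; congr (expR _)%:E; rewrite exprMn exprVn sqr_sqrtr//.
  by rewrite mulNr mulrC.
rewrite E (@ge0_integral_scale_itv0y R (Num.sqrt 2)^-1 (fun x => (gauss_fun x)%:E)).
- rewrite invrK integral0y_gauss -EFinM; congr EFin.
  rewrite sqrtrM ?pi_ge0// sqrtrV// -[X in _ / X](@sqr_sqrtr _ 2)//.
  by field; rewrite gt_eqF.
- by rewrite invr_gt0.
- by apply/measurable_EFinP; exact: measurable_gauss_fun.
- by move=> x; rewrite lee_fin gauss_fun_ge0.
Qed.

Lemma integrable_gauss : leb.-integrable `[0%R, +oo[ (EFin \o gauss).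
Proof.
apply/integrableP; split; first by apply/measurable_EFinP/measurable_funTS; exact: measurable_gauss.
under eq_integral do rewrite /= ger0_norm ?gauss_ge0//.
by rewrite integral_gauss ltry.
Qed.

Lemma integrable_gauss_scale (k : R) : 0 < k ->
  leb.-integrable `[0%R, +oo[ (fun x => (expR (- k * x ^+ 2))%:E).
Proof.
move=> k0; have sk : 0 < Num.sqrt (2 * k) by rewrite sqrtr_gt0 mulr_gt0.
have E : (fun x : R => (expR (- k * x ^+ 2))%:E) =
    (fun x => (gauss (Num.sqrt (2 * k) * x))%:E).
  apply/funext => x; congr (expR _)%:E.
  by rewrite exprMn sqr_sqrtr ?mulr_ge0 ?(ltW k0)//; field.
have mE : measurable_fun setT (fun x : R => expR (- k * x ^+ 2)).
  by apply: measurableT_comp => //; exact: measurable_funM.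
apply/integrableP; split; first exact/measurable_EFinP/measurable_funTS.
under eq_integral do rewrite /= ger0_norm ?expR_ge0//.
rewrite E (@ge0_integral_scale_itv0y R (Num.sqrt (2 * k)) (fun x => (gauss x)%:E))//.
- by rewrite integral_gauss -EFinM ltry.
- by apply/measurable_EFinP; exact: measurable_gauss.
- by move=> x; rewrite lee_fin gauss_ge0.
Qed.

(** For x at most 1 the summand 1 is enough; for larger x one has x^n <= x^(2n), which is controlled
    by a single term of the exponential series. *)
Lemma exprn_le_expR (n : nat) (k x : R) : 0 < k -> 0 <= x ->
  x ^+ n <= (1 + n`!%:R / k ^+ n) * expR (k * x ^+ 2).
Proof.
move=> k0 x0.
have kx0 : 0 <= k * x ^+ 2 by rewrite mulr_ge0 ?(ltW k0) ?exprn_ge0.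
have E1 : 1 <= expR (k * x ^+ 2) by rewrite -[leLHS]expR0 ler_expR.
have E2 : (x ^+ 2) ^+ n <= n`!%:R / k ^+ n * expR (k * x ^+ 2).
  case: n => [|n]; first by rewrite !expr0 fact0 divr1 mul1r.
  have := expR_ge1Dxn n kx0; rewrite exprMn => H.
  have f0 : 0 < n.+1`!%:R :> R by rewrite ltr0n fact_gt0.
  rewrite mulrAC ler_pdivlMr ?exprn_gt0// [leLHS]mulrC [leRHS]mulrC -ler_pdivrMr//.
  by rewrite (le_trans _ H)// lerDr.
rewrite mulrDl mul1r; have [x1|x1] := leP x 1.
  by rewrite (le_trans (exprn_ile1 _ x0 x1))// (le_trans E1)// lerDl mulr_ge0 ?expR_ge0// divr_ge0// ?exprn_ge0// ltW.
rewrite (le_trans _ (le_trans E2 _))// ?lerDr ?expR_ge0//.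
by rewrite -exprM ler_weXn2l ?(ltW x1)// mul2n -addnn leq_addr.
Qed.

Lemma integrable_exprn_gauss_scale (n : nat) (k : R) : 0 < k ->
  leb.-integrable `[0%R, +oo[ (fun x => (x ^+ n * expR (- k * x ^+ 2))%:E).
Proof.
move=> k0; have k20 : 0 < k / 2 by rewrite divr_gt0.
have mE (c : R) : measurable_fun setT (fun x : R => expR (- c * x ^+ 2)).
  by apply: measurableT_comp => //; exact: measurable_funM.
apply: (@le_integrable _ _ _ leb _ _ _
  (fun x => (1 + n`!%:R / (k / 2) ^+ n)%:E * (expR (- (k / 2) * x ^+ 2))%:E)%E) => //.
- by apply/measurable_EFinP/measurable_funTS/measurable_funM => //; exact: mE.
- move=> x /=; rewrite in_itv/= andbT => x0.
  have K0 : 0 <= 1 + n`!%:R / (k / 2) ^+ n.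
    by rewrite addr_ge0// divr_ge0// exprn_ge0// ltW.
  rewrite lee_fin !ger0_norm ?mulr_ge0 ?expR_ge0 ?exprn_ge0//.
  have -> : expR (- k * x ^+ 2) = (expR (k / 2 * x ^+ 2))^-1 * expR (- (k / 2) * x ^+ 2).
    by rewrite -expRN -expRD; congr expR; field.
  by rewrite mulrA ler_wpM2r ?expR_ge0// ler_pdivrMr ?expR_gt0// exprn_le_expR.
- by apply: integrableZl => //; exact: integrable_gauss_scale.
Qed.

End gaussian.
Arguments gauss {R} x.

(** * Fundamental theorem on a half-line and differentiation under the integral *)

Section improper_calculus.
Context (R : realType).
Local Notation leb := (@lebesgue_measure R).

Lemma integral_FTC (F f : R -> R) (a b : R) : a < b ->
  (forall x : R, is_derive x 1 F (f x)) -> continuous f ->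
  (\int[leb]_(x in `[a, b]) (f x)%:E)%E = (F b - F a)%:E.
Proof.
move=> ab dF cf.
have cF (x : R) : {for x, continuous F}.
  by apply: differentiable_continuous; apply/derivable1_diffP; case: (dF x).
rewrite (@continuous_FTC2 _ f F)//.
- exact: continuous_subspaceT.
- split; first by move=> x _; case: (dF x).
  + by apply: cvg_at_right_filter; exact: cF.
  + by apply: cvg_at_left_filter; exact: cF.
- by move=> x _; rewrite derive1E; case: (dF x).
Qed.

Lemma cvg_Rintegral_itv0n (f : R -> R) : leb.-integrable `[0%R, +oo[ (EFin \o f) ->
  \int[leb]_(x in `[0, n%:R]) f x @[n --> \oo] --> \int[leb]_(x in `[0%R, +oo[) f x.
Proof.
move=> intf; have /integrableP[/measurable_EFinP mf _] := intf.
have mD : measurable (`[0%R, +oo[ : set (measurableTypeR R)) by exact: measurable_itv.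
pose f_ (n : nat) := (EFin \o f) \_ `[0, n%:R].
have := @dominated_convergence _ _ R leb `[0%R, +oo[ mD f_ (EFin \o f)
  (fun x => `|f x|%:E).
case=> //.
- move=> n; apply/measurable_restrict => //.
  apply: (measurable_funS mD); last exact/measurable_EFinP.
  by move=> x [].
- exact/measurable_EFinP.
- apply: aeW => x; rewrite /= in_itv/= andbT => x0.
  apply: cvg_near_cst; exists (Num.truncn x).+1 => // n /= xn.
  rewrite /f_ patchE ifT// inE/= in_itv/= x0/=.
  by rewrite (le_trans (ltW (Num.Theory.truncnS_gt x)))// ler_nat.
- exact: (integrable_norm intf).
- apply: aeW => x n _; rewrite /f_ patchE; case: ifP => //= _.
  by rewrite normr0 lee_fin.
move=> _ _; rewrite -(fineK (integrable_fin_num mD intf)) => /fine_cvg.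
rewrite (_ : fine \o _ = fun n => \int[leb]_(x in `[0, n%:R]) f x)//.
apply/funext => n /=; congr fine; rewrite /f_ -integral_mkcondr.
congr (integral _ _ _); apply/seteqP; split=> x /=; rewrite !in_itv/= ?andbT.
  by case.
by move=> /andP[x0 xn]; split=> //; apply/andP.
Qed.

Lemma integral_improper_FTC (F f : R -> R) (l : R) :
  (forall x : R, is_derive x 1 F (f x)) -> continuous f ->
  leb.-integrable `[0%R, +oo[ (EFin \o f) -> F x @[x --> +oo] --> l ->
  \int[leb]_(x in `[0%R, +oo[) f x = l - F 0.
Proof.
move=> dF cf intf Fl.
rewrite -(cvg_lim _ (cvg_Rintegral_itv0n intf))//; apply/cvg_lim => //.
rewrite (_ : (fun n => _) = (fun n => F n%:R - F 0)).
  apply: cvgB; last exact: cvg_cst.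
  by apply: (cvg_comp (fun n => n%:R : R) F) Fl; exact: cvgr_idn.
apply/funext => -[|n]; first by rewrite set_itv1 Rintegral_set1 subrr.
by rewrite /Rintegral (integral_FTC _ dF cf)// ltr0n.
Qed.

Lemma is_derive_param_integral d (Y : measurableType d)
    (mu : {measure set Y -> \bar R}) (B : set Y) (f df : R -> Y -> R) (G : Y -> R) (t : R) :
  measurable B -> (forall t, mu.-integrable B (EFin \o f t)) ->
  (forall t x, B x -> is_derive (t : R) 1 (f ^~ x) (df t x)) ->
  (forall x, 0 <= G x) -> mu.-integrable B (EFin \o G) ->
  (forall t x, B x -> `|df t x| <= G x) ->
  is_derive t 1 (fun t => \int[mu]_(x in B) f t x) (\int[mu]_(x in B) df t x).
Proof.
move=> mB intf dfE G0 intG dfG.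
(* The majorant [G] is uniform in the parameter, so any neighbourhood of [t] would serve. *)
have tI : `]t - 1, t + 1[%classic t by rewrite /= in_itv/= ltrBlDr ltrDl ltr01.
have dfx s x : B x -> derivable (f ^~ x) s 1 by move=> Bx; case: (dfE s x Bx).
have dE s x : B x -> derive1 (f ^~ x) s = df s x.
  by move=> Bx; rewrite derive1E; case: (dfE s x Bx).
apply: DeriveDef.
  apply: (derivable_under_integral mB tI _ _ G0 intG) => // s x _ Bx.
    exact: dfx.
  by rewrite /partial1of2 dE// dfG.
rewrite -derive1E (differentiation_under_integral mB tI _ _ G0 intG)//.
- by apply: eq_Rintegral => x /set_mem Bx; rewrite /partial1of2 dE.
- by move=> s x _; exact: dfx.
- by move=> s x _ Bx; rewrite /partial1of2 dE// dfG.
Qed.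

End improper_calculus.

(** * Fourier transform of the Gaussian restricted to a half-line *)

Section gauss_transform.
Context (R : realType).
Local Notation leb := (@lebesgue_measure R).
Local Notation hl := (`[0%R, +oo[%classic : set R).
Implicit Types t x : R.

#[local] Existing Instance is_derive_gauss.

Lemma gaussE x : gauss x = expR (- 2^-1 * x ^+ 2).
Proof. by congr expR; rewrite mulrC mulrN mulNr. Qed.

Lemma integrable_le_gauss (n : nat) (c : R) (f : R -> R) :
  measurable_fun setT f -> (forall x, 0 <= x -> `|f x| <= c * (x ^+ n * gauss x)) ->
  leb.-integrable hl (EFin \o f).
Proof.
move=> mf fc; have h2 : 0 < 2^-1 :> R by rewrite invr_gt0.
apply: (@le_integrable _ _ _ leb _ _ _
    (fun x => c%:E * (x ^+ n * expR (- 2^-1 * x ^+ 2))%:E)%E) => //.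
- by apply/measurable_EFinP; exact: measurable_funTS.
- move=> x /=; rewrite in_itv/= andbT => x0; rewrite lee_fin -gaussE.
  by rewrite (le_trans (fc _ x0))// ler_norm.
- by apply: integrableZl => //; exact: integrable_exprn_gauss_scale.
Qed.

Lemma cvg_gauss : gauss x @[x --> +oo] --> (0 : R).
Proof.
rewrite (_ : gauss = gauss_fun \o ( *%R (Num.sqrt 2)^-1)).
  apply: (cvg_comp _ gauss_fun) cvg_gauss_fun.
  by apply: gt0_cvgMry; rewrite ?invr_gt0 ?sqrtr_gt0.
apply/funext => x; congr expR; rewrite exprMn exprVn sqr_sqrtr//.
by rewrite mulNr mulrC.
Qed.

Lemma cvg_bounded_gauss (f : R -> R) : (forall x, `|f x| <= 1) ->
  f x * gauss x @[x --> +oo] --> (0 : R).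
Proof.
move=> f1; apply: norm_cvg0.
apply: (@squeeze_cvgr _ _ _ _ (cst 0) gauss); [|exact: cvg_cst|exact: cvg_gauss].
by near=> x; rewrite normr_ge0/= normrM (ger0_norm (gauss_ge0 x)) ler_piMl ?gauss_ge0.
Unshelve. all: by end_near. Qed.

Lemma norm_sin_le1 x : `|sin x| <= 1.
Proof. by rewrite ler_norml sin_geN1 sin_le1. Qed.

Lemma norm_cos_le1 x : `|cos x| <= 1.
Proof. by rewrite ler_norml cos_geN1 cos_le1. Qed.

Lemma integral_id_gauss : \int[leb]_(x in hl) (x * gauss x) = 1.
Proof.
have := @integral_improper_FTC R (fun x => - gauss x) (fun x => x * gauss x) 0.
rewrite gauss0 opprK add0r; apply.
- by move=> x; apply: is_derive_eq; rewrite mulNr opprK.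
- by move=> x; apply: cvgM; [exact: cvg_id|exact: continuous_gauss].
- apply: (@integrable_le_gauss 1 1).
    by apply: measurable_funM => //; exact: measurable_gauss.
  by move=> x x0; rewrite mul1r expr1 ger0_norm// mulr_ge0 ?gauss_ge0.
- by rewrite -oppr0; apply: cvgN; exact: cvg_gauss.
Qed.

(* [cosg t + i sing t] is the function A(t) of the header; it solves the
   differential equation A'(t) = i - t A(t). *)
Definition cosg t := \int[leb]_(x in hl) (cos (t * x) * gauss x).
Definition sing t := \int[leb]_(x in hl) (sin (t * x) * gauss x).

Lemma measurable_cosM t : measurable_fun setT (fun x : R => cos (t * x)).
Proof.
apply: continuous_measurable_fun => x.
by apply: (@continuous_comp _ _ _ ( *%R t) cos); [exact: mulrl_continuous|exact: continuous_cos].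
Qed.

Lemma measurable_sinM t : measurable_fun setT (fun x : R => sin (t * x)).
Proof.
apply: continuous_measurable_fun => x.
by apply: (@continuous_comp _ _ _ ( *%R t) sin); [exact: mulrl_continuous|exact: continuous_sin].
Qed.

Lemma integrable_cosg t (n : nat) :
  leb.-integrable hl (EFin \o (fun x => x ^+ n * (cos (t * x) * gauss x))).
Proof.
apply: (@integrable_le_gauss n 1).
  apply: measurable_funM => //; apply: measurable_funM; last exact: measurable_gauss.
  exact: measurable_cosM.
move=> x x0; rewrite mul1r normrM ger0_norm ?exprn_ge0// ler_wpM2l ?exprn_ge0//.
by rewrite normrM (ger0_norm (gauss_ge0 x)) ler_piMl ?gauss_ge0 ?norm_cos_le1.
Qed.

Lemma integrable_sing t (n : nat) :
  leb.-integrable hl (EFin \o (fun x => x ^+ n * (sin (t * x) * gauss x))).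
Proof.
apply: (@integrable_le_gauss n 1).
  apply: measurable_funM => //; apply: measurable_funM; last exact: measurable_gauss.
  exact: measurable_sinM.
move=> x x0; rewrite mul1r normrM ger0_norm ?exprn_ge0// ler_wpM2l ?exprn_ge0//.
by rewrite normrM (ger0_norm (gauss_ge0 x)) ler_piMl ?gauss_ge0 ?norm_sin_le1.
Qed.

Let integrable_cosg0 t : leb.-integrable hl (EFin \o (fun x => cos (t * x) * gauss x)).
Proof.
have -> : (fun x => cos (t * x) * gauss x) = (fun x => x ^+ 0 * (cos (t * x) * gauss x)).
  by apply/funext => x; rewrite mul1r.
exact: integrable_cosg.
Qed.

Let integrable_sing0 t : leb.-integrable hl (EFin \o (fun x => sin (t * x) * gauss x)).
Proof.
have -> : (fun x => sin (t * x) * gauss x) = (fun x => x ^+ 0 * (sin (t * x) * gauss x)).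
  by apply/funext => x; rewrite mul1r.
exact: integrable_sing.
Qed.

Let integrable_id_gauss : leb.-integrable hl (EFin \o (fun x => x * gauss x)).
Proof.
apply: (@integrable_le_gauss 1 1).
  by apply: measurable_funM => //; exact: measurable_gauss.
by move=> x x0; rewrite mul1r expr1 ger0_norm// mulr_ge0 ?gauss_ge0.
Qed.

(** Integration by parts: the derivative of [- cos (t * x) * gauss x] in x has one term for each of
    the two integrals. This is half of the differential equation of A. *)
Lemma integral_id_cosg t :
  \int[leb]_(x in hl) (x * (cos (t * x) * gauss x)) = 1 - t * sing t.
Proof.
have i1 := integrable_cosg t 1; have i2 := integrable_sing0 t.
have := @integral_improper_FTC R (fun x => - (cos (t * x) * gauss x))
  (fun x => t * (sin (t * x) * gauss x) + x ^+ 1 * (cos (t * x) * gauss x)) 0.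
rewrite RintegralD//; last first.
  exact: integrableZlR.
rewrite RintegralZl// mulr0 cos0 mul1r gauss0 opprK add0r.
rewrite -/(sing t) => H.
apply/eqP; rewrite eq_sym subr_eq addrC eq_sym; apply/eqP; apply: H.
- move=> x; apply: is_derive_eq.
  by rewrite /GRing.scale/=; ring.
- move=> x; apply: cvgD; apply: cvgM; try exact: cvg_cst.
  + apply: cvgM; last exact: continuous_gauss.
    by apply: (@continuous_comp _ _ _ ( *%R t) sin); [exact: mulrl_continuous|exact: continuous_sin].
  + exact: exprn_continuous.
  + apply: cvgM; last exact: continuous_gauss.
    by apply: (@continuous_comp _ _ _ ( *%R t) cos); [exact: mulrl_continuous|exact: continuous_cos].
- by apply: integrableDR => //; exact: integrableZlR.
- by rewrite -oppr0; apply: cvgN; apply: cvg_bounded_gauss => x; exact: norm_cos_le1.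
Qed.

Lemma integral_id_sing t :
  \int[leb]_(x in hl) (x * (sin (t * x) * gauss x)) = t * cosg t.
Proof.
have i1 := integrable_sing t 1; have i2 := integrable_cosg0 t.
have := @integral_improper_FTC R (fun x => - (sin (t * x) * gauss x))
  (fun x => x ^+ 1 * (sin (t * x) * gauss x) - t * (cos (t * x) * gauss x)) 0.
rewrite RintegralB//; last exact: integrableZlR.
rewrite RintegralZl// mulr0 sin0 mul0r oppr0 subrr -/(cosg t) => H.
apply/eqP; rewrite -subr_eq0; apply/eqP; apply: H.
- move=> x; apply: is_derive_eq.
  by rewrite /GRing.scale/=; ring.
- move=> x; apply: cvgB; apply: cvgM; try exact: cvg_cst.
  + exact: exprn_continuous.
  + apply: cvgM; last exact: continuous_gauss.
    by apply: (@continuous_comp _ _ _ ( *%R t) sin); [exact: mulrl_continuous|exact: continuous_sin].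
  + apply: cvgM; last exact: continuous_gauss.
    by apply: (@continuous_comp _ _ _ ( *%R t) cos); [exact: mulrl_continuous|exact: continuous_cos].
- by apply: integrableBR => //; exact: integrableZlR.
- by rewrite -oppr0; apply: cvgN; apply: cvg_bounded_gauss => x; exact: norm_sin_le1.
Qed.

Lemma is_derive_cosg t : is_derive t 1 cosg (- (t * cosg t)).
Proof.
rewrite -integral_id_sing -mulN1r -RintegralZl//; last exact: (integrable_sing t 1).
apply: (@is_derive_param_integral R _ _ leb hl (fun t x => cos (t * x) * gauss x)
  (fun t x => -1 * (x * (sin (t * x) * gauss x))) (fun x => `|x| * gauss x)) => //.
- move=> s x _; apply: is_derive_eq.
  by rewrite /GRing.scale/=; ring.
- by move=> x; rewrite mulr_ge0 ?gauss_ge0.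
- apply: (@integrable_le_gauss 1 1).
    by apply: measurable_funM => //; exact: measurable_gauss.
  by move=> x x0; rewrite mul1r expr1 normrM normr_id !ger0_norm ?gauss_ge0.
- move=> s x _; rewrite mulN1r normrN normrM ler_wpM2l// normrM (ger0_norm (gauss_ge0 x)).
  by rewrite ler_piMl ?gauss_ge0 ?norm_sin_le1.
Qed.

Lemma is_derive_sing t : is_derive t 1 sing (1 - t * sing t).
Proof.
rewrite -integral_id_cosg.
apply: (@is_derive_param_integral R _ _ leb hl (fun t x => sin (t * x) * gauss x)
  (fun t x => x * (cos (t * x) * gauss x)) (fun x => `|x| * gauss x)) => //.
- move=> s x _; apply: is_derive_eq.
  by rewrite /GRing.scale/=; ring.
- by move=> x; rewrite mulr_ge0 ?gauss_ge0.
- apply: (@integrable_le_gauss 1 1).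
    by apply: measurable_funM => //; exact: measurable_gauss.
  by move=> x x0; rewrite mul1r expr1 normrM normr_id !ger0_norm ?gauss_ge0.
- move=> s x _; rewrite normrM ler_wpM2l// normrM (ger0_norm (gauss_ge0 x)).
  by rewrite ler_piMl ?gauss_ge0 ?norm_cos_le1.
Qed.

#[local] Existing Instance is_derive_cosg.
#[local] Existing Instance is_derive_sing.

Definition egauss x := expR (x ^+ 2 / 2).

Lemma gaussV x : gauss x * egauss x = 1.
Proof. by rewrite /gauss /egauss mulNr expRN mulVf// gt_eqF// expR_gt0. Qed.

Lemma continuous_egauss : continuous egauss.
Proof.
move=> x; apply: (@continuous_comp _ _ _ (fun x : R => x ^+ 2 / 2) expR).
  by apply: cvgMl; exact: exprn_continuous.
exact: continuous_expR.
Qed.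

Lemma is_derive_egauss (x : R) : is_derive x 1 egauss (x * egauss x).
Proof.
rewrite /egauss; apply: is_derive_eq.
by rewrite /GRing.scale/=; field.
Qed.
#[local] Existing Instance is_derive_egauss.

(** The equation [cosg' = - t cosg] makes [cosg * egauss] constant; its value is read off at 0. *)
Lemma cosgE t : cosg t = Num.sqrt (pi / 2) * gauss t.
Proof.
have : cosg t * egauss t = cosg 0 * egauss 0.
  apply: (@is_derive_0_is_cst _ (fun t => cosg t * egauss t)) => x.
  by apply: is_derive_eq; rewrite /GRing.scale/=; ring.
rewrite {2}/egauss expr0n/= mul0r expR0 mulr1.
have -> : cosg 0 = Num.sqrt (pi / 2).
  rewrite /cosg; under eq_Rintegral do rewrite mul0r cos0 mul1r.
  by rewrite /Rintegral integral_gauss.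
by move=> <-; rewrite -mulrA [egauss _ * _]mulrC gaussV mulr1.
Qed.

(** With [sing0] this identifies [sing] as a Dawson function, sing t = exp(-t^2/2) times the
    integral of exp(s^2/2) over [0, t]. It is the link to [Phi] on the imaginary axis. *)
Lemma is_derive_sing_egauss (c x : R) :
  is_derive x 1 (fun x => sing (c * x) * egauss (c * x)) (c * egauss (c * x)).
Proof.
apply: is_derive_eq; rewrite /GRing.scale/=; ring.
Qed.

Lemma sing0 : sing 0 = 0.
Proof.
rewrite /sing; under eq_Rintegral do rewrite mul0r sin0 mul0r.
by rewrite Rintegral_cst// mul0r.
Qed.

Lemma integral_egauss (c a b : R) : a < b ->
  (\int[leb]_(x in `[a, b]) (c * egauss (c * x))%:E)%E =
  (sing (c * b) * egauss (c * b) - sing (c * a) * egauss (c * a))%:E.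
Proof.
move=> ab; apply: (@integral_FTC R (fun x => sing (c * x) * egauss (c * x))) => //.
  exact: is_derive_sing_egauss.
move=> x; apply: cvgM; first exact: cvg_cst.
by apply: (@continuous_comp _ _ _ ( *%R c) egauss); [exact: mulrl_continuous|exact: continuous_egauss].
Qed.

Lemma singN t : sing (- t) = - sing t.
Proof.
rewrite /sing; under eq_Rintegral do rewrite mulNr sinN mulNr -mulN1r.
by rewrite RintegralZl// mulN1r.
Qed.

Lemma sing_ge0 t : 0 <= t -> 0 <= sing t.
Proof.
move=> t0; have := @integral_egauss t 0 1 ltr01.
rewrite mulr1 mulr0 sing0 mul0r subr0 => E.
rewrite -(pmulr_lge0 _ (expR_gt0 (t ^+ 2 / 2))) -lee_fin -E.
by apply: integral_ge0 => x _; rewrite lee_fin mulr_ge0// expR_ge0.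
Qed.

(** On [0, 1] the integrand of [integral_egauss] is at most its value at the right end. *)
Lemma sing_le t : 0 <= t -> sing t <= t.
Proof.
move=> t0; have := @integral_egauss t 0 1 ltr01.
rewrite mulr1 mulr0 sing0 mul0r subr0 => E.
rewrite -(ler_pM2r (expR_gt0 (t ^+ 2 / 2))) -lee_fin -E.
have -> : (t * expR (t ^+ 2 / 2))%:E = (\int[leb]_(x in `[0%R, 1%R]) (t * egauss t)%:E)%E.
  by rewrite integral_cst//= lebesgue_measure_itv/= lte01 sube0 mule1.
apply: ge0_le_integral => //.
- by move=> x _; rewrite lee_fin mulr_ge0// expR_ge0.
- apply/measurable_EFinP/measurable_funTS/measurable_funM => //.
  apply: continuous_measurable_fun => x.
  by apply: (@continuous_comp _ _ _ ( *%R t) egauss); [exact: mulrl_continuous|exact: continuous_egauss].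
- move=> x; rewrite /= in_itv/= => /andP[x0 x1]; rewrite lee_fin ler_wpM2l//.
  rewrite ler_expR ler_pM2r ?invr_gt0// ler_pXn2r// ?nnegrE ?mulr_ge0//.
  by rewrite ler_piMr.
Qed.

(** By [integral_id_cosg], 1 - t sing t is a cosine integral of absolute value at most the integral
    of x gauss x, which is 1. This is the source of the 1/t decay of [sing]. *)
Lemma mul_sing_le t : t * sing t <= 2.
Proof.
rewrite -[t * _](subKr 1) -integral_id_cosg.
have : `|\int[leb]_(x in hl) (x * (cos (t * x) * gauss x))| <= 1.
  rewrite -integral_id_gauss; have i1 := integrable_cosg t 1.
  apply: (le_trans (le_normr_Rintegral _ _)) => //.
  apply: le_Rintegral => //; first exact: integrable_norm i1.
  move=> x; rewrite /= in_itv/= andbT => x0.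
  rewrite normrM ger0_norm// ler_wpM2l// normrM (ger0_norm (gauss_ge0 x)).
  by rewrite ler_piMl ?gauss_ge0 ?norm_cos_le1.
rewrite ler_norml => /andP[+ _]; lra.
Qed.

End gauss_transform.

(** * Gaussian transforms over the orthant *)

Section dominated_fubini.
Context d1 d2 (T1 : measurableType d1) (T2 : measurableType d2) (R : realType).
Variables (m1 : {sigma_finite_measure set T1 -> \bar R})
          (m2 : {sigma_finite_measure set T2 -> \bar R}).
Variables (A : set T1) (B : set T2) (f : T1 * T2 -> R) (g1 : T1 -> R) (g2 : T2 -> R).
Hypotheses (mA : measurable A) (mB : measurable B) (mf : measurable_fun setT f).
Hypotheses (ig1 : m1.-integrable A (EFin \o g1)) (ig2 : m2.-integrable B (EFin \o g2)).
Hypothesis fg : forall x y, A x -> B y -> `|f (x, y)| <= g1 x * g2 y.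

(** Extension by zero outside the rectangle turns Fubini on [A] and [B] into Fubini on the whole
    product space. *)
Let h : T1 * T2 -> \bar R := (EFin \o f) \_ (A `*` B).

Let mh : measurable_fun setT h.
Proof.
apply/(measurable_restrictT _ _).1; first exact: measurableX.
exact/measurable_EFinP/measurable_funTS.
Qed.

Let g1' := (EFin \o g1) \_ A.
Let g2' := (EFin \o g2) \_ B.

Let hE x y : h (x, y) = if (x \in A) && (y \in B) then (f (x, y))%:E else 0%E.
Proof.
rewrite /h patchE; congr (if _ then _ else _).
by apply/idP/andP; rewrite !inE.
Qed.

Let hg x y : (`|h (x, y)| <= `|g1' x| * `|g2' y|)%E.
Proof.
rewrite hE /g1' /g2' !patchE; case: ifPn => [/andP[xA yB]|_].
  rewrite xA yB /= -EFinM lee_fin -normrM (le_trans (fg _ _)) ?ler_norm//.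
    exact: set_mem.
  exact: set_mem.
by rewrite abse0; apply: mule_ge0; exact: abse_ge0.
Qed.

Let ig1' : m1.-integrable setT g1'. Proof. exact/(integrable_mkcond _ mA). Qed.
Let ig2' : m2.-integrable setT g2'. Proof. exact/(integrable_mkcond _ mB). Qed.

Let ih : (m1 \x m2)%E.-integrable setT h.
Proof.
apply/integrable12ltyP => //.
have /integrableP[mg1 g1oo] := ig1'; have /integrableP[mg2 g2oo] := ig2'.
apply: (@le_lt_trans _ _ (\int[m1]_x (`|g1' x| * \int[m2]_y `|g2' y|))%E).
  apply: ge0_le_integral => //.
  - by move=> x _; exact: integral_ge0.
  - apply: (@measurable_fun_fubini_tonelli_F _ _ _ _ _ m2 (abse \o h)).
      exact: measurableT_comp.
    by move=> z /=; exact: abse_ge0.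
  - apply: emeasurable_funM => //; exact: measurableT_comp.
  - move=> x _; rewrite -ge0_integralZl//; last exact: measurableT_comp.
    apply: ge0_le_integral => //.
    + apply: measurableT_comp => //; apply: (measurableT_comp mh).
      exact: measurable_pair1.
    + by apply: measurable_funeM; exact: measurableT_comp.
rewrite ge0_integralZr//; last 2 first.
- exact: measurableT_comp.
- exact: integral_ge0.
apply: lte_mul_pinfty => //; first exact: integral_ge0.
by rewrite ge0_fin_numE//; exact: integral_ge0.
Qed.

Lemma integrable_section1 x : A x -> m2.-integrable B (fun y => (f (x, y))%:E).
Proof.
move=> Ax; apply: (@integrable_le_norm _ _ _ _ _ mB _ (fun y => g1 x * g2 y)).
- by apply: measurable_funTS; apply: (measurableT_comp mf); exact: measurable_pair1.
- by move=> y By; exact: fg.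
- exact: integrableZlR.
Qed.

Lemma integrable_section2 y : B y -> m1.-integrable A (fun x => (f (x, y))%:E).
Proof.
move=> By; apply: (@integrable_le_norm _ _ _ _ _ mA _ (fun x => g2 y * g1 x)).
- by apply: measurable_funTS; apply: (measurableT_comp mf); exact: measurable_pair2.
- by move=> x Ax; rewrite mulrC; exact: fg.
- exact: integrableZlR.
Qed.

Let F1 x : (\int[m2]_y h (x, y))%E =
  ((fun x => (\int[m2]_(y in B) f (x, y))%:E) \_ A) x.
Proof.
rewrite patchE; case: ifPn => xA.
  rewrite [in RHS]/Rintegral fineK; last exact/integrable_fin_num/integrable_section1/set_mem.
  rewrite [in RHS]integral_mkcond; apply: eq_integral => y _.
  by rewrite hE xA patchE.
by apply: integral0_eq => y _; rewrite hE (negbTE xA).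
Qed.

Let F2 y : (\int[m1]_x h (x, y))%E =
  ((fun y => (\int[m1]_(x in A) f (x, y))%:E) \_ B) y.
Proof.
rewrite patchE; case: ifPn => yB.
  rewrite [in RHS]/Rintegral fineK; last exact/integrable_fin_num/integrable_section2/set_mem.
  rewrite [in RHS]integral_mkcond; apply: eq_integral => x _.
  by rewrite hE yB andbT patchE.
by apply: integral0_eq => x _; rewrite hE (negbTE yB) andbF.
Qed.

Lemma Rintegral_Fubini : \int[m1]_(x in A) \int[m2]_(y in B) f (x, y) =
  \int[m2]_(y in B) \int[m1]_(x in A) f (x, y).
Proof.
rewrite /Rintegral [in LHS]integral_mkcond [in RHS]integral_mkcond.
congr fine; transitivity (\int[m1]_x \int[m2]_y h (x, y))%E.
  by apply: eq_integral => x _; rewrite F1.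
by rewrite (Fubini ih); apply: eq_integral => y _; rewrite F2.
Qed.

End dominated_fubini.

(** * Exchange of frequency and orthant integrals *)

Section orthant_transform.
Context (R : realType).
Local Notation T := (measurableTypeR R).
Local Notation leb := (@lebesgue_measure R).
Local Notation ltuple := (lebesgue_tuple R).
Local Notation hl := (`[0%R, +oo[%classic : set R).
Implicit Types s x : R.

Lemma norm_sin_le x : `|sin x| <= `|x|.
Proof.
wlog x0 : x / 0 <= x => [H|].
  by have [/H//|/ltW x0] := leP 0 x; rewrite -normrN -sinN -[leRHS]normrN H// oppr_ge0.
have [|c _] := @MVT_segment R sin cos 0 x x0.
  by apply: continuous_subspaceT => y; exact: continuous_sin.
by rewrite sin0 !subr0 => ->; rewrite normrM ler_piMl// norm_cos_le1.
Qed.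

(** Inversion is not continuous at 0, so it is expressed through the measurable real power; both
    expressions vanish at 0. *)
Lemma measurable_invr : measurable_fun setT (fun x : R => x^-1).
Proof.
rewrite (_ : (fun x : R => x^-1) = (fun x => x * (x ^+ 2) `^ (-1))).
  apply: measurable_funM => //.
  by apply: (measurableT_comp (measurable_powR (-1))); exact: measurable_funX.
apply/funext => x; rewrite powR_inv1 ?sqr_ge0//.
by have [->|x0] := eqVneq x 0; [rewrite invr0 mul0r|field].
Qed.

Definition tsum n (t : n.-tuple T) : R := \sum_(k < n) tnth t k.
Definition tgauss n (t : n.-tuple T) : R := \prod_(k < n) gauss (tnth t k).

Lemma measurable_tsum n : measurable_fun setT (@tsum n).
Proof. exact: measurable_sum_tuple. Qed.

Lemma measurable_tgauss n : measurable_fun setT (@tgauss n).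
Proof.
apply: (@measurable_prod _ _ _ _ _ (index_enum 'I_n) (fun k t => gauss (tnth t k))) => k _.
by apply: (measurableT_comp (@measurable_gauss R)); exact: measurable_tnth.
Qed.

Lemma tgauss_ge0 n (t : n.-tuple T) : 0 <= tgauss t.
Proof. by apply: prodr_ge0 => k _; exact: gauss_ge0. Qed.

Lemma integrable_tuple_prod (A : set R) n (h : R -> R) : measurable A ->
  measurable_fun setT h -> (forall x, 0 <= h x) -> leb.-integrable A (EFin \o h) ->
  (ltuple n).-integrable (box A n) (fun t => (\prod_(k < n) h (tnth t k))%:E).
Proof.
move=> mA mh h0 /integrableP[_ hoo]; apply/integrableP; split.
  apply/measurable_EFinP/measurable_funTS.
  apply: (@measurable_prod _ _ _ _ _ (index_enum 'I_n) (fun k t => h (tnth t k))) => k _.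
  by apply: measurableT_comp => //; exact: measurable_tnth.
under eq_integral do rewrite gee0_abs ?lee_fin ?prodr_ge0//.
rewrite ge0_integral_box_prod ?ltry//.
by under eq_integral do rewrite -[(h _)%:E]gee0_abs ?lee_fin//.
Qed.

Lemma integrable_tgauss n : (ltuple n).-integrable (box hl n) (EFin \o @tgauss n).
Proof.
apply: (@integrable_tuple_prod hl n gauss) => //.
- exact: measurable_gauss.
- exact: gauss_ge0.
- exact: integrable_gauss.
Qed.

(** Multiplicativity of exp(i s x), in coordinates: the phases add up to the sum of the entries. *)
Lemma tuple_cprod_gauss s n (t : n.-tuple T) :
  tuple_cprod (fun x => cos (s * x) * gauss x) (fun x => sin (s * x) * gauss x) t =
  (cos (s * tsum t) * tgauss t) +i* (sin (s * tsum t) * tgauss t).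
Proof.
rewrite /tuple_cprod /tsum /tgauss.
elim/big_ind3 : _ => [|x1 y1 z1 x2 y2 z2 -> ->|k _ //].
  by rewrite mulr0 cos0 sin0 !mulr1.
by rewrite mulrDr cosD sinD; congr (_ +i* _); ring.
Qed.

Lemma integral_cos_tgauss s n :
  \int[ltuple n]_(t in box hl n) (cos (s * tsum t) * tgauss t) =
    complex.Re ((cosg s +i* sing s) ^+ n) /\
  \int[ltuple n]_(t in box hl n) (sin (s * tsum t) * tgauss t) =
    complex.Im ((cosg s +i* sing s) ^+ n).
Proof.
have i0 (g : R -> R) : measurable_fun setT g -> (forall x, `|g x| <= 1) ->
    leb.-integrable hl (EFin \o (fun x => g x * gauss x)).
  move=> mg g1; apply: (@integrable_le_gauss R 0 1).
    by apply: measurable_funM => //; exact: measurable_gauss.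
  by move=> x x0; rewrite !mul1r normrM (ger0_norm (gauss_ge0 x)) ler_piMl ?gauss_ge0.
have [_ _] := @integral_tuple_cprod R hl _ _ n (measurable_itv _)
  (i0 _ (measurable_cosM s) (fun x => norm_cos_le1 _))
  (i0 _ (measurable_sinM s) (fun x => norm_sin_le1 _)).
rewrite -/(cosg s) -/(sing s) => <- /=.
by split; apply: eq_Rintegral => t _; rewrite tuple_cprod_gauss.
Qed.

Section kernel.
Variables (n : nat) (w : R -> R).
Hypotheses (mw : measurable_fun setT w) (iw : leb.-integrable hl (EFin \o w)).

Let mfst : measurable_fun setT (fun p : T * n.-tuple T => w p.1).
Proof. by apply: (measurableT_comp mw); exact: measurable_fst. Qed.

Let mtg : measurable_fun setT (fun p : T * n.-tuple T => tgauss p.2).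
Proof. by apply: (measurableT_comp (@measurable_tgauss n)); exact: measurable_snd. Qed.

Let mprod : measurable_fun setT (fun p : T * n.-tuple T => p.1 * tsum p.2).
Proof.
apply: measurable_funM => //.
by apply: (measurableT_comp (@measurable_tsum n)); exact: measurable_snd.
Qed.

Let f (p : T * n.-tuple T) := w p.1 * (cos (p.1 * tsum p.2) * tgauss p.2).

Let mf : measurable_fun setT f.
Proof.
apply: measurable_funM => //; apply: measurable_funM => //.
apply: (@measurableT_comp _ _ _ _ _ _ cos _ (fun p : T * n.-tuple T => p.1 * tsum p.2)) => //.
by apply: continuous_measurable_fun; exact: continuous_cos.
Qed.

Let fg x y : hl x -> box hl n y -> `|f (x, y)| <= `|w x| * tgauss y.
Proof.
move=> _ _; rewrite /f/= normrM ler_wpM2l// normrM (ger0_norm (tgauss_ge0 _)).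
by rewrite ler_piMl ?tgauss_ge0 ?norm_cos_le1.
Qed.

(** Fubini, with majorant |w| times the Gaussian on the orthant. For a fixed frequency the orthant
    integral factorizes into the n-th power of A. *)
Lemma orthant_cos_transform :
  \int[ltuple n]_(t in box hl n) (\int[leb]_(x in hl) (cos (x * tsum t) * w x) * tgauss t) =
  \int[leb]_(x in hl) (w x * complex.Re ((cosg x +i* sing x) ^+ n)).
Proof.
have mhl : measurable (hl : set T) by exact: measurable_itv.
have mb : measurable (box hl n) by exact: measurable_box.
have iaw : leb.-integrable hl (EFin \o (fun x => `|w x|)) by exact: integrable_norm iw.
have := Rintegral_Fubini mhl mb mf iaw (integrable_tgauss n) fg.
have it x : (ltuple n).-integrable (box hl n)
    (EFin \o (fun t : n.-tuple T => cos (x * tsum t) * tgauss t)).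
  apply: (integrable_le_norm mb _ _ (integrable_tgauss n)).
    apply/measurable_funTS/measurable_funM; last exact: measurable_tgauss.
    apply: (measurableT_comp (measurable_cosM x)).
    exact: measurable_tsum.
  move=> t _; rewrite normrM (ger0_norm (tgauss_ge0 _)).
  by rewrite ler_piMl ?tgauss_ge0 ?norm_cos_le1.
under eq_Rintegral => x _.
  rewrite /f/= RintegralZl//= (integral_cos_tgauss x n).1.
  over.
move=> ->; apply: eq_Rintegral => t _; rewrite -RintegralZr//.
  by apply: eq_Rintegral => x _; rewrite /f/= mulrCA mulrA.
apply: (integrable_le_norm mhl _ _ iaw).
  apply/measurable_funTS/measurable_funM => //.
  by have := measurable_cosM (tsum t); under eq_fun do rewrite mulrC.
by move=> x _; rewrite normrM ler_piMl ?norm_cos_le1.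
Qed.

End kernel.

Section sine_kernel.
Variables (n : nat) (w : R -> R).
Hypotheses (mw : measurable_fun setT w) (iw : leb.-integrable hl (EFin \o w)).

(** The sine kernel is bounded only by the sum of the entries. Since the entries are nonnegative,
    the product of the 1 + t_k dominates this sum, and a majorant of product form is integrable
    factor by factor. *)
Let g2 (t : n.-tuple T) := \prod_(k < n) (`|1 + tnth t k| * gauss (tnth t k)).

Let mh : measurable_fun setT (fun x : R => `|1 + x| * gauss x).
Proof.
apply: measurable_funM; last exact: measurable_gauss.
by apply: measurableT_comp => //; exact: measurable_funD.
Qed.

Let ig2 : (ltuple n).-integrable (box hl n) (EFin \o g2).
Proof.
apply: (@integrable_tuple_prod hl n (fun x => `|1 + x| * gauss x)) => //.
- by move=> x; rewrite mulr_ge0 ?gauss_ge0.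
- have mhl : measurable (hl : set T) by exact: measurable_itv.
  apply: (integrable_le_norm mhl (g := fun x => x ^+ 0 * gauss x + x ^+ 1 * gauss x)).
  + exact: measurable_funTS.
  + move=> x /=; rewrite in_itv/= andbT => x0.
    rewrite ger0_norm ?mulr_ge0 ?gauss_ge0// ger0_norm ?addr_ge0//.
    by rewrite mulrDl expr0 expr1.
  + apply: integrableDR => //; apply: (@integrable_le_gauss R _ 1);
      try (move=> x x0; rewrite mul1r ger0_norm ?mulr_ge0 ?exprn_ge0 ?gauss_ge0 //; reflexivity);
      by apply: measurable_funM => //; exact: measurable_gauss.
Qed.

Lemma tsum_le_prod (t : n.-tuple T) : box hl n t -> 0 <= tsum t <= \prod_(k < n) `|1 + tnth t k|.
Proof.
move=> tb; have t0 k : 0 <= tnth t k by have := tb k; rewrite /= in_itv/= andbT.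
rewrite sumr_ge0//=.
suff : 1 + tsum t <= \prod_(k < n) `|1 + tnth t k|.
  by apply: le_trans; rewrite lerDr.
have /andP[//] : (0 <= tsum t) && (1 + tsum t <= \prod_(k < n) `|1 + tnth t k|).
rewrite /tsum; elim/big_rec2 : _ => [|k y z _ /andP[z0 zy]]; first by rewrite addr0 !lexx.
rewrite addr_ge0//= ger0_norm ?addr_ge0//.
rewrite (le_trans _ (ler_wpM2l _ zy)) ?addr_ge0//.
by have := mulr_ge0 (t0 k) z0; lra.
Qed.

Let f (p : T * n.-tuple T) := w p.1 * (p.1^-1 * sin (p.1 * tsum p.2) * tgauss p.2).

Let mf : measurable_fun setT f.
Proof.
have mV : measurable_fun setT (fun x : R => x^-1) by exact: measurable_invr.
apply: measurable_funM; first by apply: (measurableT_comp mw); exact: measurable_fst.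
apply: measurable_funM; last by apply: (measurableT_comp (@measurable_tgauss n)); exact: measurable_snd.
apply: measurable_funM; first by apply: (measurableT_comp mV); exact: measurable_fst.
apply: (@measurableT_comp _ _ _ _ _ _ sin _ (fun p : T * n.-tuple T => p.1 * tsum p.2)) => //.
  by apply: continuous_measurable_fun; exact: continuous_sin.
apply: measurable_funM => //.
by apply: (measurableT_comp (@measurable_tsum n)); exact: measurable_snd.
Qed.

Let norm_sinc x s : 0 <= x -> 0 <= s -> `|x^-1 * sin (x * s)| <= s.
Proof.
(* At x = 0 the convention that the inverse of 0 is 0 makes the kernel vanish. *)
move=> x0 s0; have [->|xn0] := eqVneq x 0; first by rewrite mul0r sin0 mulr0 normr0.
have xp : 0 < x by rewrite lt_neqAle eq_sym xn0.
rewrite normrM gtr0_norm ?invr_gt0// mulrC ler_pdivrMr//.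
by rewrite (le_trans (norm_sin_le _))// ger0_norm ?mulr_ge0// mulrC.
Qed.

Let fg x y : hl x -> box hl n y -> `|f (x, y)| <= `|w x| * g2 y.
Proof.
rewrite /= in_itv/= andbT => x0 yb; rewrite /f/= normrM ler_wpM2l//.
have /andP[s0 sle] := tsum_le_prod yb.
rewrite normrM (ger0_norm (tgauss_ge0 _)) /g2 big_split/= ler_wpM2r ?tgauss_ge0//.
exact: le_trans (norm_sinc x0 s0) sle.
Qed.

Lemma orthant_sin_transform :
  \int[ltuple n]_(t in box hl n) (\int[leb]_(x in hl) (x^-1 * sin (x * tsum t) * w x) * tgauss t) =
  \int[leb]_(x in hl) (w x * (x^-1 * complex.Im ((cosg x +i* sing x) ^+ n))).
Proof.
have mhl : measurable (hl : set T) by exact: measurable_itv.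
have mb : measurable (box hl n) by exact: measurable_box.
have iaw : leb.-integrable hl (EFin \o (fun x => `|w x|)) by exact: integrable_norm iw.
have mV : measurable_fun setT (fun x : R => x^-1) by exact: measurable_invr.
have := Rintegral_Fubini mhl mb mf iaw ig2 fg.
have it x : (ltuple n).-integrable (box hl n)
    (EFin \o (fun t : n.-tuple T => sin (x * tsum t) * tgauss t)).
  apply: (integrable_le_norm mb _ _ (integrable_tgauss n)).
    apply/measurable_funTS/measurable_funM; last exact: measurable_tgauss.
    apply: (measurableT_comp (measurable_sinM x)).
    exact: measurable_tsum.
  move=> t _; rewrite normrM (ger0_norm (tgauss_ge0 _)).
  by rewrite ler_piMl ?tgauss_ge0 ?norm_sin_le1.
under eq_Rintegral => x _.
  rewrite /f/=; under eq_Rintegral do rewrite -[_^-1 * _ * _]mulrA.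
  rewrite RintegralZl//=; last exact: integrableZlR.
  rewrite RintegralZl//= (integral_cos_tgauss x n).2.
  over.
move=> ->; apply: eq_Rintegral => t tb; rewrite -RintegralZr//.
  by apply: eq_Rintegral => x _; rewrite /f/= mulrCA mulrA.
have /andP[s0 _] := tsum_le_prod (set_mem tb).
apply: (integrable_le_norm mhl (g := fun x => tsum t * `|w x|)).
- apply/measurable_funTS/measurable_funM => //; apply: measurable_funM => //.
  by have := measurable_sinM (tsum t); under eq_fun do rewrite mulrC.
- move=> x /=; rewrite in_itv/= andbT => x0.
  by rewrite normrM ler_wpM2r// norm_sinc.
- exact: integrableZlR.
Qed.

End sine_kernel.

End orthant_transform.

(** * Gaussian and Gaussian-tail weights on the orthant *)

Section orthant_gaussian.
Context (R : realType).
Local Notation T := (measurableTypeR R).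
Local Notation leb := (@lebesgue_measure R).
Local Notation ltuple := (lebesgue_tuple R).
Local Notation hl := (`[0%R, +oo[%classic : set R).
Implicit Types s x k : R.

Lemma integral_scale_hl (c : R) (f : R -> R) : 0 < c -> measurable_fun setT f ->
  leb.-integrable hl (EFin \o f) ->
  (\int[leb]_(x in hl) (f (c * x))%:E = c^-1%:E * \int[leb]_(x in hl) (f x)%:E)%E.
Proof.
move=> c0 mf iF; have mhl : measurable (hl : set T) by exact: measurable_itv.
have mfe : measurable_fun setT (EFin \o f) by exact/measurable_EFinP.
have E (g : R -> \bar R) : measurable_fun setT g -> (forall x, (0 <= g x)%E) ->
    (\int[leb]_(x in hl) g (c * x)%R = c^-1%:E * \int[leb]_(x in hl) g x)%E.
  exact: ge0_integral_scale_itv0y.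
rewrite integralE [in RHS]integralE.
rewrite (_ : (fun x => (f (c * x))%:E) = (EFin \o f) \o ( *%R c))//.
rewrite funepos_comp funeneg_comp.
transitivity (c^-1%:E * \int[leb]_(x in hl) (EFin \o f)^\+ x -
              c^-1%:E * \int[leb]_(x in hl) (EFin \o f)^\- x)%E.
  by congr (_ - _)%E; apply: E => //; [exact: measurable_funepos|exact: measurable_funeneg].
apply/esym/muleBr => //; apply: fin_num_adde_defl.
by rewrite fin_numN; exact: (integrable_neg_fin_num mhl iF).
Qed.

Lemma Rintegral_scale_hl (c : R) (f : R -> R) : 0 < c -> measurable_fun setT f ->
  leb.-integrable hl (EFin \o f) ->
  \int[leb]_(x in hl) f (c * x) = c^-1 * \int[leb]_(x in hl) f x.
Proof.
move=> c0 mf iF; have mhl : measurable (hl : set T) by exact: measurable_itv.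
by rewrite /Rintegral integral_scale_hl// fineM// integrable_fin_num.
Qed.

Lemma integrable_scale_hl (c : R) (f : R -> R) : 0 < c -> measurable_fun setT f ->
  leb.-integrable hl (EFin \o f) -> leb.-integrable hl (EFin \o (fun x => f (c * x))).
Proof.
move=> c0 mf iF; apply/integrableP; split.
  by apply/measurable_EFinP/measurable_funTS/measurableT_comp.
rewrite (@integral_scale_hl c (fun x => `|f x|))//.
- have /integrableP[_ foo] := iF.
  apply: lte_mul_pinfty => //; first by rewrite lee_fin invr_ge0 ltW.
- exact: measurableT_comp.
- exact: integrable_norm iF.
Qed.

Let i_gauss (g : R -> R) : measurable_fun setT g -> (forall x, `|g x| <= 1) ->
    leb.-integrable hl (EFin \o (fun x => g x * gauss x)).
Proof.
move=> mg g1; apply: (@integrable_le_gauss R 0 1).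
  by apply: measurable_funM => //; exact: measurable_gauss.
by move=> x x0; rewrite !mul1r normrM (ger0_norm (gauss_ge0 x)) ler_piMl ?gauss_ge0.
Qed.

Let mgs (c : R) : measurable_fun setT (fun x => gauss (c * x)).
Proof. by apply: (measurableT_comp (@measurable_gauss R)); exact: mulrl_measurable. Qed.

Let igs (c : R) : 0 < c -> leb.-integrable hl (EFin \o (fun x => gauss (c * x))).
Proof.
by move=> c0; apply: integrable_scale_hl => //; [exact: measurable_gauss|exact: integrable_gauss].
Qed.

Lemma sqrt_pi2_gt0 : 0 < Num.sqrt (pi / 2) :> R.
Proof. by rewrite sqrtr_gt0 divr_gt0// pi_gt0. Qed.

(** The Gaussian is its own cosine transform; this is [cosgE] after rescaling the frequency by the
    square root of k. *)
Lemma gauss_fourier k s : 0 < k -> gauss (s / Num.sqrt k) =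
  Num.sqrt k / Num.sqrt (pi / 2) * \int[leb]_(x in hl) (cos (x * s) * gauss (Num.sqrt k * x)).
Proof.
move=> k0; have sk0 : 0 < Num.sqrt k by rewrite sqrtr_gt0.
have -> : \int[leb]_(x in hl) (cos (x * s) * gauss (Num.sqrt k * x)) =
    (Num.sqrt k)^-1 * cosg (s / Num.sqrt k).
  rewrite -Rintegral_scale_hl//.
  - apply: eq_Rintegral => x _; congr (cos _ * _); field.
    by rewrite gt_eqF.
  - apply: measurable_funM; [exact: measurable_cosM|exact: measurable_gauss].
  - by apply: i_gauss => [|x]; [exact: measurable_cosM|exact: norm_cos_le1].
by rewrite cosgE; field; rewrite !gt_eqF// sqrt_pi2_gt0.
Qed.

Lemma simplex_orthant_transform k n : 0 < k ->
  \int[ltuple n]_(t in box hl n) (gauss (tsum t / Num.sqrt k) * tgauss t) =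
  Num.sqrt k / Num.sqrt (pi / 2) *
    \int[leb]_(x in hl) (gauss (Num.sqrt k * x) * complex.Re ((cosg x +i* sing x) ^+ n)).
Proof.
move=> k0; have sk0 : 0 < Num.sqrt k by rewrite sqrtr_gt0.
rewrite -orthant_cos_transform//; last exact: igs.
have mb : measurable (box hl n) by exact: measurable_box.
rewrite -RintegralZl//.
  by apply: eq_Rintegral => t _; rewrite gauss_fourier// mulrA.
have m1 : measurable_fun setT (fun t : n.-tuple T => gauss (tsum t / Num.sqrt k) : R).
  apply: (measurableT_comp (@measurable_gauss R)).
  by apply: measurable_funM => //; exact: measurable_tsum.
have iE s : \int[leb]_(x in hl) (cos (x * s) * gauss (Num.sqrt k * x)) =
    Num.sqrt (pi / 2) / Num.sqrt k * gauss (s / Num.sqrt k).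
  by rewrite gauss_fourier//; field; rewrite !gt_eqF// sqrt_pi2_gt0.
apply: (integrable_le_norm mb (g := fun t => (Num.sqrt (pi / 2) / Num.sqrt k) * tgauss t)).
- apply/measurable_funTS/measurable_funM; last exact: measurable_tgauss.
  rewrite (_ : (fun t => _) = (fun t : n.-tuple T =>
      (Num.sqrt (pi / 2) / Num.sqrt k) * gauss (tsum t / Num.sqrt k))).
    exact: measurable_funM.
  by apply/funext => t; rewrite iE.
- move=> t _; rewrite normrM (ger0_norm (tgauss_ge0 _)) ler_wpM2r ?tgauss_ge0//.
  rewrite iE ger0_norm ?mulr_ge0 ?gauss_ge0 ?invr_ge0 ?sqrtr_ge0//.
  by rewrite ler_piMr ?gauss_le1// mulr_ge0 ?invr_ge0 ?sqrtr_ge0.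
- by apply: integrableZlR => //; exact: integrable_tgauss.
Qed.

(** The unnormalized Gaussian tail. The fixed domain of integration is the one that arises when a
    radial variable is shifted by the sum of the other coordinates. *)
Definition gtail s : R := \int[leb]_(x in hl) gauss (x + s).

Let isinc_hl s : leb.-integrable hl (EFin \o (fun x => x^-1 * sin (x * s) * gauss x)).
Proof.
have mhl : measurable (hl : set T) by exact: measurable_itv.
apply: (integrable_le_norm mhl (g := fun x => `|s| * gauss x)).
- apply/measurable_funTS/measurable_funM; last exact: measurable_gauss.
  apply: measurable_funM; first exact: measurable_invr.
  by have := measurable_sinM s; under eq_fun do rewrite mulrC.
- move=> x /=; rewrite in_itv/= andbT le_eqVlt => /predU1P[<-|x0].
    by rewrite invr0 !mul0r normr0 mulr_ge0 ?gauss_ge0.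
  rewrite normrM (ger0_norm (gauss_ge0 x)) ler_wpM2r ?gauss_ge0//.
  rewrite normrM gtr0_norm ?invr_gt0// mulrC ler_pdivrMr//.
  by rewrite (le_trans (norm_sin_le _))// normrM (gtr0_norm x0) mulrC.
- by apply: integrableZlR => //; exact: integrable_gauss.
Qed.

Let isinc s : leb.-integrable `]0%R, +oo[ (EFin \o (fun x => x^-1 * sin (x * s) * gauss x)).
Proof. by apply: integrableS (isinc_hl s) => // x; rewrite /= !in_itv/= !andbT => /ltW. Qed.

(** Differentiation in s cancels 1/x and leaves the cosine transform. The open half-line excludes x
    = 0, where the cancellation fails. *)
Lemma is_derive_sinc s :
  is_derive s 1 (fun s => \int[leb]_(x in `]0%R, +oo[) (x^-1 * sin (x * s) * gauss x)) (cosg s).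
Proof.
have mo : measurable (`]0%R, +oo[%classic : set T) by exact: measurable_itv.
have ig : leb.-integrable `]0%R, +oo[ (EFin \o (@gauss R)).
  by apply: integrableS (@integrable_gauss R) => // x; rewrite /= !in_itv/= !andbT => /ltW.
have ic t : leb.-integrable `]0%R, +oo[ (EFin \o (fun x => cos (t * x) * gauss x)).
  apply: (integrable_le_norm mo _ _ ig).
    by apply/measurable_funTS/measurable_funM; [exact: measurable_cosM|exact: measurable_gauss].
  by move=> x _; rewrite normrM (ger0_norm (gauss_ge0 x)) ler_piMl ?gauss_ge0 ?norm_cos_le1.
rewrite /cosg -Rintegral_itv_obnd_cbnd//.
apply: (@is_derive_param_integral R _ _ leb `]0%R, +oo[
  (fun s x => x^-1 * sin (x * s) * gauss x) (fun t x => cos (t * x) * gauss x) gauss) => //.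
- move=> t x; rewrite /= in_itv/= andbT => x0; apply: is_derive_eq.
  by rewrite /GRing.scale/= [t * x]mulrC; field; rewrite gt_eqF.
- exact: gauss_ge0.
- by move=> t x _; rewrite normrM (ger0_norm (gauss_ge0 x)) ler_piMl ?gauss_ge0 ?norm_cos_le1.
Qed.

Let q s := \int[leb]_(x in `]0%R, +oo[) (x^-1 * sin (x * s) * gauss x).

Let measurable_q : measurable_fun setT q.
Proof.
apply: continuous_measurable_fun => s.
by apply: differentiable_continuous; apply/derivable1_diffP; case: (is_derive_sinc s).
Qed.

Let q0 : q 0 = 0.
Proof.
rewrite /q; under eq_Rintegral do rewrite mulr0 sin0 mulr0 mul0r.
by rewrite Rintegral_cst ?mul0r//.
Qed.

Lemma gtail_itv s : gtail s = \int[leb]_(x in `[s, +oo[) gauss x.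
Proof.
have := @ge0_integral_affine R 1 s ((EFin \o gauss) \_ `[s, +oo[) (oner_neq0 _).
rewrite normr1 invr1 mul1e => E.
rewrite /gtail /Rintegral [in RHS]integral_mkcond -E; last 2 first.
- apply/(measurable_restrictT _ _).1 => //.
  by apply/measurable_EFinP/measurable_funTS; exact: measurable_gauss.
- by move=> x; rewrite patchE; case: ifP => // _; rewrite lee_fin gauss_ge0.
rewrite integral_mkcond; congr fine; apply: eq_integral => x _.
rewrite !patchE mul1r; congr (if _ then _ else _).
by apply/idP/idP; rewrite !inE/= !in_itv/= !andbT lerDr.
Qed.

(** By [is_derive_sinc] and [cosgE], [q s] is sqrt(pi/2) times the Gaussian integral over [0, s];
    the tail is the full half-line integral minus this part. *)
Let gtail_q s : 0 <= s -> gtail s = Num.sqrt (pi / 2) - (Num.sqrt (pi / 2))^-1 * q s.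
Proof.
have hl_gauss : \int[leb]_(x in hl) gauss x = Num.sqrt (pi / 2).
  by rewrite /Rintegral integral_gauss.
rewrite le_eqVlt => /predU1P[<-|s0].
  by rewrite q0 mulr0 subr0 /gtail; under eq_Rintegral do rewrite addr0.
have is_s : leb.-integrable `[s, +oo[ (EFin \o (@gauss R)).
  apply: integrableS (@integrable_gauss R) => // x; rewrite /= !in_itv/= !andbT.
  exact/le_trans/ltW.
have cE : @cosg R = (fun x => Num.sqrt (pi / 2) * gauss x) by apply/funext => x; exact: cosgE.
have := @integral_FTC R q (@cosg R) 0 s s0 is_derive_sinc.
rewrite q0 subr0 cE => /(_ _)/(congr1 fine)/= <-.
  rewrite -/(Rintegral _ _ _) RintegralZl//; last first.
    apply: integrableS (@integrable_gauss R) => // x; rewrite /= !in_itv/= !andbT.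
    by case/andP.
  rewrite mulKf ?gt_eqF ?sqrt_pi2_gt0// gtail_itv -hl_gauss Rintegral_itvB//.
  - by rewrite Rintegral_itv_obnd_cbnd//; apply: integrableS is_s => // x;
      rewrite /= !in_itv/= !andbT => /ltW.
  - exact: integrable_gauss.
  - by rewrite bnd_simp ltW.
by move=> x; apply: cvgMr; exact: continuous_gauss.
Qed.

Lemma gtail_ge0 s : 0 <= gtail s.
Proof. by apply: Rintegral_ge0 => x _; exact: gauss_ge0. Qed.

Lemma measurable_gauss_shift s : measurable_fun setT (fun x : R => gauss (x + s)).
Proof. by apply: (measurableT_comp (@measurable_gauss R)); exact: measurable_funD. Qed.

Lemma gauss_shift_le x s : 0 <= x -> 0 <= s -> gauss (x + s) <= gauss s * gauss x.
Proof.
move=> x0 s0; rewrite /gauss -expRD ler_expR.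
have := mulr_ge0 x0 s0; nra.
Qed.

Lemma integrable_gauss_shift s : 0 <= s ->
  leb.-integrable hl (EFin \o (fun x => gauss (x + s))).
Proof.
move=> s0; have mhl : measurable (hl : set T) by exact: measurable_itv.
apply: (integrable_le_norm mhl (g := fun x => gauss s * gauss x)).
- by apply: measurable_funTS; exact: measurable_gauss_shift.
- move=> x /=; rewrite in_itv/= andbT => x0.
  by rewrite ger0_norm ?gauss_ge0// gauss_shift_le.
- by apply: integrableZlR => //; exact: integrable_gauss.
Qed.

Lemma gtail_le s : 0 <= s -> gtail s <= Num.sqrt (pi / 2) * gauss s.
Proof.
move=> s0; rewrite mulrC -{1}(_ : \int[leb]_(x in hl) gauss x = Num.sqrt (pi / 2)).
  rewrite -RintegralZl//; last exact: integrable_gauss.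
  apply: le_Rintegral => //; first exact: integrable_gauss_shift.
    by apply: integrableZlR => //; exact: integrable_gauss.
  by move=> x; rewrite /= in_itv/= andbT => x0; exact: gauss_shift_le.
by rewrite /Rintegral integral_gauss.
Qed.

Lemma integral_tgauss n :
  \int[ltuple n]_(t in box hl n) tgauss t = Num.sqrt (pi / 2) ^+ n.
Proof.
rewrite /Rintegral (@ge0_integral_box_prod R hl n gauss)//.
- by rewrite /Rintegral integral_gauss.
- exact: measurable_gauss.
- exact: gauss_ge0.
- by rewrite integral_gauss ltry.
Qed.

(** The constant term stems from the value of the tail at 0. It ends up as the summand 1/2 in the
    volume of the crosspolytope. *)
Lemma crosspolytope_orthant_transform k n : 0 < k ->
  \int[ltuple n]_(t in box hl n) (gtail (tsum t / Num.sqrt k) * tgauss t) =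
  Num.sqrt (pi / 2) ^+ n.+1 - (Num.sqrt (pi / 2))^-1 *
    \int[leb]_(x in hl)
      (gauss (Num.sqrt k * x) * (x^-1 * complex.Im ((cosg x +i* sing x) ^+ n))).
Proof.
move=> k0; have sk0 : 0 < Num.sqrt k by rewrite sqrtr_gt0.
have mb : measurable (box hl n) by exact: measurable_box.
rewrite -orthant_sin_transform//; last exact: igs.
have qE s : \int[leb]_(x in hl) (x^-1 * sin (x * s) * gauss (Num.sqrt k * x)) =
    q (s / Num.sqrt k).
  rewrite /q Rintegral_itv_obnd_cbnd; last exact: isinc.
  rewrite -[RHS](mulVKf (lt0r_neq0 sk0)).
  have mf : measurable_fun setT (fun x => x^-1 * sin (x * (s / Num.sqrt k)) * gauss x).
    apply: measurable_funM; last exact: measurable_gauss.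
    apply: measurable_funM; first exact: measurable_invr.
    by have := measurable_sinM (s / Num.sqrt k); under eq_fun do rewrite mulrC.
  have ic := integrable_scale_hl sk0 mf (isinc_hl _).
  rewrite -(Rintegral_scale_hl sk0 mf (isinc_hl _)) -RintegralZl//.
  apply: eq_Rintegral => x _; rewrite invfM !mulrA mulfV ?gt_eqF// mul1r.
  by congr (_ * sin _ * _); field; rewrite gt_eqF.
have pi20 := sqrt_pi2_gt0.
have mts : measurable_fun setT (fun t : n.-tuple T => tsum t / Num.sqrt k).
  by apply: measurable_funM => //; exact: measurable_tsum.
(* The tail lies between 0 and sqrt(pi/2), which confines [q] to [0, pi/2]. *)
have qle t : box hl n t -> `|q (tsum t / Num.sqrt k)| <= pi / 2.
  move=> tb; have /andP[t0 _] := tsum_le_prod tb.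
  have s0 : 0 <= tsum t / Num.sqrt k by rewrite divr_ge0// ltW.
  have := gtail_q s0; have := gtail_ge0 (tsum t / Num.sqrt k).
  have g1 := le_trans (gtail_le s0) (ler_piMr (ltW pi20) (gauss_le1 (tsum t / Num.sqrt k))).
  move=> + E; move: g1; rewrite E lerBDr lerDl subr_ge0 => q0' q1.
  rewrite ger0_norm; last by rewrite -(pmulr_rge0 _ (_ : 0 < (Num.sqrt (pi / 2))^-1)) ?invr_gt0.
  rewrite mulrC ler_pdivrMr// in q1; rewrite (le_trans q1)//.
  by rewrite -expr2 sqr_sqrtr// divr_ge0// pi_ge0.
have iq : (ltuple n).-integrable (box hl n)
    (EFin \o (fun t : n.-tuple T => q (tsum t / Num.sqrt k) * tgauss t)).
  apply: (integrable_le_norm mb (g := fun t => pi / 2 * tgauss t)).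
  - apply/measurable_funTS/measurable_funM; last exact: measurable_tgauss.
    exact: (measurableT_comp measurable_q mts).
  - move=> t tb; rewrite normrM (ger0_norm (tgauss_ge0 _)) ler_wpM2r ?tgauss_ge0//.
    exact: qle.
  - by apply: integrableZlR => //; exact: integrable_tgauss.
rewrite (_ : \int[ltuple n]_(t in box hl n) (gtail _ * _) =
  \int[ltuple n]_(t in box hl n) (Num.sqrt (pi / 2) * tgauss t -
    (Num.sqrt (pi / 2))^-1 * (q (tsum t / Num.sqrt k) * tgauss t))); last first.
  apply: eq_Rintegral => t /set_mem tb; have /andP[t0 _] := tsum_le_prod tb.
  by rewrite gtail_q ?divr_ge0 ?(ltW sk0)// mulrBl mulrA.
rewrite RintegralB//; last 2 first.
- by apply: integrableZlR => //; exact: integrable_tgauss.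
- exact: integrableZlR.
congr (_ - _).
  by rewrite (@RintegralZl _ _ _ _ _ _ _ mb (@integrable_tgauss R n)) integral_tgauss exprS.
under [in RHS]eq_Rintegral do rewrite qE.
exact: (@RintegralZl _ _ _ _ _ _ _ mb iq).
Qed.

End orthant_gaussian.

(** * Continuation of a Laplace transform to negative parameters *)

Section taylor.
Context (R : realType).
Implicit Types x k : R.

Definition tay N x : R := \sum_(i < N) x ^+ i / i`!%:R.

Lemma tayS N x : tay N.+1 x = tay N x + x ^+ N / N`!%:R.
Proof. by rewrite /tay big_ord_recr. Qed.

Lemma tay_ge0 N x : 0 <= x -> 0 <= tay N x.
Proof. by move=> x0; apply: sumr_ge0 => i _; rewrite divr_ge0 ?exprn_ge0. Qed.

Lemma cvg_tay x : tay N x @[N --> \oo] --> expR x.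
Proof.
have := is_cvg_series_exp_coeff x; rewrite /expR /=.
by rewrite (_ : (fun N => tay N x) = series (exp_coeff x))//; apply/funext => N;
  rewrite /tay /series /= big_mkord.
Qed.

Lemma tay_le_expR N x : 0 <= x -> tay N x <= expR x.
Proof.
move=> x0; have c := @cvg_tay x; rewrite -(cvg_lim _ c)//.
apply: nondecreasing_cvgn_le; last by apply/cvg_ex; exists (expR x).
apply/nondecreasing_seqP => n.
by rewrite tayS lerDl divr_ge0 ?exprn_ge0.
Qed.

Lemma is_derive_tay N (x : R) : is_derive x 1 (tay N.+1) (tay N x).
Proof.
elim: N x => [|N IH] x.
  rewrite (_ : tay 1 = cst 1); last first.
    by apply/funext => y; rewrite /tay big_ord1 expr0 fact0 divr1.
  by rewrite /tay big_ord0; exact: is_derive_cst.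
rewrite (_ : tay N.+2 = tay N.+1 + (N.+1)`!%:R^-1 \*: (@id R ^+ N.+1)); last first.
  by apply/funext => y; rewrite tayS mulrC /= !fctE.
rewrite tayS; apply: is_deriveD; apply: is_derive_eq.
rewrite /GRing.scale/= mulr1 factS natrM; field.
by rewrite nat1r !pnatr_eq0 -lt0n fact_gt0.
Qed.

Let derive_ge0_le (f f' : R -> R) : (forall x, is_derive (x : R) 1 f (f' x)) ->
  (forall x, 0 <= x -> 0 <= f' x) -> forall x, 0 <= x -> f 0 <= f x.
Proof.
move=> df f'0 x x0.
have cf : {within `[0, x], continuous f}.
  apply: continuous_subspaceT => y.
  by apply: differentiable_continuous; apply/derivable1_diffP; case: (df y).
have [c] := MVT_segment x0 (fun y _ => df y) cf.
rewrite in_itv/= => /andP[c0 _]; rewrite subr0 => E.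
by rewrite -subr_ge0 E mulr_ge0// f'0.
Qed.

(** With the sign (-1)^N the remainders satisfy r_(N+1)' = r_N and r_(N+1)(0) = 0, so both bounds
    follow by induction from monotonicity. *)
Lemma expRN_taylor_bound N x : 0 <= x ->
  0 <= (-1) ^+ N * (expR (- x) - tay N (- x)) <= x ^+ N / N`!%:R.
Proof.
pose r N x : R := (-1) ^+ N * (expR (- x) - tay N (- x)).
have dr M (y : R) : is_derive y 1 (r M.+1) (r M y).
  have dt : is_derive y 1 (fun y => tay M.+1 (- y)) (- tay M (- y)).
    have := @is_derive1_comp R (tay M.+1) -%R y _ _ (is_derive_tay M (- y)) _.
    by move=> /(_ (-1)); rewrite mulrN1; apply; apply: is_derive_eq.
  have de : is_derive y 1 (fun y => expR (- y)) (- expR (- y)).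
    by apply: is_derive_eq; rewrite /GRing.scale/=; ring.
  rewrite /r; apply: is_derive_eq.
  by rewrite /GRing.scale/= exprS; ring.
have r0 M : r M.+1 0 = 0.
  rewrite /r oppr0 expR0 /tay big_ord_recl expr0 fact0 divr1 big1 ?addr0 ?subrr ?mulr0//.
  by move=> i _; rewrite /= expr0n/= mul0r.
rewrite -/(r N x); elim: N x => [|N IH] x x0.
  rewrite /r /tay big_ord0 subr0 !expr0 mul1r fact0 divr1 expR_ge0/=.
  by rewrite -[leRHS]expR0 ler_expR oppr_le0.
apply/andP; split.
  rewrite -[leLHS](r0 N); apply: (derive_ge0_le (dr N)) => // y y0.
  by have /andP[] := IH y y0.
rewrite -subr_ge0.
have dx (y : R) : is_derive y 1 (fun y => y ^+ N.+1 / N.+1`!%:R - r N.+1 y)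
    (y ^+ N / N`!%:R - r N y).
  apply: is_deriveB.
  rewrite (_ : (fun y => _) = (N.+1)`!%:R^-1 \*: (@id R ^+ N.+1)); last first.
    by apply/funext => z; rewrite mulrC /= !fctE.
  apply: is_derive_eq.
  rewrite /GRing.scale/= mulr1 factS natrM; field.
  by rewrite nat1r !pnatr_eq0 -lt0n fact_gt0.
have := derive_ge0_le dx _ x0; rewrite expr0n/= mul0r r0 subrr; apply=> y y0.
by rewrite subr_ge0; have /andP[] := IH y y0.
Qed.

(** The lowest coefficient is O(k) at 0+, hence zero; dividing by k gives the same hypothesis for
    the remaining coefficients. *)
Lemma small_poly_coef0 n (c : nat -> R) (C : R) :
  (forall k, 0 < k -> k < 1 -> `|\sum_(i < n) c i * k ^+ i| <= C * k ^+ n) ->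
  forall i, (i < n)%N -> c i = 0.
Proof.
elim: n c => [//|n IH] c Hc.
have C0 : 0 <= C.
  have h0 : 0 < 2^-1 :> R by rewrite invr_gt0.
  have h1 : 2^-1 < 1 :> R by rewrite invf_lt1 ?ltr1n.
  by have := le_trans (normr_ge0 _) (Hc _ h0 h1); rewrite pmulr_lge0// exprn_gt0.
pose K := C + \sum_(i < n) `|c i.+1|.
have K0 : 0 <= K by rewrite addr_ge0// sumr_ge0.
have c0k k : 0 < k -> k < 1 -> `|c 0%N| <= K * k.
  move=> k0 k1; have := Hc k k0 k1; rewrite big_ord_recl expr0 mulr1.
  set S := \sum_(i < n) _ => H.
  have Sle : `|S| <= (\sum_(i < n) `|c i.+1|) * k.
    rewrite (le_trans (ler_norm_sum _ _ _))// mulr_suml; apply: ler_sum => i _.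
    rewrite normrM ler_wpM2l// ger0_norm ?exprn_ge0 ?(ltW k0)//= exprS.
    by rewrite ler_piMr ?(ltW k0)// exprn_ile1 ?(ltW k0) ?(ltW k1).
  have CK : C * k ^+ n.+1 <= C * k.
    by rewrite ler_wpM2l// exprS ler_piMr ?(ltW k0)// exprn_ile1 ?(ltW k0) ?(ltW k1).
  rewrite /K mulrDl -[c 0%N](addrK S) (le_trans (ler_normB _ _))// lerD//.
  exact: le_trans H CK.
have c00 : c 0%N = 0.
  apply/eqP; rewrite -normr_eq0 eq_le normr_ge0 andbT leNgt; apply/negP => cp.
  (* The choice k = e / (e + K + 1) lies in ]0, 1[ and gives K k < e. *)
  have gen (e : R) : 0 < e -> (forall k, 0 < k -> k < 1 -> e <= K * k) -> False.
    move=> e0 eK; have d0 : 0 < e + K + 1 by lra.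
    have k0 : 0 < e / (e + K + 1) by rewrite divr_gt0.
    have k1 : e / (e + K + 1) < 1 by rewrite ltr_pdivrMr//; lra.
    by have := eK _ k0 k1; rewrite mulrA ler_pdivlMr// mulrC ler_pM2r//; lra.
  exact: gen cp c0k.
have IHc : forall i, (i < n)%N -> c i.+1 = 0.
  apply: (IH (fun i => c i.+1)) => k k0 k1; have := Hc k k0 k1.
  rewrite big_ord_recl c00 mul0r add0r => H.
  rewrite -(ler_pM2r k0) -mulrA -exprSr (le_trans _ H)//.
  rewrite -[X in _ * X](gtr0_norm k0) -normrM mulr_suml.
  by under [in leRHS]eq_bigr do rewrite /= exprSr mulrA.
by case=> [//|i] /IHc.
Qed.

End taylor.

(** * Taylor expansion of a Laplace transform at zero *)

Section laplace_moments.
Context d (T : measurableType d) (R : realType) (mu : {measure set T -> \bar R}).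
Variables (D : set T) (mD : measurable D) (w U : T -> R).
Hypotheses (mw : measurable_fun D w) (mU : measurable_fun D U).
Hypothesis U0 : forall t, D t -> 0 <= U t.
Hypothesis iwU : forall n, mu.-integrable D (EFin \o (fun t => w t * U t ^+ n)).
Implicit Types k : R.

Let iaw n : mu.-integrable D (EFin \o (fun t => `|w t| * U t ^+ n)).
Proof.
apply: (integrable_le_norm mD _ _ (integrable_norm (iwU n))).
  apply: measurable_funM; last exact: measurable_funX.
  exact: measurableT_comp.
by move=> t Dt /=; rewrite !normrM normr_id.
Qed.

Let iw : mu.-integrable D (EFin \o w).
Proof.
have := iwU 0; rewrite (_ : (fun t => w t * U t ^+ 0) = w)//.
by apply/funext => t; rewrite mulr1.
Qed.

Let ie k : 0 <= k -> mu.-integrable D (EFin \o (fun t => w t * expR (- (k * U t)))).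
Proof.
move=> k0; apply: (integrable_le_norm mD _ _ (integrable_norm iw)).
  apply: measurable_funM => //; apply: measurableT_comp => //.
  by apply: measurableT_comp => //; exact: measurable_funM.
move=> t Dt /=; rewrite normrM ler_piMr// ger0_norm ?expR_ge0//.
by rewrite -[leRHS]expR0 ler_expR oppr_le0 mulr_ge0// U0.
Qed.

Lemma Rintegral_sum n (g : nat -> T -> R) :
  (forall i, mu.-integrable D (EFin \o g i)) ->
  mu.-integrable D (EFin \o (fun t => \sum_(i < n) g i t)) /\
  \int[mu]_(t in D) (\sum_(i < n) g i t) = \sum_(i < n) \int[mu]_(t in D) g i t.
Proof.
move=> ig; elim: n => [|n [IHi IHE]].
  rewrite big_ord0 (_ : (fun t => _) = cst 0); last first.
    by apply/funext => t; rewrite big_ord0.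
  by split; [exact: integrable0|rewrite Rintegral_cst ?mul0r].
rewrite (_ : (fun t => _) = (fun t => \sum_(i < n) g i t + g n t)); last first.
  by apply/funext => t; rewrite big_ord_recr.
split; first exact: integrableDR.
by rewrite RintegralD// IHE big_ord_recr.
Qed.

Lemma integral_tay (a : R) N :
  mu.-integrable D (EFin \o (fun t => w t * tay N (a * U t))) /\
  \int[mu]_(t in D) (w t * tay N (a * U t)) =
  \sum_(i < N) (a ^+ i / i`!%:R) * \int[mu]_(t in D) (w t * U t ^+ i).
Proof.
have [] := @Rintegral_sum N (fun i t => (a ^+ i / i`!%:R) * (w t * U t ^+ i)).
  by move=> i; exact: integrableZlR.
rewrite (_ : (fun t => _) = (fun t => w t * tay N (a * U t))); last first.
  apply/funext => t; rewrite mulr_sumr; apply: eq_bigr => i _.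
  by rewrite exprMn; ring.
by move=> i E; split=> //; rewrite E; apply: eq_bigr => i' _; rewrite RintegralZl.
Qed.

(** The pointwise alternating bound for exp(-x) at x = k U, integrated against |w|; the remainder is
    a moment times k^N. *)
Lemma laplace_taylor_bound N k : 0 <= k ->
  `|\int[mu]_(t in D) (w t * expR (- (k * U t))) -
    \sum_(i < N) ((- k) ^+ i / i`!%:R) * \int[mu]_(t in D) (w t * U t ^+ i)|
  <= (\int[mu]_(t in D) (`|w t| * U t ^+ N)) / N`!%:R * k ^+ N.
Proof.
move=> k0; have [iT <-] := integral_tay (- k) N.
rewrite -RintegralB//; last exact: ie.
have ib : mu.-integrable D (EFin \o (fun t =>
    w t * expR (- (k * U t)) - w t * tay N (- k * U t))).
  by apply: integrableBR => //; exact: ie.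
rewrite (le_trans (le_normr_Rintegral _ _))//.
have -> : (\int[mu]_(t in D) (`|w t| * U t ^+ N)) / N`!%:R * k ^+ N =
    \int[mu]_(t in D) (k ^+ N / N`!%:R * (`|w t| * U t ^+ N)).
  by rewrite RintegralZl//; ring.
apply: le_Rintegral => //.
- exact: integrable_norm ib.
- exact: integrableZlR.
- move=> t Dt; rewrite -mulrBr normrM [leRHS]mulrCA ler_wpM2l//.
  have := expRN_taylor_bound N (mulr_ge0 k0 (U0 Dt)); rewrite mulNr => /andP[r0 r1].
  rewrite mulrAC -exprMn (le_trans _ r1)//.
  by rewrite -(ger0_norm r0) normrM normrX normrN1 expr1n mul1r.
Qed.

End laplace_moments.

Section laplace_continuation.
Context d1 d2 (T1 : measurableType d1) (T2 : measurableType d2) (R : realType).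
Variables (mu : {measure set T1 -> \bar R}) (nu : {measure set T2 -> \bar R}).
Variables (D : set T1) (E : set T2) (mD : measurable D) (mE : measurable E).
Variables (w U : T1 -> R) (rho V : T2 -> R) (m : nat) (c0 : R).
Hypotheses (mw : measurable_fun D w) (mU : measurable_fun D U).
Hypotheses (mrho : measurable_fun E rho) (mV : measurable_fun E V).
Hypotheses (w0 : forall t, D t -> 0 <= w t) (U0 : forall t, D t -> 0 <= U t).
Hypothesis V0 : forall t, E t -> 0 <= V t.
Hypothesis iwU : forall n, mu.-integrable D (EFin \o (fun t => w t * U t ^+ n)).
Hypothesis irho : nu.-integrable E (EFin \o (fun t => rho t * expR (V t))).
Hypothesis laplaceE : forall k : R, 0 < k -> k < 1 ->
  k ^+ m * \int[mu]_(t in D) (w t * expR (- (k * U t))) =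
  c0 + \int[nu]_(t in E) (rho t * expR (- (k * V t))).

(** Since V^n / n! is a term of the series of exp V, integrability against exp V yields all
    moments. *)
Let irhoV n : nu.-integrable E (EFin \o (fun t => rho t * V t ^+ n)).
Proof.
apply: (integrable_le_norm mE (g := fun t => n`!%:R * `|rho t * expR (V t)|)).
- by apply: measurable_funM => //; exact: measurable_funX.
- move=> t Et; rewrite !normrM mulrCA ler_wpM2l//.
  rewrite !ger0_norm ?expR_ge0 ?exprn_ge0 ?V0//.
  have := tay_le_expR n.+1 (V0 Et); rewrite tayS => H.
  have : V t ^+ n / n`!%:R <= expR (V t).
    by rewrite (le_trans _ H)// lerDr tay_ge0// V0.
  by rewrite ler_pdivrMr ?ltr0n ?fact_gt0// mulrC.
- by apply: integrableZlR => //; exact: integrable_norm irho.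
Qed.

(** The two Taylor polynomials of the functional equation agree up to O(k^(m+N+1)) at 0+, so they
    coincide as polynomials. Their common identity may then be evaluated at k = -1, which lies
    outside the range of the hypothesis. *)
Let tay_moments N : \int[mu]_(t in D) (w t * tay N.+1 (1 * U t)) =
  (-1) ^+ m * (c0 + \int[nu]_(t in E) (rho t * tay (m + N.+1) (1 * V t))).
Proof.
pose A i := (-1) ^+ i / i`!%:R * \int[mu]_(t in D) (w t * U t ^+ i).
pose B i := (-1) ^+ i / i`!%:R * \int[nu]_(t in E) (rho t * V t ^+ i).
(* Coefficients of k^m times the left polynomial, minus [c0], minus the right polynomial: the factor
   k^m shifts the index by m and [c0] enters only in degree 0. *)
pose c i := (if (i < m)%N then 0 else A (i - m)%N) - (if i == 0%N then c0 else 0) - B i.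
have cE (k : R) : \sum_(i < m + N.+1) c i * k ^+ i =
    k ^+ m * (\sum_(i < N.+1) A i * k ^+ i) - c0 - \sum_(i < m + N.+1) B i * k ^+ i.
  rewrite /c; under eq_bigr do rewrite mulrBl mulrBl.
  rewrite !sumrB; congr (_ - _ - _).
    rewrite big_split_ord/= big1 ?add0r; last by move=> i _; rewrite ltn_ord mul0r.
    rewrite mulr_sumr; apply: eq_bigr => i _.
    by rewrite ltnNge leq_addr/= addKn exprD; ring.
  rewrite addnS big_ord_recl/= expr0 mulr1 big1 ?addr0// => i _.
  by rewrite mul0r.
pose C1 := (\int[mu]_(t in D) (`|w t| * U t ^+ N.+1)) / N.+1`!%:R.
pose C2 := (\int[nu]_(t in E) (`|rho t| * V t ^+ (m + N.+1))) / (m + N.+1)`!%:R.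
have c_small (k : R) : 0 < k -> k < 1 ->
    `|\sum_(i < m + N.+1) c i * k ^+ i| <= (C1 + C2) * k ^+ (m + N.+1).
  move=> k0 k1; rewrite cE.
  have := laplace_taylor_bound mD mw mU U0 iwU N.+1 (ltW k0).
  have := laplace_taylor_bound mE mrho mV V0 irhoV (m + N.+1) (ltW k0).
  have := laplaceE k0 k1; rewrite -/C1 -/C2.
  have signE i (x : R) : (- k) ^+ i / i`!%:R * x = (-1) ^+ i / i`!%:R * x * k ^+ i.
    by rewrite [in LHS]exprNn; move: ((-1) ^+ i) (k ^+ i) (i`!%:R^-1) => a b e; ring.
  under [\sum_(i < m + N.+1) (- k) ^+ i / _ * _]eq_bigr do rewrite signE -/(B _).
  under [\sum_(i < N.+1) (- k) ^+ i / _ * _]eq_bigr do rewrite signE -/(A _).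
  set LW := \int[mu]_(t in D) _; set LR := \int[nu]_(t in E) _.
  set SA := \sum_(i < N.+1) _; set SB := \sum_(i < m + N.+1) _ => EL HB HA.
  have -> : k ^+ m * SA - c0 - SB = (LR - SB) - k ^+ m * (LW - SA).
    by rewrite mulrBr EL; ring.
  rewrite (le_trans (ler_normB _ _))// addrC mulrDl lerD//.
  by rewrite normrM ger0_norm ?exprn_ge0 ?(ltW k0)// exprD mulrCA ler_wpM2l// exprn_ge0// ltW.
have c_0 := small_poly_coef0 c_small.
(* At k = -1 the alternating signs cancel, and the sums become integrals of Taylor polynomials of
   exp U and exp V. *)
have := cE (-1); rewrite big1 => [/esym|i _]; last by rewrite c_0// mul0r.
have signE (x : R) i : (-1) ^+ i / i`!%:R * x * (-1) ^+ i = 1 ^+ i / i`!%:R * x.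
  by rewrite mulrC !mulrA -expr2 sqrr_sign expr1n.
under eq_bigr do rewrite signE.
under [X in _ - X]eq_bigr do rewrite signE.
rewrite -(integral_tay mD iwU 1 N.+1).2 -(integral_tay mE irhoV 1 (m + N.+1)).2.
set X := \int[mu]_(t in D) _; set Y := \int[nu]_(t in E) _ => XY.
have -> : c0 + Y = (-1) ^+ m * X by apply/eqP; rewrite eq_sym -subr_eq0 opprD addrA XY.
by rewrite mulrA -expr2 sqrr_sign mul1r.
Qed.

(* Both integrals have Taylor expansions in [k] at 0+ with moments as
   coefficients; the hypothesis identifies them.  At [k = -1] the series on the
   left has nonnegative terms (monotone convergence) and the one on the right is
   dominated by [expR V]. *)
Lemma laplace_continuation :
  (\int[mu]_(t in D) (w t * expR (U t))%:E)%E =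
  ((-1) ^+ m * (c0 + \int[nu]_(t in E) (rho t * expR (V t))))%:E.
Proof.
have mtay N dX (Y : measurableType dX) (F : set Y) (f : Y -> R) :
    measurable_fun F f -> measurable_fun F (fun t => tay N (1 * f t)).
  move=> mf; apply: measurable_sum => i.
  by apply: measurable_funM => //; apply: measurable_funX; exact: measurable_funM.
have ctay (a x : R) : (a * tay N.+1 (1 * x))%:E @[N --> \oo] --> (a * expR x)%:E.
  apply: cvg_EFin; first exact: nearW.
  apply: cvgMr; rewrite mul1r.
  by have := @cvg_tay R x; rewrite -cvg_shiftS.
have cvgL : (\int[mu]_(t in D) (w t * tay N.+1 (1 * U t))%:E)%E @[N --> \oo] -->
    (\int[mu]_(t in D) (w t * expR (U t))%:E)%E.
  rewrite (_ : (\int[mu]_(t in D) (w t * expR (U t))%:E)%E =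
    (\int[mu]_(t in D) limn (fun N => (w t * tay N.+1 (1 * U t))%:E))%E); last first.
    by apply: eq_integral => t _; apply/esym/cvg_lim => //; exact: ctay.
  apply: cvg_monotone_convergence => //.
  - by move=> N; apply/measurable_EFinP/measurable_funM => //; exact: mtay.
  - by move=> N t Dt; rewrite lee_fin mulr_ge0 ?w0// tay_ge0// mul1r U0.
  - move=> t Dt; apply/nondecreasing_seqP => N; rewrite lee_fin ler_wpM2l ?w0//.
    by rewrite [leRHS]tayS lerDl divr_ge0// exprn_ge0// mul1r U0.
have cvgR : \int[nu]_(t in E) (rho t * tay (m + N.+1) (1 * V t)) @[N --> \oo] -->
    \int[nu]_(t in E) (rho t * expR (V t)).
  have := @dominated_convergence _ _ R nu E mE
    (fun N t => (rho t * tay (m + N.+1) (1 * V t))%:E)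
    (fun t => (rho t * expR (V t))%:E) (fun t => `|rho t * expR (V t)|%:E).
  case=> //.
  - by move=> N; apply/measurable_EFinP/measurable_funM => //; exact: mtay.
  - by apply/measurable_EFinP/measurable_funM => //; exact: measurableT_comp.
  - apply: aeW => t _; have := ctay (rho t) (V t); rewrite -(cvg_shiftn m).
    by rewrite (_ : (fun N => _) = (fun N => (rho t * tay (N + m).+1 (1 * V t))%:E))//;
      apply/funext => N; rewrite addnS addnC.
  - exact: integrable_norm irho.
  - apply: aeW => t N Et; rewrite lee_fin !normrM ler_wpM2l// ger0_norm ?tay_ge0 ?mul1r ?V0//.
    by rewrite ger0_norm ?expR_ge0// tay_le_expR// V0.
  by move=> _ _; rewrite -(fineK (integrable_fin_num mE irho)) => /fine_cvg.
have := cvgL; rewrite (_ : (fun N => _) = (fun N =>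
    ((-1) ^+ m * (c0 + \int[nu]_(t in E) (rho t * tay (m + N.+1) (1 * V t))))%:E)); last first.
  apply/funext => N; rewrite -tay_moments /Rintegral fineK//; apply: integrable_fin_num => //.
  exact: (integral_tay mD iwU 1 N.+1).1.
move=> /cvg_lim <- //; apply/cvg_lim => //; apply: cvg_EFin; first exact: nearW.
by apply: cvgMr; apply: cvgD; [exact: cvg_cst|exact: cvgR].
Qed.

End laplace_continuation.

(** * Closed forms and integrability of the integrands *)

Section gamma_moment.
Context (R : realType).
Local Notation leb := (@lebesgue_measure R).
Local Notation hl := (`[0%R, +oo[%classic : set R).
Implicit Types x : R.

(** The constant C of the polar form; it is the radial integral for a = 1. *)
Definition gmoment (d : nat) : R := \int[leb]_(x in hl) (x ^+ d * gauss x).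

Lemma integrable_gmoment d : leb.-integrable hl (EFin \o (fun x => x ^+ d * gauss x)).
Proof.
apply: (@integrable_le_gauss R d 1).
  by apply: measurable_funM => //; exact: measurable_gauss.
by move=> x x0; rewrite mul1r ger0_norm// mulr_ge0 ?exprn_ge0 ?gauss_ge0.
Qed.

(** The exponents that occur are half-integers; a natural power of the square root is continuous on
    the whole line, including 0. *)
Let gammaf n (t : R) : R := Num.sqrt t ^+ n * expR (- t).

Let continuous_gammaf n : continuous (gammaf n).
Proof.
move=> t; apply: cvgM.
  apply: (@continuous_comp _ _ _ Num.sqrt (fun y : R => y ^+ n)).
    exact: sqrt_continuous.
  exact: exprn_continuous.
apply: (@continuous_comp _ _ _ -%R expR); first exact: opp_continuous.
exact: continuous_expR.
Qed.

Let half_sqr x : R := x ^+ 2 / 2.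

Let is_derive_half_sqr (x : R) : is_derive x 1 half_sqr x.
Proof. by apply: is_derive_eq; rewrite /GRing.scale/=; field. Qed.

Let derive_half_sqr : derive1 half_sqr = id.
Proof. by apply/funext => x; rewrite derive1E; case: (is_derive_half_sqr x). Qed.

(** The substitution t = x^2/2 on a bounded interval. The half-line is reached afterwards through
    exhaustion by [0, N^2/2]. *)
Let half_sqr_substitution n (N : nat) :
  (\int[leb]_(t in `[0%R, half_sqr N%:R]) (gammaf n t)%:E)%E =
  (\int[leb]_(x in `[0%R, N%:R]) ((Num.sqrt 2 ^- n) * (x ^+ n.+1 * gauss x))%:E)%E.
Proof.
have h0 : half_sqr 0 = 0 by rewrite /half_sqr expr0n/= mul0r.
rewrite -{1}h0 (@integration_by_substitution_increasing R half_sqr)//.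
- apply: eq_integral => x; rewrite inE/= in_itv/= => /andP[x0 _]; congr EFin.
  rewrite derive_half_sqr !fctE /gammaf /half_sqr /gauss mulNr.
  rewrite sqrtrM ?sqr_ge0// sqrtr_sqr ger0_norm// sqrtrV// exprMn exprVn [x ^+ n.+1]exprSr.
  move: (expR _) (_ ^- n) (x ^+ n) => a b c; ring.
- move=> x y; rewrite !in_itv/= => /andP[x0 _] /andP[y0 _] xy.
  by rewrite ltr_pM2r ?invr_gt0// ltr_pXn2r.
- by rewrite derive_half_sqr => x _; exact: cvg_id.
- by rewrite derive_half_sqr; apply/cvg_ex; exists 0; apply: cvg_at_right_filter; exact: cvg_id.
- by rewrite derive_half_sqr; apply/cvg_ex; exists N%:R; apply: cvg_at_left_filter; exact: cvg_id.
- have ch (x : R) : {for x, continuous half_sqr}.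
    by apply: differentiable_continuous; apply/derivable1_diffP; case: (is_derive_half_sqr x).
  split; first by move=> x _; case: (is_derive_half_sqr x).
  + by apply: cvg_at_right_filter; exact: ch.
  + by apply: cvg_at_left_filter; exact: ch.
- exact/continuous_subspaceT/continuous_gammaf.
Qed.

Lemma integral_gammaf n :
  (\int[leb]_(t in hl) (Num.sqrt t ^+ n * expR (- t))%:E)%E =
  ((Num.sqrt 2 ^- n) * gmoment n.+1)%:E.
Proof.
have mono : nondecreasing_seq (fun N : nat => `[0, half_sqr N%:R]%classic : set R).
  apply/nondecreasing_seqP => N; apply/subsetPset => x /=; rewrite !in_itv/=.
  move=> /andP[-> xN]/=; rewrite (le_trans xN)// ler_pM2r ?invr_gt0//.
  by rewrite ler_pXn2r// ?nnegrE// ler_nat.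
have := @ge0_nondecreasing_set_cvg_integral _ (measurableTypeR R) R
  (fun N : nat => `[0, half_sqr N%:R]%classic) (EFin \o gammaf n) leb mono.
have -> : \bigcup_N `[0, half_sqr N%:R]%classic = hl.
  apply/seteqP; split => x; first by move=> [N _]; rewrite /= !in_itv/= andbT => /andP[].
  (* If y is an integer above x, then N = y + 1 satisfies N^2/2 >= y >= x. *)
  rewrite /= in_itv/= andbT => x0; exists (Num.truncn x).+2 => //=.
  rewrite in_itv/= x0/= /half_sqr; have := Num.Theory.truncnS_gt x.
  rewrite -[_.+2%:R]natr1; set y := (Num.truncn x).+1%:R => xy.
  by rewrite ler_pdivlMr//; nra.
have mg : measurable_fun setT (EFin \o gammaf n).
  by apply/measurable_EFinP; apply: continuous_measurable_fun; exact: continuous_gammaf.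
move=> /(_ _ _ _)/cvg_lim <- //; last 2 first.
- by move=> N; exact: measurable_funTS.
- by move=> N x _; rewrite lee_fin mulr_ge0 ?exprn_ge0 ?sqrtr_ge0 ?expR_ge0.
apply/cvg_lim => //; rewrite (_ : (fun N => _) = (fun N : nat =>
    (Num.sqrt 2 ^- n * \int[leb]_(x in `[0, N%:R]) (x ^+ n.+1 * gauss x))%:E)).
  apply: cvg_EFin; first exact: nearW.
  by apply: cvgMr; apply: cvg_Rintegral_itv0n; exact: integrable_gmoment.
apply/funext => N; rewrite /= half_sqr_substitution.
have iN : leb.-integrable `[0, N%:R] (EFin \o (fun x => x ^+ n.+1 * gauss x)).
  by apply: integrableS (integrable_gmoment n.+1) => // x; rewrite /= !in_itv/= andbT => /andP[].
rewrite -RintegralZl// /Rintegral fineK//.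
by apply: integrable_fin_num => //; exact: integrableZlR.
Qed.

(** On [1, 2] the integrand is bounded below by the positive constant [gauss 2]. *)
Lemma gmoment_gt0 d : 0 < gmoment d.
Proof.
have i12 : leb.-integrable `[1, 2] (EFin \o (fun x => x ^+ d * gauss x)).
  apply: integrableS (integrable_gmoment d) => // x; rewrite /= !in_itv/= andbT => /andP[x1 _].
  exact: le_trans x1.
apply: (@lt_le_trans _ _ (\int[leb]_(x in `[1, 2]) (x ^+ d * gauss x))); last first.
  rewrite /gmoment -lee_fin /Rintegral !fineK; last 2 first.
  - exact: integrable_fin_num (integrable_gmoment d).
  - exact: integrable_fin_num i12.
  apply: ge0_subset_integral => //.
  - by have /integrableP[] := integrable_gmoment d.
  - move=> x; rewrite /= in_itv/= andbT => x0.
    by rewrite lee_fin mulr_ge0 ?exprn_ge0 ?gauss_ge0.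
  - by move=> x; rewrite /= !in_itv/= andbT => /andP[x1 _]; exact: le_trans x1.
apply: (@lt_le_trans _ _ (\int[leb]_(x in `[1, 2]) gauss 2)).
  rewrite Rintegral_cst//= lebesgue_measure_itv/= lte_fin ltr1n/=.
  by rewrite mulr_gt0 ?expR_gt0//; lra.
apply: le_Rintegral => //.
  by apply: (@continuous_compact_integrable R (cst (gauss 2))); [exact: segment_compact|move=> x; exact: cvg_cst].
move=> x; rewrite /= in_itv/= => /andP[x1 x2].
rewrite -[leLHS]mul1r ler_pM ?gauss_ge0 ?exprn_ege1//.
rewrite ler_expR; nra.
Qed.

Lemma GammaE d : (0 < d)%N -> Gamma (d.+1%:R / 2) = Num.sqrt 2 ^- d.-1 * gmoment d.
Proof.
case: d => // d _; rewrite /Gamma.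
have E (t : R) : 0 < t -> t `^ (d.+2%:R / 2 - 1) * expR (- t) = Num.sqrt t ^+ d * expR (- t).
  move=> t0; congr (_ * _).
  have -> : d.+2%:R / 2 - 1 = 2^-1 * d%:R :> R by rewrite -[d.+2]addn2 natrD; field.
  by rewrite powRrM powR12_sqrt ?(ltW t0)// powR_mulrn ?sqrtr_ge0.
transitivity (\int[leb]_(t in `]0, +oo[) (Num.sqrt t ^+ d * expR (- t))).
  by apply: eq_Rintegral => t; rewrite inE/= in_itv/= andbT => t0; rewrite E.
rewrite /Rintegral integral_itv_obnd_cbnd ?integral_gammaf//.
apply/measurable_EFinP/measurable_funTS.
by apply: continuous_measurable_fun; exact: continuous_gammaf.
Qed.

(** This is the Gaussian integral over R^(d+1) in polar coordinates, here obtained from the Gamma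
    function. *)
Lemma omega_gmoment d : (0 < d)%N -> omega R d.+1 * gmoment d = Num.sqrt (2 * pi) ^+ d.+1.
Proof.
move=> d0; rewrite /omega GammaE//; have g0 := gmoment_gt0 d.
have s2 : 0 < Num.sqrt 2 :> R by rewrite sqrtr_gt0.
have piE : Num.sqrt pi ^+ d.+1 = pi `^ (d.+1%:R / 2) :> R.
  by rewrite -powR12_sqrt ?pi_ge0// -powR_mulrn ?powR_ge0// -powRrM mulrC.
rewrite sqrtrM// exprMn piE; case: d d0 g0 {piE} => // d _ g0 /=.
have -> : Num.sqrt 2 ^+ d.+2 = 2 * Num.sqrt 2 ^+ d :> R.
  by rewrite !exprS mulrA -expr2 sqr_sqrtr.
move: (pi `^ _) => p; field.
by rewrite !gt_eqF ?exprn_gt0.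
Qed.

End gamma_moment.

(** * Parity of real and imaginary parts of complex powers *)

Section gaussian_transform_bounds.
Context (R : realType).
Local Notation leb := (@lebesgue_measure R).
Local Notation hl := (`[0%R, +oo[%classic : set R).
Implicit Types (x u : R) (z : R[i]).

Lemma ReX z n : complex.Re (z ^+ n.+1) =
  complex.Re z * complex.Re (z ^+ n) - complex.Im z * complex.Im (z ^+ n).
Proof. by rewrite exprS; case: (z ^+ n) => c e; case: z. Qed.

Lemma ImX z n : complex.Im (z ^+ n.+1) =
  complex.Re z * complex.Im (z ^+ n) + complex.Im z * complex.Re (z ^+ n).
Proof. by rewrite exprS; case: (z ^+ n) => c e; case: z. Qed.

Lemma sqr_normX z n : complex.Re (z ^+ n) ^+ 2 + complex.Im (z ^+ n) ^+ 2 =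
  (complex.Re z ^+ 2 + complex.Im z ^+ 2) ^+ n.
Proof.
elim: n => [|n IH]; first by rewrite !expr0 /= expr1n expr0n addr0.
by rewrite ReX ImX [RHS]exprS -IH; ring.
Qed.

(** Expanding an odd power, each monomial of the real part contains a and each monomial of the
    imaginary part contains b. Two multiplications by a + ib preserve this, and both bounds are
    needed in the induction. *)
Lemma odd_power_bound (a b : R) k (N := a ^+ 2 + b ^+ 2) :
  `|complex.Re ((a +i* b) ^+ k.*2.+1)| <= 3 ^+ k * `|a| * N ^+ k /\
  `|complex.Im ((a +i* b) ^+ k.*2.+1)| <= 3 ^+ k * `|b| * N ^+ k.
Proof.
have N0 : 0 <= N by rewrite addr_ge0 ?sqr_ge0.
elim: k => [|k [IHr IHi]]; first by rewrite !expr0 !mulr1 !mul1r expr1.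
have Re2 : `|complex.Re ((a +i* b) ^+ k.*2.+2)| <= N ^+ k.+1.
  rewrite -(ler_pXn2r (ltn0Sn 1)) ?nnegrE ?exprn_ge0//.
  rewrite real_normK ?num_real// -exprM mulnC mul2n -(sqr_normX (a +i* b)) -doubleS.
  by rewrite lerDl sqr_ge0.
have Im2 : `|complex.Im ((a +i* b) ^+ k.*2.+2)| <= 2 * 3 ^+ k * `|a| * `|b| * N ^+ k.
  rewrite ImX/= (le_trans (ler_normD _ _))// !normrM.
  have H1 := ler_wpM2l (normr_ge0 a) IHi; have H2 := ler_wpM2l (normr_ge0 b) IHr.
  by rewrite (le_trans (lerD H1 H2))//; lra.
have aN : `|a| * `|a| <= N by rewrite -expr2 real_normK ?num_real// lerDl sqr_ge0.
have bN : `|b| * `|b| <= N by rewrite -expr2 real_normK ?num_real// lerDr sqr_ge0.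
have p3 : 1 <= 3 ^+ k :> R by rewrite exprn_ege1// ler1n.
have Nk0 : 0 <= N ^+ k by rewrite exprn_ge0.
(* The constant grows from 3^k to 1 + 2 * 3^k, which is at most 3^(k+1). *)
have bound (c e : R) : 0 <= c -> 0 <= e -> e * e <= N ->
    c * N ^+ k.+1 + e * (2 * 3 ^+ k * c * e * N ^+ k) <= 3 ^+ k.+1 * c * N ^+ k.+1.
  move=> c0 e0 eN.
  have -> : e * (2 * 3 ^+ k * c * e * N ^+ k) = 2 * 3 ^+ k * c * (e * e) * N ^+ k by ring.
  have : 2 * 3 ^+ k * c * (e * e) * N ^+ k <= 2 * 3 ^+ k * c * N * N ^+ k.
    by rewrite ler_wpM2r// ler_wpM2l// !mulr_ge0// exprn_ge0.
  move=> H; rewrite (le_trans (lerD (lexx _) H))//.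
  rewrite -mulrA -exprS [3 ^+ k.+1]exprS -subr_ge0.
  have -> : 3 * 3 ^+ k * c * N ^+ k.+1 - (c * N ^+ k.+1 + 2 * 3 ^+ k * c * N ^+ k.+1) =
    (3 ^+ k - 1) * (c * N ^+ k.+1) by ring.
  by rewrite mulr_ge0 ?subr_ge0// mulr_ge0// exprn_ge0.
rewrite doubleS; split.
- rewrite ReX/= (le_trans (ler_normB _ _))// !normrM.
  have H1 := ler_wpM2l (normr_ge0 a) Re2; have H2 := ler_wpM2l (normr_ge0 b) Im2.
  by rewrite (le_trans (lerD H1 H2))// bound.
- rewrite ImX/= (le_trans (ler_normD _ _))// !normrM addrC.
  have H1 := ler_wpM2l (normr_ge0 b) Re2; have H2 := ler_wpM2l (normr_ge0 a) Im2.
  rewrite (le_trans (lerD H1 H2))// (le_trans _ (bound _ _ _ _ aN))//.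
  by rewrite le_eqVlt; apply/orP; left; apply/eqP; ring.
Qed.

Lemma even_power_bound (a b : R) k (N := a ^+ 2 + b ^+ 2) :
  `|complex.Im ((a +i* b) ^+ k.*2.+2)| <= 2 * 3 ^+ k * `|a| * `|b| * N ^+ k.
Proof.
have [IHr IHi] := odd_power_bound a b k.
rewrite ImX/= (le_trans (ler_normD _ _))// !normrM.
have H1 := ler_wpM2l (normr_ge0 a) IHi; have H2 := ler_wpM2l (normr_ge0 b) IHr.
by rewrite (le_trans (lerD H1 H2))// -/N; lra.
Qed.

End gaussian_transform_bounds.

(** * Decay and integrability of the densities *)

Section integrands.
Context (R : realType).
Local Notation leb := (@lebesgue_measure R).
Local Notation hl := (`[0%R, +oo[%classic : set R).
Implicit Types (x u y : R) (d n : nat).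

Definition gpair u : R[i] := cosg u +i* sing u.

Lemma continuous_cosg : continuous (@cosg R).
Proof.
by move=> x; apply/differentiable_continuous/derivable1_diffP; case: (is_derive_cosg x).
Qed.

Lemma continuous_sing : continuous (@sing R).
Proof.
by move=> x; apply/differentiable_continuous/derivable1_diffP; case: (is_derive_sing x).
Qed.

Lemma measurable_cosg : measurable_fun setT (@cosg R).
Proof. by apply: continuous_measurable_fun; exact: continuous_cosg. Qed.

Lemma measurable_sing : measurable_fun setT (@sing R).
Proof. by apply: continuous_measurable_fun; exact: continuous_sing. Qed.

Lemma measurable_gpairX n :
  measurable_fun setT (fun u => complex.Re (gpair u ^+ n)) /\
  measurable_fun setT (fun u => complex.Im (gpair u ^+ n)).
Proof.
elim: n => [|n [mr mi]]; first by rewrite /=; split; exact: measurable_cst.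
split.
- under eq_fun do rewrite ReX/=.
  by apply: measurable_funB; apply: measurable_funM => //; [exact: measurable_cosg|exact: measurable_sing].
- under eq_fun do rewrite ImX/=.
  by apply: measurable_funD; apply: measurable_funM => //; [exact: measurable_cosg|exact: measurable_sing].
Qed.

Lemma measurable_egauss : measurable_fun setT (@egauss R).
Proof. by apply: continuous_measurable_fun; exact: continuous_egauss. Qed.

Lemma oneDsqr_gt0 x : 0 < oneDsqr x.
Proof. exact: lt_le_trans ltr01 (oneDsqr_ge1 x). Qed.

Lemma integrable_oneDsqrV : leb.-integrable hl (EFin \o (fun x => (oneDsqr x)^-1)).
Proof.
apply/integrableP; split.
  apply/measurable_EFinP/measurable_funTS.
  by apply: continuous_measurable_fun; exact: continuous_oneDsqrV.
rewrite (_ : (\int[_]_(x in _) _)%E = (\int[leb]_(x in hl) (oneDsqr x)^-1%:E)%E).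
  by rewrite integral0y_oneDsqr ltry.
by apply: eq_integral => x _; rewrite /= ger0_norm// invr_ge0.
Qed.

Lemma integrable_le_oneDsqrV (c : R) (f : R -> R) : measurable_fun setT f ->
  (forall u, 0 <= u -> `|f u| <= c / oneDsqr u) -> leb.-integrable hl (EFin \o f).
Proof.
move=> mf fc; apply: (@integrable_le_norm _ _ R leb hl _ f (fun u => c * (oneDsqr u)^-1)).
- by [].
- exact: measurable_funTS.
- by move=> u; rewrite /= in_itv/= andbT => /fc.
- apply: integrableZlR => //; exact: integrable_oneDsqrV.
Qed.

Lemma gpair_sqr_le u : 0 <= u -> cosg u ^+ 2 + sing u ^+ 2 <= 8 / oneDsqr u.
Proof.
move=> u0; have b0 := sing_ge0 u0; have bu := sing_le u0; have ub := mul_sing_le u.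
have o0 : 0 < oneDsqr u by exact: oneDsqr_gt0.
(* The 2 bounds (1 + u^2) cosg^2, by pi/2 < 2 and (1 + u^2) exp(-u^2) <= 1. The 6 is 2 + 4: sing^2
   <= u sing <= 2 and (u sing)^2 <= 4. *)
rewrite ler_pdivlMr// mulrDl (_ : 8 = 2 + 6 :> R); last by ring.
apply: lerD.
  rewrite cosgE exprMn sqr_sqrtr ?divr_ge0 ?pi_ge0// /gauss -expRM_natr.
  have -> : - u ^+ 2 / 2 * 2%:R = - u ^+ 2 by field.
  rewrite -mulrA -[leRHS]mulr1 ler_pM ?mulr_ge0 ?expR_ge0 ?(ltW o0) ?invr_ge0 ?pi_ge0//.
  - by have /andP[_ /ltW] := @pihalf_02 R.
  - by rewrite expRN mulrC ler_pdivrMr ?expR_gt0// mul1r expR_ge1Dx.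
have b2 : sing u ^+ 2 <= 2.
  by rewrite expr2 (le_trans _ ub)// ler_wpM2r.
rewrite /oneDsqr mulrDr mulr1 -exprMn mulrC.
have : (u * sing u) ^+ 2 <= 4.
  rewrite (_ : 4 = 2 ^+ 2 :> R); last by ring.
  by rewrite ler_pXn2r// nnegrE// mulr_ge0.
by move: b2; lra.
Qed.

Lemma gpair_sqrX_le u n : 0 <= u -> (cosg u ^+ 2 + sing u ^+ 2) ^+ n.+1 <= 8 ^+ n.+1 / oneDsqr u.
Proof.
move=> u0; have o1 := oneDsqr_ge1 u.
have : (cosg u ^+ 2 + sing u ^+ 2) ^+ n.+1 <= (8 / oneDsqr u) ^+ n.+1.
  by rewrite ler_pXn2r ?nnegrE ?gpair_sqr_le// ?addr_ge0 ?sqr_ge0// divr_ge0// (le_trans ler01).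
move=> /le_trans; apply; rewrite exprMn ler_wpM2l// exprVn lef_pV2 ?posrE ?exprn_gt0 ?oneDsqr_gt0//.
by rewrite exprS ler_peMr ?(le_trans ler01 o1)// exprn_ege1.
Qed.

Lemma cosg_egauss u : cosg u * egauss u = Num.sqrt (pi / 2).
Proof. by rewrite cosgE -mulrA gaussV mulr1. Qed.

(** The factor [cosg] of the real part cancels [egauss] up to a constant; what remains is |A|^(2m),
    which decays at least like 1/(1 + u^2) because m > 0. *)
Lemma integrable_simplex_density m : (0 < m)%N ->
  leb.-integrable hl (EFin \o (fun u => complex.Re (gpair u ^+ m.*2.+1) * egauss u)).
Proof.
case: m => // m _; apply: (@integrable_le_oneDsqrV (3 ^+ m.+1 * Num.sqrt (pi / 2) * 8 ^+ m.+1)).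
  by apply: measurable_funM; [have [] := measurable_gpairX m.+1.*2.+1|exact: measurable_egauss].
move=> u u0; have [+ _] := odd_power_bound (cosg u) (sing u) m.+1.
rewrite normrM (ger0_norm (expR_ge0 _)) -/(egauss u) => H.
apply: (le_trans (ler_wpM2r (expR_ge0 _) H)); rewrite -/(egauss u).
have c0 : 0 <= cosg u by rewrite cosgE mulr_ge0 ?gauss_ge0 ?sqrtr_ge0.
rewrite (ger0_norm c0) mulrAC -[_ * _ * egauss u]mulrA cosg_egauss -[leRHS]mulrA.
by rewrite ler_wpM2l ?gpair_sqrX_le// mulr_ge0 ?sqrtr_ge0 ?exprn_ge0.
Qed.

Lemma sing_div_le u : 0 <= u -> u^-1 * sing u <= 3 / oneDsqr u.
Proof.
move=> u0; rewrite ler_pdivlMr ?oneDsqr_gt0//.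
have [->|un0] := eqVneq u 0; first by rewrite sing0 mulr0 mul0r.
have bu := sing_le u0; have ub := mul_sing_le u.
have u1 : u^-1 * sing u <= 1 by rewrite mulrC ler_pdivrMr ?mul1r// lt_neqAle eq_sym un0.
(* The two summands are at most 1 and 2, whence the constant 3. *)
have -> : u^-1 * sing u * oneDsqr u = u^-1 * sing u + u * sing u by rewrite /oneDsqr; field.
lra.
Qed.

(** The imaginary part of an even power contains both [cosg] and [sing]. The first cancels [egauss],
    the second together with 1/u provides the decay, and the remaining power of |A| is bounded. *)
Lemma integrable_crosspolytope_density m : (0 < m)%N ->
  leb.-integrable hl (EFin \o (fun u => u^-1 * complex.Im (gpair u ^+ m.*2) * egauss u)).
Proof.
case: m => // m _.
apply: (@integrable_le_oneDsqrV (2 * 3 ^+ m * Num.sqrt (pi / 2) * 8 ^+ m * 3)).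
  apply: measurable_funM; last exact: measurable_egauss.
  by apply: measurable_funM; [exact: measurable_invr|have [] := measurable_gpairX m.+1.*2].
move=> u u0; have := even_power_bound (cosg u) (sing u) m.
rewrite !normrM (ger0_norm (expR_ge0 _)) -/(egauss u) (@ger0_norm _ u^-1) ?invr_ge0// => H.
apply: (le_trans (ler_wpM2r (expR_ge0 _) (ler_wpM2l _ H))); first by rewrite invr_ge0.
rewrite -/(egauss u).
have c0 : 0 <= cosg u by rewrite cosgE mulr_ge0 ?gauss_ge0 ?sqrtr_ge0.
have s0 := sing_ge0 u0; rewrite (ger0_norm c0) (ger0_norm s0).
set N := (_ + _) ^+ m.
have -> : u^-1 * (2 * 3 ^+ m * cosg u * sing u * N) * egauss u =
  2 * 3 ^+ m * (cosg u * egauss u) * N * (u^-1 * sing u) by ring.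
rewrite cosg_egauss -[leRHS]mulrA.
have N8 : N <= 8 ^+ m.
  rewrite /N; case: (m) => [|k]; first by rewrite !expr0.
  apply: (le_trans (gpair_sqrX_le _ u0)); rewrite ler_pdivrMr ?oneDsqr_gt0//.
  by rewrite ler_peMr ?oneDsqr_ge1// exprn_ge0.
rewrite ler_pM ?sing_div_le ?mulr_ge0 ?exprn_ge0 ?invr_ge0 ?sqrtr_ge0// ?addr_ge0 ?sqr_ge0//.
by rewrite ler_wpM2l// !mulr_ge0 ?exprn_ge0 ?sqrtr_ge0.
Qed.

(** Two factors give the decay 1/u^2; the others are bounded by 2. *)
Lemma integrable_singX d : (2 <= d)%N -> leb.-integrable hl (EFin \o (fun u => sing u ^+ d)).
Proof.
case: d => [|[|d]]// _; apply: (@integrable_le_oneDsqrV (2 ^+ d * 8)).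
  by apply: measurable_funX; exact: measurable_sing.
move=> u u0; have s0 := sing_ge0 u0; rewrite ger0_norm ?exprn_ge0//.
rewrite -addn2 exprD -[leRHS]mulrA ler_pM ?exprn_ge0//.
  apply: lerXn2r; rewrite ?nnegrE//; have [u1|/ltW u1] := leP u 1.
    by rewrite (le_trans (sing_le u0))//; lra.
  by rewrite (le_trans _ (mul_sing_le u))// ler_peMl.
by rewrite (le_trans _ (gpair_sqr_le u0))// lerDr sqr_ge0.
Qed.

End integrands.

(** * The integrands of the theorem in terms of A *)

Section integrands_closed_form.
Context (R : realType).
Local Notation leb := (@lebesgue_measure R).
Local Notation hl := (`[0%R, +oo[%classic : set R).
Implicit Types (x u y : R) (d n : nat).
Local Notation s2p := (Num.sqrt (2 * pi) : R).

Lemma sqrt_2pi_gt0 : 0 < s2p.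
Proof. by rewrite sqrtr_gt0 mulr_gt0 ?pi_gt0. Qed.

Lemma sqrt_2pi_half : s2p / 2 = Num.sqrt (pi / 2).
Proof.
have -> : pi / 2 = 2 * pi / 2 ^+ 2 :> R by field.
by rewrite [RHS]sqrtrM ?mulr_ge0 ?pi_ge0// sqrtrV// sqrtr_sqr ger0_norm.
Qed.

Lemma half_complex : 2^-1 = (2^-1)%:C :> R[i].
Proof. by rewrite fmorphV rmorph_nat. Qed.

(** On the segment from 0 to iu the exponent -t^2/2 is real and positive, so the integral is that of
    [egauss], known from [integral_egauss]. *)
Lemma Phi_im u : Phi ('i%C * u%:C) = 2^-1 +i* (s2p^-1 * (sing u * egauss u)).
Proof.
have E s : expC (- (s%:C * ('i%C * u%:C)) ^+ 2 / 2) = (egauss (u * s))%:C.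
  have -> : - (s%:C * ('i%C * u%:C)) ^+ 2 / 2 = ((u * s) ^+ 2 / 2)%:C :> R[i].
    rewrite half_complex !exprMn complex.sqr_i mulN1r mulrN opprK.
    by rewrite -!(rmorphXn (real_complex R)) -!rmorphM; congr (_ %:C); rewrite [X in X / _]mulrC.
  rewrite /expC /= sin0 cos0; apply/eqP; rewrite eq_complex /=; apply/andP; split; apply/eqP.
    by rewrite mulr1 mulr0 subr0.
  by rewrite mulr0 mul0r addr0.
have I : u * (\int[leb]_(s in `[0, 1]) egauss (u * s)) = sing u * egauss u.
  have := @integral_egauss R u 0 1 ltr01.
  rewrite !mulr1 !mulr0 sing0 mul0r subr0 => /(congr1 fine) /= <-.
  rewrite -RintegralZl//; apply: continuous_compact_integrable; first exact: segment_compact.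
  apply: continuous_subspaceT => x.
  by apply: (@continuous_comp _ _ _ ( *%R u) (@egauss R)); [exact: mulrl_continuous|exact: continuous_egauss].
rewrite /Phi; have -> : (fun s => expC (- (s%:C * ('i%C * u%:C)) ^+ 2 / 2)) = (fun s => (egauss (u * s))%:C).
  by apply/funext.
rewrite /Cintegral /= half_complex (_ : \int[leb]_(_ in _) 0 = 0); last by rewrite /Rintegral integral0.
apply/eqP; rewrite eq_complex /=; apply/andP; split; apply/eqP; first by ring.
rewrite -I; ring.
Qed.

Lemma Phi_imE u : Phi ('i%C * u%:C) = (egauss u / s2p)%:C * gpair u.
Proof.
rewrite Phi_im; apply/eqP; rewrite eq_complex /=; apply/andP; split; apply/eqP; last by ring.
rewrite mul0r subr0 mulrAC [egauss u * _]mulrC cosg_egauss -sqrt_2pi_half.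
by field; rewrite gt_eqF ?sqrt_2pi_gt0.
Qed.

(** This conjugation symmetry turns the sum of the two powers in the simplex integrand into twice a
    real part. *)
Lemma gpairN u : gpair (- u) = (gpair u)^*%C.
Proof. by rewrite /gpair singN /conjc !cosgE /gauss sqrrN. Qed.

(** With y = sqrt(n) u the Gaussian cancels exactly n factors [egauss u]. This accounts for the
    scalings sqrt d and sqrt(d-1) inside [Phi]. *)
Lemma gauss_scale_egauss n (y u : R) : y ^+ 2 = n%:R * u ^+ 2 -> gauss y * egauss u ^+ n = 1.
Proof.
move=> yu; rewrite /egauss -expRM_natr /gauss -expRD yu -[RHS]expR0; congr expR; field=> //.
Qed.

Lemma scaled_sqr n (y : R) : (0 < n)%N -> y ^+ 2 = n%:R * (y / Num.sqrt n%:R) ^+ 2.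
Proof.
move=> n0; rewrite exprMn exprVn sqr_sqrtr ?ler0n//; field.
by rewrite pnatr_eq0 -lt0n.
Qed.

Lemma cube_integrandE d y : (0 < d)%N -> cube_integrand d y =
  ((2 / s2p) ^+ d * sing (y / Num.sqrt d%:R) ^+ d)%:C * 'i%C ^+ d.
Proof.
move=> d0; rewrite /cube_integrand; set u := y / _.
have -> : 2 * Phi ('i%C * u%:C) - 1 = (2 / s2p * sing u * egauss u)%:C * 'i%C.
  rewrite Phi_im -[2]/(2%:R) -(rmorph_nat (real_complex R)).
  by apply/eqP; rewrite eq_complex /=; apply/andP; split; apply/eqP; field; rewrite ?gt_eqF ?sqrt_2pi_gt0.
rewrite -/(gauss y) exprMn mulrAC; congr (_ * _).
rewrite -(rmorphXn (real_complex R)) -rmorphM; congr (_%:C).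
rewrite -exprMn [LHS](_ : _ = (2 / s2p * sing u) ^+ d * (gauss y * egauss u ^+ d)).
  by rewrite (gauss_scale_egauss (scaled_sqr y d0)) mulr1.
by rewrite [in LHS]exprMn; ring.
Qed.

(** The power d + 1 of [Phi] carries d + 1 factors [egauss]; the Gaussian removes d of them and one
    is left. *)
Lemma simplex_integrandE d y (u := y / Num.sqrt d%:R) : (0 < d)%N -> simplex_integrand d y =
  (2 / s2p ^+ d.+1 * (complex.Re (gpair u ^+ d.+1) * egauss u))%:C.
Proof.
move=> d0; rewrite /simplex_integrand -/u.
have -> : - ('i%C * u%:C) = 'i%C * (- u)%:C :> R[i] by rewrite rmorphN mulrN.
rewrite !Phi_imE gpairN (_ : egauss (- u) = egauss u) 2?exprMn; last by rewrite /egauss sqrrN.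
rewrite -mulrDr -(rmorphXn (real_complex R)) -rmorphXn.
have -> : gpair u ^+ d.+1 + (gpair u ^+ d.+1)^*%C = (2 * complex.Re (gpair u ^+ d.+1))%:C.
  by rewrite addcJ rmorphM rmorph_nat.
rewrite -/(gauss y) -!rmorphM; congr (_%:C).
rewrite exprMn exprVn exprS; have := gauss_scale_egauss (scaled_sqr y d0); rewrite -/u => E.
transitivity (2 / s2p ^+ d.+1 * (complex.Re (gpair u ^+ d.+1) * egauss u) * (gauss y * egauss u ^+ d)).
  by ring.
by rewrite E mulr1.
Qed.

(** Here d factors [egauss] meet a Gaussian that removes d - 1 of them, so again one is left. *)
Lemma crosspolytope_integrandE d y (u := y / Num.sqrt d.-1%:R) : (1 < d)%N -> y != 0 ->
  crosspolytope_integrand d y =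
  (Num.sqrt d.-1%:R * s2p ^+ d)^-1 * (u^-1 * complex.Im (gpair u ^+ d) * egauss u).
Proof.
move=> d1 y0; rewrite /crosspolytope_integrand /right_ext0 (negbTE y0) -/u.
have d10 : (0 < d.-1)%N by case: d d1 {u} => [|[]].
have d0 : Num.sqrt d.-1%:R != 0 :> R by rewrite gt_eqF// sqrtr_gt0 ltr0n.
rewrite Phi_imE exprMn -(rmorphXn (real_complex R)).
have -> (a : R) (z : R[i]) : complex.Im (a%:C * z) = a * complex.Im z.
  by case: z => p q; rewrite /= mul0r addr0.
rewrite -/(gauss y) exprMn exprVn -[in egauss u ^+ d](prednK (ltnW d1)) exprS.
have := gauss_scale_egauss (scaled_sqr y d10); rewrite -/u => E.
have -> : y^-1 = (Num.sqrt d.-1%:R)^-1 * u^-1 by rewrite /u invfM invrK mulrCA mulVf// mulr1.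
clearbody u; rewrite invfM.
transitivity ((Num.sqrt d.-1%:R)^-1 / s2p ^+ d * (u^-1 * complex.Im (gpair u ^+ d) * egauss u)
   * (gauss y * egauss u ^+ d.-1)); first by ring.
by rewrite E mulr1.
Qed.

End integrands_closed_form.

(** * Hyperbolic volume in polar form *)

Section rectangle_tonelli.
Context d1 d2 (T1 : measurableType d1) (T2 : measurableType d2) (R : realType).
Variables (m1 : {sigma_finite_measure set T1 -> \bar R})
  (m2 : {sigma_finite_measure set T2 -> \bar R}).
Variables (A : set T1) (B : set T2) (f : T1 * T2 -> \bar R).
Hypotheses (mA : measurable A) (mB : measurable B)
  (mf : measurable_fun setT f) (f0 : forall p, (0 <= f p)%E).

Let g := f \_ (A `*` B).

Let mg : measurable_fun setT g.
Proof. by apply/(measurable_restrictT _ _).1; [exact: measurableX|exact: measurable_funTS]. Qed.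

Let g0 p : (0 <= g p)%E.
Proof. by rewrite /g patchE; case: ifP. Qed.

Let gE1 x : (\int[m2]_y g (x, y) = ((fun x => \int[m2]_(y in B) f (x, y)) \_ A) x)%E.
Proof.
rewrite [RHS]patchE; case: ifPn => [xA|/negP xA].
  rewrite [RHS]integral_mkcond; apply: eq_integral => y _; rewrite !patchE.
  congr (if _ then _ else _); apply/idP/idP; rewrite !inE => /=; first by case.
  by move=> By; split => //; rewrite inE in xA.
apply: integral0_eq => y _; rewrite /g patchE ifF//; apply/negP.
by rewrite inE => -[/= Ax _]; apply: xA; rewrite inE.
Qed.

Let gE2 y : (\int[m1]_x g (x, y) = ((fun y => \int[m1]_(x in A) f (x, y)) \_ B) y)%E.
Proof.
rewrite [RHS]patchE; case: ifPn => [yB|/negP yB].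
  rewrite [RHS]integral_mkcond; apply: eq_integral => x _; rewrite !patchE.
  congr (if _ then _ else _); apply/idP/idP; rewrite !inE => /=; first by case.
  by move=> Ax; split => //; rewrite inE in yB.
apply: integral0_eq => x _; rewrite /g patchE ifF//; apply/negP.
by rewrite inE => -[/= _ By]; apply: yB; rewrite inE.
Qed.

Lemma ge0_tonelli_rect : (\int[m1]_(x in A) \int[m2]_(y in B) f (x, y) =
  \int[m2]_(y in B) \int[m1]_(x in A) f (x, y))%E.
Proof.
rewrite integral_mkcond; under eq_integral do rewrite -gE1.
rewrite (@fubini_tonelli _ _ _ _ _ m1 m2 g mg g0) [RHS]integral_mkcond.
by apply: eq_integral => y _; rewrite gE2.
Qed.

Lemma measurable_fun_section_integral :
  measurable_fun B (fun y => \int[m1]_(x in A) f (x, y))%E.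
Proof.
apply/(measurable_restrictT _ mB).2.
rewrite (_ : _ \_ _ = (fun y => \int[m1]_x g (x, y))%E); last by apply/funext => y; rewrite gE2.
exact: measurable_fun_fubini_tonelli_G.
Qed.

End rectangle_tonelli.

Section hyperbolic_volume_polar.
Context (R : realType).
Let T := measurableTypeR R.
Local Notation leb := (@lebesgue_measure R).
Local Notation ltuple := (lebesgue_tuple R).
Local Notation hl := (`[0%R, +oo[%classic : set R).

Definition tsqr n (t : n.-tuple T) : R := \sum_(k < n) tnth t k ^+ 2.

Lemma measurable_tsqr n : measurable_fun setT (@tsqr n).
Proof. exact: measurable_sum_sqr. Qed.

Lemma tsqr_ge0 n (t : n.-tuple T) : 0 <= tsqr t.
Proof. by apply: sumr_ge0 => k _; exact: sqr_ge0. Qed.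

Lemma enorm_row_of_tuple n (t : n.-tuple T) : enorm (row_of_tuple t) = Num.sqrt (tsqr t).
Proof. by rewrite /enorm; congr Num.sqrt; apply: eq_bigr => k _; rewrite mxE. Qed.

Lemma sqr_enorm_row_of_tuple n (t : n.-tuple T) : enorm (row_of_tuple t) ^+ 2 = tsqr t.
Proof. by rewrite enorm_row_of_tuple sqr_sqrtr// tsqr_ge0. Qed.

(** Normalized so that, inside the open ball, the integral over r >= 0 is the density of hyperbolic
    volume. *)
Definition polar_density n (p : T * n.-tuple T) : R :=
  (gmoment R n)^-1 * (p.1 ^+ n * expR (- (1 - tsqr p.2) * p.1 ^+ 2 / 2)).

Lemma measurable_polar_density n : measurable_fun setT (@polar_density n).
Proof.
apply: measurable_funM; first exact: measurable_cst.
apply: measurable_funM.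
  by apply: measurable_funX; exact: measurable_fst.
apply: measurableT_comp => //; apply: measurable_funM; last exact: measurable_cst.
apply: measurable_funM.
  apply: measurableT_comp => //; apply: measurable_funB => //.
  by apply: (measurableT_comp (@measurable_tsqr n)); exact: measurable_snd.
by apply: measurable_funX; exact: measurable_fst.
Qed.

Lemma polar_density_ge0 n (p : T * n.-tuple T) : 0 <= p.1 -> 0 <= polar_density p.
Proof.
move=> p0; rewrite mulr_ge0 ?invr_ge0 ?(ltW (gmoment_gt0 _ _))//.
by rewrite mulr_ge0 ?exprn_ge0 ?expR_ge0.
Qed.

Lemma integral_polar_density n (t : n.-tuple T) : tsqr t < 1 ->
  (\int[leb]_(r in hl) (polar_density (r, t))%:E =
   (((1 - tsqr t) `^ (n.+1%:R / 2))^-1)%:E)%E.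
Proof.
rewrite -subr_gt0 /polar_density /=; set a := 1 - _ => a0.
have s0 : 0 < Num.sqrt a by rewrite sqrtr_gt0.
have C0 := gmoment_gt0 R n.
pose f (x : R) := x ^+ n * gauss x.
have mf : measurable_fun setT f.
  by apply: measurable_funM; [exact: measurable_funX|exact: measurable_gauss].
transitivity (\int[leb]_(r in hl) (((gmoment R n)^-1 * Num.sqrt a ^- n)%:E * (f (Num.sqrt a * r)%R)%:E))%E.
  apply: eq_integral => r _; rewrite -EFinM; congr EFin; rewrite /f exprMn /gauss exprMn sqr_sqrtr ?(ltW a0)//.
  by rewrite [- a * _]mulNr; field; rewrite ?expf_neq0 ?gt_eqF.
have if0 := integrable_gmoment R n.
rewrite integralZl//; last exact: integrable_scale_hl.
rewrite integral_scale_hl// -[X in (_ * (_ * X))%E]fineK; last exact: integrable_fin_num if0.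
rewrite -[fine _]/(gmoment R n) -!EFinM; congr EFin.
rewrite [n.+1%:R / 2]mulrC powRrM powR12_sqrt ?(ltW a0)// powR_mulrn ?sqrtr_ge0//.
by rewrite exprS; field; rewrite expf_neq0 ?gt_eqF.
Qed.

(** [hyp_vol] sees only the open ball, whereas the polytopes touch the unit sphere at their
    vertices. The sphere is a null set, so the whole of [B] can be kept as the domain. *)
Lemma hyp_vol_polar n (B : set 'rV[R]_n.+1) : measurable (@row_of_tuple R n.+1 @^-1` B) ->
  (forall x, B x -> enorm x <= 1) ->
  (hyp_vol B = \int[ltuple n.+1]_(t in @row_of_tuple R n.+1 @^-1` B)
     \int[leb]_(r in hl) (polar_density (r, t))%:E)%E.
Proof.
move=> mB B1; set S := _ @^-1` B.
have mhl : measurable (hl : set T) by exact: measurable_itv.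
(* The density can be negative at r < 0; its absolute value is nonnegative everywhere, as Tonelli
   demands, and agrees with it for r >= 0. *)
have mpos : measurable_fun setT (fun p : T * n.+1.-tuple T => (`|polar_density p|)%:E).
  by apply/measurable_EFinP/measurableT_comp => //; exact: measurable_polar_density.
have pE (t : n.+1.-tuple T) : (\int[leb]_(r in hl) (polar_density (r, t))%:E =
    \int[leb]_(r in hl) `|polar_density (r, t)|%:E)%E.
  apply: eq_integral => r; rewrite inE/= in_itv/= andbT => r0.
  by rewrite ger0_norm ?polar_density_ge0.
under [RHS]eq_integral do rewrite pE.
pose N : set (n.+1.-tuple T) := [set t | \sum_k tnth t k ^+ 2 = 1].
have mN : measurable N.
  by rewrite -[N]setTI; apply: (@measurable_sum_sqr R n.+1 _ [set 1]).
rewrite (ge0_negligible_integral mN)//; last 3 first.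
- apply: measurable_funTS.
  have := @measurable_fun_section_integral _ _ _ _ R leb hl setT _ mhl measurableT mpos.
  by apply => p; rewrite lee_fin.
- by move=> t _; apply: integral_ge0 => r _; rewrite lee_fin.
- exact: lebesgue_tuple_sphere.
have SN : S `\` N = S `&` @row_of_tuple R n.+1 @^-1` [set x | enorm x < 1].
  apply/seteqP; split => t /= [St].
    move=> Nt; split => //; rewrite lt_neqAle B1// andbT; apply/eqP => t1; apply: Nt.
    by rewrite /N/= -/(tsqr t) -sqr_enorm_row_of_tuple t1 expr1n.
  move=> t1; split => // Nt; move: t1.
  by rewrite enorm_row_of_tuple /tsqr Nt sqrtr1 ltxx.
rewrite SN /hyp_vol; apply: eq_integral => t; rewrite inE => -[_ /= t1].
rewrite -pE integral_polar_density; first by rewrite sqr_enorm_row_of_tuple.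
by rewrite -sqr_enorm_row_of_tuple expr_lt1// sqrtr_ge0.
Qed.

(* The change of variables (r, t) -> (s, r t) with s = r - (r t_1 + ... + r t_n). *)
Lemma ge0_integral_cone n (G : T * n.-tuple T -> R) :
  measurable_fun setT G -> (forall p, 0 <= G p) ->
  (\int[ltuple n]_(t in [set t | box hl n t /\ (tsum t <= 1)%R])
     \int[leb]_(r in hl) (r ^+ n * G (r, tuple_of_row (r *: row_of_tuple t))%R)%:E =
   \int[ltuple n]_(t in box hl n) \int[leb]_(s in hl) (G ((s + tsum t)%R, t))%:E)%E.
Proof.
move=> mG G0.
have mhl : measurable (hl : set T) by exact: measurable_itv.
have mS : measurable [set t : n.-tuple T | box hl n t /\ tsum t <= 1].
  apply: measurableI; first exact: measurable_box.
  rewrite -[X in measurable X]setTI; apply: (@measurable_tsum R n _ [set` `]-oo, 1]]) => //.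
(* The cone over the truncated orthant: its slice at height r > 0 is r times that set. *)
pose E : set (T * n.-tuple T) := [set p | box hl n p.2 /\ tsum p.2 <= p.1].
have mE : measurable E.
  apply: measurableI.
    by rewrite -[X in measurable X]setTI; apply: measurable_snd => //; exact: measurable_box.
  rewrite (_ : (fun _ => _) = (fun p : T * n.-tuple T => tsum p.2 - p.1) @^-1` [set` `]-oo, 0]]).
    have mh : measurable_fun setT (fun p : T * n.-tuple T => tsum p.2 - p.1).
      apply: measurable_funB; last exact: measurable_fst.
      by apply: (measurableT_comp (@measurable_tsum R n)); exact: measurable_snd.
    by rewrite -[X in measurable X]setTI; apply: mh => //; exact: measurable_itv.
  by apply/seteqP; split => p /=; rewrite in_itv/= subr_le0.
pose H := (EFin \o G) \_ E.
have mH : measurable_fun setT H.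
  by apply/(measurable_restrictT _ _).1 => //; apply/measurable_funTS/measurable_EFinP.
have H0 p : (0 <= H p)%E by rewrite /H patchE; case: ifP => //; rewrite lee_fin.
(* The slice r = 0 is dropped, because the homothety with ratio r is invertible only for r > 0. *)
pose hlo : set T := `]0%R, +oo[%classic.
have mhlo : measurable hlo by exact: measurable_itv.
pose F (p : T * n.-tuple T) : \bar R :=
  (`|p.1| ^+ n * G (p.1, tuple_of_row (p.1 *: row_of_tuple p.2)))%:E.
have mF : measurable_fun setT F.
  apply/measurable_EFinP/measurable_funM.
    by apply/measurable_funX/measurableT_comp => //; exact: measurable_fst.
  apply: (measurableT_comp mG); apply: measurable_fun_pair; first exact: measurable_fst.
  apply: measurable_fun_tuple_of_row => k; under eq_fun do rewrite !mxE.
  apply: measurable_funM; first exact: measurable_fst.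
  by apply: (measurableT_comp (measurable_tnth k)); exact: measurable_snd.
have F0 p : (0 <= F p)%E by rewrite lee_fin mulr_ge0// exprn_ge0.
transitivity (\int[ltuple n]_(t in [set t | box hl n t /\ (tsum t <= 1)%R]) \int[leb]_(r in hlo) F (r, t))%E.
  apply: eq_integral => t _.
  rewrite integral_itv_obnd_cbnd; last first.
    by apply: measurable_funTS; apply: (measurableT_comp mF); exact: measurable_pair2.
  apply: eq_integral => r; rewrite inE/= in_itv/= andbT => r0.
  by rewrite /F/= ger0_norm.
rewrite -(ge0_tonelli_rect _ _ mhlo mS mF F0).
transitivity (\int[leb]_(r in hlo) \int[ltuple n]_t H (r, t))%E.
  apply: eq_integral => r; rewrite inE /hlo/= in_itv/= andbT => r0.
  transitivity (\int[ltuple n]_t ((r ^+ n)%:E * H (r, tuple_of_row (r *: row_of_tuple t))))%E.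
    rewrite integral_mkcond; apply: eq_integral => t _; rewrite /H !patchE.
    have EE : (t \in [set t | box hl n t /\ tsum t <= 1]) =
        ((r, tuple_of_row (r *: row_of_tuple t)) \in E).
      have rt : r * tsum t = tsum (tuple_of_row (r *: row_of_tuple t)).
        by rewrite /tsum mulr_sumr; apply: eq_bigr => k _; rewrite tnth_mktuple !mxE.
      have bE : box hl n t <-> box hl n (tuple_of_row (r *: row_of_tuple t)).
        by split=> bt k; have := bt k; rewrite /= !in_itv/= !andbT tnth_mktuple !mxE pmulr_rge0.
      apply/idP/idP; rewrite !inE /E /= -rt => -[/bE bt tr]; split => //.
        by rewrite -[leRHS]mulr1 ler_pM2l.
      by move: tr; rewrite -[leRHS]mulr1 ler_pM2l.
    rewrite EE; case: ifP => _; last by rewrite mule0.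
    by rewrite /F/= gtr0_norm.
  rewrite ge0_integralZl//; last 2 first.
  - apply: (measurableT_comp mH); apply: measurable_fun_pair => //.
    apply: measurable_fun_tuple_of_row => k; under eq_fun do rewrite !mxE.
    by apply: measurable_funM => //; exact: measurable_tnth.
  - by rewrite lee_fin exprn_ge0// ltW.
  (* The Jacobian r^(-n) is compensated by the factor r^n of the integrand. *)
  rewrite (ge0_integral_tuple_scale (f := fun t => H (r, t)))//.
    by rewrite muleA -EFinM mulfV ?mul1e// expf_neq0// gt_eqF.
  by apply: (measurableT_comp mH); exact: measurable_pair1.
rewrite (ge0_tonelli_rect _ _ mhlo measurableT mH H0) [RHS]integral_mkcond.
apply: eq_integral => t _; rewrite patchE; case: ifPn => tb; last first.
  apply: integral0_eq => r _; rewrite /H patchE ifF//.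
  by apply/negP; rewrite inE => -[/= bt _]; move/negP: tb; apply; rewrite inE.
rewrite inE in tb.
have ts0 : 0 <= tsum t by have /andP[] := tsum_le_prod tb.
pose g : R -> \bar R := (fun r => (G (r, t))%:E) \_ `[tsum t, +oo[.
have mg : measurable_fun setT g.
  apply/(measurable_restrictT _ _).1; first exact: measurable_itv.
  by apply/measurable_funTS/measurable_EFinP/(measurableT_comp mG); exact: measurable_pair2.
transitivity (\int[leb]_x g x)%E.
  rewrite integral_itv_obnd_cbnd; last first.
    by apply: measurable_funTS; apply: (measurableT_comp mH); exact: measurable_pair2.
  rewrite integral_mkcond; apply: eq_integral => r _; rewrite /g /H !patchE.
  have -> : ((r, t) \in E) = (r \in `[tsum t, +oo[%classic).
    by apply/idP/idP; rewrite !inE /E /= in_itv/= andbT; [case|split].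
  case: ifPn => // /negP rl; rewrite ifF//; apply/negP; rewrite inE/= in_itv/= andbT => tr.
  by apply: rl; rewrite inE/= in_itv/= andbT (le_trans ts0).
have := @ge0_integral_affine R 1 (tsum t) g (oner_neq0 _) mg.
rewrite normr1 invr1 mul1e => <-; last by move=> x; rewrite /g patchE; case: ifP => //; rewrite lee_fin.
rewrite [RHS]integral_mkcond; apply: eq_integral => r _; rewrite /g !patchE mul1r.
congr (if _ then _ else _).
by apply/idP/idP; rewrite !inE/= !in_itv/= !andbT lerDr.
Qed.
End hyperbolic_volume_polar.

(** * Reduction to the orthant by reflections *)

Section reflection.
Context (R : realType).
Let T := measurableTypeR R.
Local Notation leb := (@lebesgue_measure R).
Local Notation ltuple := (lebesgue_tuple R).
Local Notation hl := (`[0%R, +oo[%classic : set R).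

Lemma ge0_integral_even (g : R -> \bar R) : measurable_fun setT g ->
  (forall x, (0 <= g x)%E) -> (forall x, g (- x) = g x) ->
  (\int[leb]_x g x = 2%:E * \int[leb]_(x in hl) g x)%E.
Proof.
move=> mg g0 eg.
have mneg : measurable (`]-oo, 0%R[ : set T) by exact: measurable_itv.
have mhl : measurable (hl : set T) by exact: measurable_itv.
have setTE : setT = `]-oo, 0%R[ `|` hl :> set R.
  by apply/seteqP; split => // x _; have [x0|x0] := ltP x 0; [left|right]; rewrite /= in_itv/= ?andbT.
rewrite -[X in (X * _)%E]/(1 + 1)%:E EFinD ge0_muleDl ?lee_fin// mul1e.
rewrite [LHS](_ : _ = \int[leb]_(x in `]-oo, 0%R[ `|` hl) g x)%E ?setTE//.
rewrite ge0_integral_setU//; last 2 first.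
- by rewrite -setTE.
- apply/disj_setPLR => x /=; rewrite !in_itv/= andbT => x0.
  by apply/negP; rewrite -ltNge.
congr (_ + _)%E; rewrite -[RHS]integral_itv_obnd_cbnd; last exact: measurable_funTS.
rewrite [LHS]integral_mkcond [RHS]integral_mkcond.
have m1 : -1 != 0 :> R by rewrite oppr_eq0 oner_neq0.
have := @ge0_integral_affine R (-1) 0 (g \_ `]-oo, 0%R[) m1.
rewrite normrN1 invr1 mul1e => <-.
- apply: eq_integral => x _; rewrite addr0 mulN1r !patchE eg; congr (if _ then _ else _).
  by apply/idP/idP; rewrite !inE/= !in_itv/= andbT oppr_lt0.
- exact/(measurable_restrictT _ _).1/measurable_funTS.
- by move=> x; rewrite patchE; case: ifP.
Qed.

Lemma Rintegral_even (f : R -> R) : leb.-integrable hl (EFin \o f) ->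
  measurable_fun setT f -> (forall x, f (- x) = f x) ->
  leb.-integrable setT (EFin \o f) /\ \int[leb]_x f x = 2 * \int[leb]_(x in hl) f x.
Proof.
move=> /integrableP[_ ioo] mf ef.
have mfe : measurable_fun setT (EFin \o f) by exact/measurable_EFinP.
have i2 : leb.-integrable hl (EFin \o f) by apply/integrableP; split => //; exact: measurable_funTS.
have mhl : measurable (hl : set T) by exact: measurable_itv.
split.
  apply/integrableP; split => //.
  rewrite ge0_integral_even//.
  - by rewrite lte_mul_pinfty// lee_fin.
  - exact: measurableT_comp.
  - by move=> x /=; rewrite ef.
rewrite /Rintegral -[2]/(fine 2%:E) -fineM//; last exact: (integrable_fin_num mhl i2).
congr fine; rewrite integralE [in RHS]integralE.
rewrite !ge0_integral_even//; last 4 first.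
- exact: measurable_funeneg.
- by move=> x; rewrite !funenegE ef.
- exact: measurable_funepos.
- by move=> x; rewrite !funeposE ef.
by apply/esym/muleBr => //; apply: fin_num_adde_defl;
  rewrite fin_numN; exact: (integrable_neg_fin_num mhl i2).
Qed.

Definition tuple_abs n (t : n.-tuple T) : n.-tuple T := [tuple `|tnth t k| | k < n].

Lemma ge0_integral_orthant n (f : n.-tuple T -> \bar R) : measurable_fun setT f ->
  (forall t, (0 <= f t)%E) -> (forall t, f (tuple_abs t) = f t) ->
  (\int[ltuple n]_t f t = (2 ^+ n)%:E * \int[ltuple n]_(t in box hl n) f t)%E.
Proof.
have mhl : measurable (hl : set T) by exact: measurable_itv.
elim: n f => [|n IH] f mf f0 ef.
  by rewrite integral_tuple0 mul1e -(boxT R 0) integral_tuple0.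
have abs_cons x (t : n.-tuple T) : tuple_abs [tuple of x :: t] = [tuple of `|x| :: tuple_abs t].
  apply: eq_from_tnth => k; rewrite tnth_mktuple.
  by case: (unliftP ord0 k) => [j ->|->]; rewrite ?tnthS ?tnth0 ?tnth_mktuple.
have abs_idem m (t : m.-tuple T) : tuple_abs (tuple_abs t) = tuple_abs t.
  by apply: eq_from_tnth => k; rewrite !tnth_mktuple normr_id.
rewrite ge0_integral_tupleS//.
transitivity (\int[leb]_x ((2 ^+ n)%:E * \int[ltuple n]_(t in box hl n) f [tuple of x :: t]))%E.
  apply: eq_integral => x _; apply: IH.
  - by apply: measurableT_comp => //; exact: measurable_fun_consl.
  - by [].
  - by move=> t; rewrite -ef abs_cons abs_idem -abs_cons ef.
have mF : measurable_fun setT (fun x : T => \int[ltuple n]_(t in box hl n) f [tuple of x :: t])%E.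
  pose F (p : n.-tuple T * T) := f [tuple of p.2 :: p.1].
  apply: (@measurable_fun_section_integral _ _ _ _ R (ltuple n) (box hl n) setT F) => //.
  - exact: measurable_box.
  - by apply: (measurableT_comp mf); apply: measurable_cons; [exact: measurable_snd|exact: measurable_fst].
  - by move=> p; exact: f0.
have F0 (x : T) : (0 <= \int[ltuple n]_(t in box hl n) f [tuple of x :: t])%E.
  by apply: integral_ge0.
rewrite ge0_integralZl// ?lee_fin ?exprn_ge0//.
rewrite ge0_integral_even//.
  by rewrite ge0_integral_boxS// muleA -EFinM -exprSr.
move=> x; apply: eq_integral => t _.
by rewrite -ef -[in RHS]ef !abs_cons normrN.
Qed.

End reflection.

(** * The cube *)

Section cube_volume.
Context (R : realType).
Let T := measurableTypeR R.
Local Notation leb := (@lebesgue_measure R).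
Local Notation ltuple := (lebesgue_tuple R).
Local Notation hl := (`[0%R, +oo[%classic : set R).

(** For fixed r the factor exp(r^2 |y|^2/2) is a product over the coordinates, and every
    one-dimensional integral is a Dawson value. *)
Lemma hyp_vol_cube d : (2 <= d)%N -> hyp_vol (@ideal_cube R d) =
  ((gmoment R d)^-1 * \int[leb]_(r in hl) (2 * sing (r / Num.sqrt d%:R)) ^+ d)%:E.
Proof.
case: d => [|n]// d2; set d := n.+1; set a := (Num.sqrt d%:R)^-1 : R.
have d0 : (0 < d)%N by [].
have a0 : 0 < a by rewrite invr_gt0 sqrtr_gt0 ltr0n.
(* The vertices lie on the unit sphere. The same identity later cancels [gauss r] against the d
   factors [egauss (r * a)]. *)
have a2 : d%:R * a ^+ 2 = 1 by rewrite exprVn sqr_sqrtr ?ler0n// mulfV// pnatr_eq0.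
have mhl : measurable (hl : set T) by exact: measurable_itv.
pose I : set T := `[- a, a]%classic.
have mI : measurable I by exact: measurable_itv.
have SE : @row_of_tuple R d @^-1` @ideal_cube R d = box I d.
  apply/seteqP; split => t /= ht k; have := ht k; by rewrite /I/= !in_itv/= ?mxE.
rewrite hyp_vol_polar ?SE; last 2 first.
- exact: measurable_box.
- move=> x xc; rewrite -[leRHS]sqrtr1 ler_sqrt// -a2.
  rewrite (_ : d%:R * _ = \sum_(k < d) a ^+ 2); last by rewrite sumr_const card_ord mulr_natl.
  apply: ler_sum => k _; rewrite -(real_normK (num_real (x 0 k))).
  by rewrite ler_pXn2r ?nnegrE ?(ltW a0)// ler_norml; exact: xc.
pose F (p : T * d.-tuple T) : \bar R := `|polar_density p|%:E.
have mF : measurable_fun setT F.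
  by apply/measurable_EFinP/measurableT_comp => //; exact: measurable_polar_density.
transitivity (\int[ltuple d]_(t in box I d) \int[leb]_(r in hl) F (r, t))%E.
  apply: eq_integral => t _; apply: eq_integral => r; rewrite inE/= in_itv/= andbT => r0.
  by rewrite /F ger0_norm ?polar_density_ge0.
have F0 p : (0 <= F p)%E by rewrite lee_fin.
have mB := @measurable_box R I d mI.
rewrite -(ge0_tonelli_rect _ _ mhl mB mF F0).
have C0 := gmoment_gt0 R d.
transitivity (\int[leb]_(r in hl) ((gmoment R d)^-1 * (2 * sing (r * a)) ^+ d)%:E)%E.
  apply: eq_integral => r; rewrite inE/= in_itv/= andbT => r0.
  pose h x := egauss (r * x).
  have h0 x : 0 <= h x by exact: expR_ge0.
  have mh : measurable_fun setT h.
    apply: (measurableT_comp (@measurable_egauss R)); exact: mulrl_measurable.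
  have ih : leb.-integrable I (EFin \o h).
    apply: continuous_compact_integrable; first exact: segment_compact.
    apply: continuous_subspaceT => x.
    by apply: (@continuous_comp _ _ _ ( *%R r) (@egauss R)); [exact: mulrl_continuous|exact: continuous_egauss].
  have hE : r * (\int[leb]_(x in I) h x) = 2 * sing (r * a) * egauss (r * a).
    rewrite -RintegralZl//; have := @integral_egauss R r (- a) a.
    rewrite gtrN// => /(_ isT)/(congr1 fine)/= H.
    transitivity (sing (r * a) * egauss (r * a) - sing (r * - a) * egauss (r * - a)); first exact: H.
    rewrite mulrN singN (_ : egauss (- (r * a)) = egauss (r * a)); last by rewrite /egauss sqrrN.
    by ring.
  transitivity (\int[ltuple d]_(t in box I d) (((gmoment R d)^-1 * r ^+ d * gauss r)%:E *
      (\prod_(k < d) h (tnth t k))%:E))%E.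
    apply: eq_integral => t _; rewrite /F ger0_norm ?polar_density_ge0//.
    rewrite -EFinM; congr EFin; rewrite /polar_density /= -!mulrA; congr (_ * (_ * _)).
    rewrite -expR_sum -expRD; congr expR.
    rewrite (_ : \sum_(k < d) _ = tsqr t * (r ^+ 2 / 2)); first by field.
    by rewrite /tsqr mulr_suml; apply: eq_bigr => k _; rewrite exprMn; ring.
  rewrite ge0_integralZl//; last 3 first.
  - apply/measurable_EFinP/measurable_funTS.
    apply: (@measurable_prod _ _ _ _ _ (index_enum 'I_d) (fun k t => h (tnth t k))) => k _.
    by apply: (measurableT_comp mh); exact: measurable_tnth.
  - by move=> t _; rewrite lee_fin prodr_ge0.
  - by rewrite lee_fin !mulr_ge0 ?invr_ge0 ?(ltW C0) ?exprn_ge0 ?gauss_ge0.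
  rewrite ge0_integral_box_prod//; last first.
    rewrite -ge0_fin_numE; first exact: (integrable_fin_num mI ih).
    by apply: integral_ge0 => x _; rewrite lee_fin.
  rewrite -EFinM; congr EFin.
  transitivity ((gmoment R d)^-1 * gauss r * (r * \int[leb]_(x in I) h x) ^+ d).
    by rewrite exprMn; ring.
  rewrite hE exprMn; have : r ^+ 2 = d%:R * (r * a) ^+ 2.
    by rewrite exprMn mulrCA a2 mulr1.
  move=> /gauss_scale_egauss E.
  transitivity ((gmoment R d)^-1 * (2 * sing (r * a)) ^+ d * (gauss r * egauss (r * a) ^+ d)).
    by ring.
  by rewrite E mulr1.
have i0 : leb.-integrable hl (EFin \o (fun r => (2 * sing (r * a)) ^+ d)).
  rewrite (_ : (fun r => _) = (fun r => 2 ^+ d * sing (a * r) ^+ d)); last first.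
    by apply/funext => r; rewrite exprMn [r * a]mulrC.
  apply: integrableZlR => //; apply: (integrable_scale_hl (f := fun x => sing x ^+ d)) => //.
    by apply: measurable_funX; exact: measurable_sing.
  exact: integrable_singX.
rewrite (_ : (fun r => _) = (fun r => ((gmoment R d)^-1%:E * ((2 * sing (r * a)) ^+ d)%:E)%E)).
  rewrite integralZl// EFinM /Rintegral fineK//; exact: (integrable_fin_num mhl i0).
by apply/funext => r; rewrite EFinM.
Qed.

End cube_volume.

(** * Continuation of the orthant integrals to k = -1 *)

Section orthant_continuation.
Context (R : realType).
Let T := measurableTypeR R.
Local Notation leb := (@lebesgue_measure R).
Local Notation ltuple := (lebesgue_tuple R).
Local Notation hl := (`[0%R, +oo[%classic : set R).
Implicit Types (x u : R).

Lemma tgaussE n (t : n.-tuple T) : tgauss t = expR (- (tsqr t / 2)).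
Proof.
rewrite /tgauss /gauss -expR_sum; congr expR.
by rewrite /tsqr mulr_suml -sumrN; apply: eq_bigr => k _; rewrite mulNr.
Qed.

(** For nonnegative entries |t|^2 <= (t_1 + ... + t_n)^2, so the one-dimensional decay of the weight
    controls all coordinates. *)
Lemma gauss_tsum_le n (t : n.-tuple T) : box hl n t -> gauss (tsum t) <= tgauss t.
Proof.
move=> tb; rewrite tgaussE /gauss ler_expR mulNr lerN2 ler_pM2r ?invr_gt0//.
have t0 k : 0 <= tnth t k by have := tb k; rewrite /= in_itv/= andbT.
rewrite /tsqr /tsum expr2 mulr_suml; apply: ler_sum => k _.
rewrite expr2 ler_wpM2l// (bigD1 k)//= lerDl.
by apply: sumr_ge0 => i _; exact: t0.
Qed.

Section weight.
Variables (n : nat) (phi : R -> R) (K : R).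
Hypotheses (mphi : measurable_fun setT phi) (phi0 : forall s, 0 <= s -> 0 <= phi s)
  (phiK : forall s, 0 <= s -> phi s <= K * gauss s).

Let mhl : measurable (hl : set T). Proof. exact: measurable_itv. Qed.
Let mb : measurable (box hl n). Proof. exact: measurable_box. Qed.

Lemma measurable_weight : measurable_fun setT (fun t : n.-tuple T => phi (tsum t)).
Proof. by apply: (measurableT_comp mphi); exact: measurable_tsum. Qed.

(** The weight is at most K exp(-|t|^2/2). Half of this exponent absorbs the power of |t|^2, and the
    other half, the product of the [h (tnth t k)], stays integrable. *)
Lemma integrable_weight_moment N : (ltuple n).-integrable (box hl n)
  (EFin \o (fun t : n.-tuple T => phi (tsum t) * (tsqr t / 2) ^+ N)).
Proof.
have K0 : 0 <= K by have := le_trans (phi0 (lexx 0)) (phiK (lexx 0)); rewrite gauss0 mulr1.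
pose h x := expR (- 4^-1 * x ^+ 2) : R.
have mh : measurable_fun setT h.
  by apply: measurableT_comp => //; exact: measurable_funM.
apply: (integrable_le_norm mb
    (g := fun t : n.-tuple T => K * (N`!%:R * 2 ^+ N) * \prod_(k < n) h (tnth t k))).
- apply/measurable_funTS/measurable_funM; first exact: measurable_weight.
  by apply/measurable_funX/measurable_funM => //; exact: measurable_tsqr.
- move=> t tb; have /andP[s0 _] := tsum_le_prod tb.
  have q0 := tsqr_ge0 t.
  have u0 : 0 <= tsqr t / 4 by rewrite divr_ge0.
  rewrite ger0_norm ?mulr_ge0 ?exprn_ge0 ?phi0 ?divr_ge0//.
  have -> : \prod_(k < n) h (tnth t k) = expR (- (tsqr t / 4)).
    rewrite -expR_sum; congr expR; rewrite /tsqr mulr_suml -sumrN.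
    by apply: eq_bigr => k _; rewrite mulrC mulrN.
  have H1 : phi (tsum t) <= K * tgauss t.
    by rewrite (le_trans (phiK s0))// ler_wpM2l// gauss_tsum_le.
  have H2 : (tsqr t / 2) ^+ N <= N`!%:R * 2 ^+ N * expR (tsqr t / 4).
    have -> : tsqr t / 2 = 2 * (tsqr t / 4) by field.
    have := tay_le_expR N.+1 u0; rewrite tayS => H.
    have : (tsqr t / 4) ^+ N / N`!%:R <= expR (tsqr t / 4).
      by rewrite (le_trans _ H)// lerDr tay_ge0.
    rewrite ler_pdivrMr ?ltr0n ?fact_gt0// => {}H.
    rewrite exprMn; apply: (le_trans (ler_wpM2l _ H)); first by rewrite exprn_ge0.
    by rewrite le_eqVlt; apply/orP; left; apply/eqP; ring.
  apply: (le_trans (ler_pM (phi0 s0) _ H1 H2)).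
    by rewrite exprn_ge0// divr_ge0.
  rewrite tgaussE le_eqVlt; apply/orP; left; apply/eqP.
  have -> : expR (- (tsqr t / 4)) = expR (- (tsqr t / 2)) * expR (tsqr t / 4).
    by rewrite -expRD; congr expR; field.
  by ring.
- apply: integrableZlR => //; apply: (@integrable_tuple_prod R hl n h) => //.
  by move=> x; exact: expR_ge0.
  by apply: integrable_gauss_scale; rewrite invr_gt0.
Qed.

(** The substitution t -> sqrt(k) t moves k from the Gaussian into the weight, where the orthant
    transforms expect it. *)
Lemma Rintegral_weight_scale k : 0 < k ->
  \int[ltuple n]_(t in box hl n) (phi (tsum t) * expR (- (k * (tsqr t / 2)))) =
  Num.sqrt k ^- n * \int[ltuple n]_(t in box hl n) (phi (tsum t / Num.sqrt k) * tgauss t).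
Proof.
move=> k0; have s0 : 0 < Num.sqrt k by rewrite sqrtr_gt0.
pose f (t : n.-tuple T) : \bar R := `|phi (tsum t / Num.sqrt k) * tgauss t|%:E.
have mf : measurable_fun setT (f \_ (box hl n)).
  apply/(measurable_restrictT _ _).1 => //; apply/measurable_funTS/measurable_EFinP.
  apply: measurableT_comp => //; apply: measurable_funM; last exact: measurable_tgauss.
  by apply: (measurableT_comp mphi); apply: measurable_funM => //; exact: measurable_tsum.
have f0 t : (0 <= (f \_ (box hl n)) t)%E by rewrite patchE; case: ifP => // _; rewrite /f lee_fin.
have boxE (t : n.-tuple T) :
    (tuple_of_row (Num.sqrt k *: row_of_tuple t) \in box hl n) = (t \in box hl n).
  by apply/idP/idP; rewrite !inE => bt i; have := bt i;
    rewrite /= !in_itv/= !andbT tnth_mktuple !mxE pmulr_rge0.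
have sE (t : n.-tuple T) : tsum (tuple_of_row (Num.sqrt k *: row_of_tuple t)) = Num.sqrt k * tsum t.
  by rewrite /tsum mulr_sumr; apply: eq_bigr => i _; rewrite tnth_mktuple !mxE.
have qE (t : n.-tuple T) : tsqr (tuple_of_row (Num.sqrt k *: row_of_tuple t)) = k * tsqr t.
  rewrite /tsqr mulr_sumr; apply: eq_bigr => i _; rewrite tnth_mktuple !mxE exprMn.
  by rewrite sqr_sqrtr// ltW.
rewrite /Rintegral; have E := ge0_integral_tuple_scale s0 mf f0.
have -> : (\int[ltuple n]_(t in box hl n) (phi (tsum t) * expR (- (k * (tsqr t / 2))))%:E =
   \int[ltuple n]_t (f \_ (box hl n)) (tuple_of_row (Num.sqrt k *: row_of_tuple t)))%E.
  rewrite integral_mkcond; apply: eq_integral => t _; rewrite !patchE boxE.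
  case: ifPn => //; rewrite inE => tb; have /andP[ts0 _] := tsum_le_prod tb.
  rewrite /f sE tgaussE qE mulrAC mulfV ?mul1r ?gt_eqF// ger0_norm ?mulrA//.
  by rewrite mulr_ge0 ?expR_ge0 ?phi0.
have -> : (\int[ltuple n]_(t in box hl n) (phi (tsum t / Num.sqrt k) * tgauss t)%:E =
   \int[ltuple n]_t (f \_ (box hl n)) t)%E.
  rewrite integral_mkcond; apply: eq_integral => t _; rewrite !patchE.
  case: ifPn => //; rewrite inE => tb; have /andP[ts0 _] := tsum_le_prod tb.
  by rewrite /f ger0_norm// mulr_ge0 ?tgauss_ge0 ?phi0// divr_ge0// ltW.
have c0 : 0 < Num.sqrt k ^- n by rewrite invr_gt0 exprn_gt0.
(* If the integral is infinite, [fine] sends both sides to 0. *)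
rewrite E; case: (\int[_]__ _)%E => [r| |] //=.
  by rewrite gt0_muley ?lte_fin//= mulr0.
by rewrite gt0_muleNy ?lte_fin//= mulr0.
Qed.

End weight.

(** The density at k = -1 dominates those at k > 0, so its integrability covers them all. *)
Lemma norm_gauss_le_egauss (a x y : R) : `|gauss y * a| <= `|a * egauss x|.
Proof.
rewrite normrM [leRHS]normrM [leLHS]mulrC; apply: ler_wpM2l => //.
rewrite (ger0_norm (gauss_ge0 y)) (ger0_norm (expR_ge0 _)) (le_trans (gauss_le1 y))//.
by rewrite -[leLHS]expR0 ler_expR divr_ge0 ?sqr_ge0.
Qed.

Lemma gauss_sqrtM (k x : R) : 0 <= k -> gauss (Num.sqrt k * x) = expR (- (k * (x ^+ 2 / 2))).
Proof. by move=> k0; rewrite /gauss exprMn sqr_sqrtr// mulNr mulrA. Qed.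

Lemma measurable_gtail : measurable_fun setT (@gtail R).
Proof.
have mhl : measurable (hl : set T) by exact: measurable_itv.
pose F (p : T * T) : \bar R := (gauss (p.1 + p.2)%R)%:E.
have mF : measurable_fun setT F.
  apply/measurable_EFinP; apply: (measurableT_comp (@measurable_gauss R)).
  by apply: measurable_funD; [exact: measurable_fst|exact: measurable_snd].
have F0 p : (0 <= F p)%E by rewrite lee_fin gauss_ge0.
have := @measurable_fun_section_integral _ _ _ _ R leb hl setT F mhl measurableT mF F0.
by move=> H; exact: (measurableT_comp (@fine_measurable R setT measurableT) H).
Qed.

(** [laplace_continuation] with constant term 0; the density is the real part of an odd power of
    A. *)
Lemma simplex_continuation m : (0 < m)%N ->
  (\int[ltuple m.*2.+1]_(t in box hl m.*2.+1) (gauss (tsum t) * expR (tsqr t / 2))%:E =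
  ((-1) ^+ m * ((Num.sqrt (pi / 2))^-1 *
     \int[leb]_(x in hl) (complex.Re (gpair x ^+ m.*2.+1) * egauss x)))%:E)%E.
Proof.
move=> m0; have mhl : measurable (hl : set T) by exact: measurable_itv.
pose rho x := (Num.sqrt (pi / 2))^-1 * complex.Re (gpair x ^+ m.*2.+1) : R.
pose V x := x ^+ 2 / 2 : R.
have iS := integrable_simplex_density R m0.
have -> : (Num.sqrt (pi / 2))^-1 * \int[leb]_(x in hl) (complex.Re (gpair x ^+ m.*2.+1) * egauss x)
   = 0 + \int[leb]_(x in hl) (rho x * expR (V x)).
  rewrite add0r -(RintegralZl _ mhl iS); apply: eq_Rintegral => x _.
  by rewrite /rho mulrA.
have gK (s : R) : 0 <= s -> gauss s <= 1 * gauss s by rewrite mul1r.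
apply: laplace_continuation => //.
- exact: measurable_box.
- apply: measurable_funTS; apply: measurable_weight; exact: measurable_gauss.
- by apply/measurable_funTS/measurable_funM => //; exact: measurable_tsqr.
- apply/measurable_funTS/measurable_funM => //.
  by have [] := @measurable_gpairX R m.*2.+1.
- by apply/measurable_funTS/measurable_funM.
- by move=> t _; exact: gauss_ge0.
- by move=> t _; rewrite divr_ge0 ?tsqr_ge0.
- by move=> x _; rewrite divr_ge0 ?sqr_ge0.
- by move=> N; exact: (integrable_weight_moment _ (@measurable_gauss R) (fun s _ => gauss_ge0 s) gK).
- rewrite (_ : (fun x => _) = (fun x => (Num.sqrt (pi / 2))^-1 *
    (complex.Re (gpair x ^+ m.*2.+1) * egauss x))); first exact: integrableZlR.
  by apply/funext => x; rewrite /rho mulrA.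
move=> k k0 _; have s0 : 0 < Num.sqrt k by rewrite sqrtr_gt0.
have p0 := sqrt_pi2_gt0 R.
rewrite (Rintegral_weight_scale _ (@measurable_gauss R) (fun s _ => gauss_ge0 s) k0).
rewrite simplex_orthant_transform// add0r.
have -> : \int[leb]_(t in hl) (rho t * expR (- (k * V t))) = (Num.sqrt (pi / 2))^-1 *
   \int[leb]_(x in hl) (gauss (Num.sqrt k * x) * complex.Re ((cosg x +i* sing x) ^+ m.*2.+1)).
  have iR : leb.-integrable hl (EFin \o (fun x => gauss (Num.sqrt k * x) *
      complex.Re ((cosg x +i* sing x) ^+ m.*2.+1))).
    have [mR _] := @measurable_gpairX R m.*2.+1.
    apply: (integrable_le_norm mhl _ _ (integrable_norm iS)).
      apply/measurable_funTS/measurable_funM => //.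
      by apply: (measurableT_comp (@measurable_gauss R)); exact: mulrl_measurable.
    by move=> x _; exact: norm_gauss_le_egauss.
  rewrite -(RintegralZl _ mhl iR); apply: eq_Rintegral => x _.
  by rewrite gauss_sqrtM ?(ltW k0)// /rho /V; ring.
rewrite !mulrA; congr (_ * _).
(* The factor sqrt k of the Fourier inversion cancels the odd one among the 2m + 1 factors 1/sqrt k,
   and k^m cancels the others. *)
rewrite exprS -muln2 mulnC exprM sqr_sqrtr ?(ltW k0)//; field.
by rewrite expf_neq0 ?gt_eqF.
Qed.

(** The constant of [crosspolytope_orthant_transform] plays the part of [c0]. The density has no
    definite sign, which the dominated side of [laplace_continuation] permits. *)
Lemma crosspolytope_continuation m : (0 < m)%N ->
  (\int[ltuple m.*2]_(t in box hl m.*2) (gtail (tsum t) * expR (tsqr t / 2))%:E =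
  ((-1) ^+ m * (Num.sqrt (pi / 2) ^+ m.*2.+1 - (Num.sqrt (pi / 2))^-1 *
     \int[leb]_(x in hl) (x^-1 * complex.Im (gpair x ^+ m.*2) * egauss x)))%:E)%E.
Proof.
move=> m0; have mhl : measurable (hl : set T) by exact: measurable_itv.
pose rho x := - (Num.sqrt (pi / 2))^-1 * (x^-1 * complex.Im (gpair x ^+ m.*2)) : R.
pose V x := x ^+ 2 / 2 : R.
have iS := integrable_crosspolytope_density R m0.
have [_ mI] := @measurable_gpairX R m.*2.
have mrho : measurable_fun setT (fun x => x^-1 * complex.Im (gpair x ^+ m.*2)).
  by apply: measurable_funM => //; exact: measurable_invr.
rewrite -mulNr.
have -> : - (Num.sqrt (pi / 2))^-1 * \int[leb]_(x in hl) (x^-1 * complex.Im (gpair x ^+ m.*2) * egauss x)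
   = \int[leb]_(x in hl) (rho x * expR (V x)).
  rewrite -(RintegralZl _ mhl iS); apply: eq_Rintegral => x _.
  by rewrite /rho !mulrA.
apply: laplace_continuation => //.
- exact: measurable_box.
- apply: measurable_funTS; apply: measurable_weight; exact: measurable_gtail.
- by apply/measurable_funTS/measurable_funM => //; exact: measurable_tsqr.
- by apply/measurable_funTS/measurable_funM.
- by apply/measurable_funTS/measurable_funM.
- by move=> t _; exact: gtail_ge0.
- by move=> t _; rewrite divr_ge0 ?tsqr_ge0.
- by move=> x _; rewrite divr_ge0 ?sqr_ge0.
- by move=> N; exact: (integrable_weight_moment _ measurable_gtail (fun s _ => gtail_ge0 s) (@gtail_le R)).
- rewrite (_ : (fun x => _) = (fun x => - (Num.sqrt (pi / 2))^-1 *
    (x^-1 * complex.Im (gpair x ^+ m.*2) * egauss x))); first exact: integrableZlR.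
  by apply/funext => x; rewrite /rho !mulrA.
move=> k k0 _; have s0 : 0 < Num.sqrt k by rewrite sqrtr_gt0.
have p0 := sqrt_pi2_gt0 R.
rewrite (Rintegral_weight_scale _ measurable_gtail (fun s _ => gtail_ge0 s) k0).
rewrite crosspolytope_orthant_transform//.
have iR : leb.-integrable hl (EFin \o (fun x => gauss (Num.sqrt k * x) *
    (x^-1 * complex.Im ((cosg x +i* sing x) ^+ m.*2)))).
  apply: (integrable_le_norm mhl _ _ (integrable_norm iS)).
    apply/measurable_funTS/measurable_funM => //.
    by apply: (measurableT_comp (@measurable_gauss R)); exact: mulrl_measurable.
  by move=> x _; exact: norm_gauss_le_egauss.
have -> : \int[leb]_(t in hl) (rho t * expR (- (k * V t))) = - (Num.sqrt (pi / 2))^-1 *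
   \int[leb]_(x in hl) (gauss (Num.sqrt k * x) * (x^-1 * complex.Im ((cosg x +i* sing x) ^+ m.*2))).
  rewrite -(RintegralZl _ mhl iR); apply: eq_Rintegral => x _.
  by rewrite gauss_sqrtM ?(ltW k0)// /rho /V; ring.
rewrite mulNr mulrA -[m.*2]mul2n exprM sqr_sqrtr ?(ltW k0)// mulfV ?mul1r//.
by rewrite expf_neq0 ?gt_eqF.
Qed.
End orthant_continuation.

(** * The ideal polytopes *)

Section convex_combinations.
Context (R : realType) (V : lmodType R).
Implicit Types (B : set V) (x y : V) (l : R).

Lemma convex_setP B : convex_set B <->
  forall x y l, 0 <= l -> l <= 1 -> B x -> B y -> B (l *: x + (1 - l) *: y).
Proof.
split => [cB x y l l0 l1 Bx By|cB x y l].
  have /(_ (Itv01 l0 l1)) := cB x y _ (mem_set Bx) (mem_set By).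
  by rewrite inE /conv/=.
rewrite !inE => Bx By; rewrite /conv/=.
by apply: cB.
Qed.

(** Split off the first weight and renormalize the others; this fails only if the first weight is 1,
    and then the others vanish. *)
Lemma convex_sum B n (p : 'I_n.+1 -> V) (a : 'I_n.+1 -> R) : convex_set B ->
  (forall i, 0 <= a i) -> \sum_i a i = 1 -> (forall i, B (p i)) -> B (\sum_i a i *: p i).
Proof.
move=> /convex_setP cB; elim: n p a => [|n IH] p a a0 a1 Bp.
  by move: a1; rewrite !big_ord1 => ->; rewrite scale1r.
have E : a ord0 + \sum_(i < n.+1) a (lift ord0 i) = 1 by rewrite -big_ord_recl.
rewrite big_ord_recl.
have [a01|a01] := eqVneq (a ord0) 1.
  rewrite big1 ?addr0 ?a01 ?scale1r// => i _.
  have /eqP : \sum_(i < n.+1) a (lift ord0 i) = 0 by move: E; rewrite a01 => /(canRL (addKr _)); rewrite addNr.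
  by rewrite psumr_eq0// => /allP/(_ i (mem_index_enum _))/eqP ->; rewrite scale0r.
have S0 : 0 <= \sum_(i < n.+1) a (lift ord0 i) by exact: sumr_ge0.
have aE : 1 - a ord0 = \sum_(i < n.+1) a (lift ord0 i) by rewrite -E addrC addKr.
have b0 : 1 - a ord0 != 0 by rewrite subr_eq0 eq_sym.
have -> : \sum_(i < n.+1) a (lift ord0 i) *: p (lift ord0 i) =
    (1 - a ord0) *: \sum_(i < n.+1) (a (lift ord0 i) / (1 - a ord0)) *: p (lift ord0 i).
  rewrite scaler_sumr; apply: eq_bigr => i _.
  by rewrite scalerA mulrCA mulfV ?mulr1.
apply: cB => //; first by rewrite -E lerDl.
apply: IH => //.
- by move=> i; rewrite divr_ge0// aE.
- by rewrite -mulr_suml -aE mulfV.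
Qed.

End convex_combinations.

(** * The crosspolytope as a unit ball of the sum norm *)

Section crosspolytope_set.
Context (R : realType) (n : nat).
Implicit Types x : 'rV[R]_n.+1.

Lemma crosspolytopeE :
  @ideal_crosspolytope R n.+1 = [set x | \sum_k `|x 0 k| <= 1].
Proof.
apply/seteqP; split.
  apply: smallest_sub => [|x [i [|]] ->] /=.
  - apply/convex_setP => x y l l0 l1 /= x1 y1.
    apply: (@le_trans _ _ (\sum_k (l * `|x 0 k| + (1 - l) * `|y 0 k|))).
      apply: ler_sum => k _; rewrite !mxE (le_trans (ler_normD _ _))//.
      by rewrite !normrM (ger0_norm l0) (@ger0_norm _ (1 - l)) ?subr_ge0.
    rewrite big_split/= -!mulr_sumr.
    have l1' : 0 <= 1 - l by rewrite subr_ge0.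
    have := ler_wpM2l l0 x1; have := ler_wpM2l l1' y1; rewrite !mulr1; lra.
  - rewrite (bigD1 i)//= big1 ?addr0 => [|j ji]; first by rewrite mxE !eqxx normr1.
    by rewrite mxE (negbTE ji) andbF normr0.
  - rewrite (bigD1 i)//= big1 ?addr0 => [|j ji]; first by rewrite !mxE !eqxx normrN1.
    by rewrite !mxE (negbTE ji) andbF oppr0 normr0.
move=> x x1 B [cB BV].
have BP i : B (delta_mx 0 i) by apply: BV; exists i; left.
have BN i : B (- delta_mx 0 i) by apply: BV; exists i; right.
(* The origin is the midpoint of two opposite vertices; it takes up the slack between the sum norm
   and 1. *)
have B0 : B 0.
  have /convex_setP/(_ (delta_mx 0 ord0) (- delta_mx 0 ord0) 2^-1) := cB.
  rewrite (_ : 1 - 2^-1 = 2^-1 :> R); last by field.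
  by rewrite scalerN subrr; apply; rewrite ?invr_ge0 ?invf_le1 ?ler1n.
(* Index 0 stands for the origin; index k + 1 stands for plus or minus the k-th basis vector,
   according to the sign of the coordinate. *)
pose p (i : 'I_n.+2) : 'rV[R]_n.+1 := if unlift ord0 i is Some k then
  (if 0 <= x 0 k then delta_mx 0 k else - delta_mx 0 k) else 0.
pose a (i : 'I_n.+2) : R := if unlift ord0 i is Some k then `|x 0 k| else 1 - \sum_k `|x 0 k|.
have -> : x = \sum_i a i *: p i.
  rewrite big_ord_recl [p ord0]/p unlift_none scaler0 add0r [LHS]row_sum_delta.
  apply: eq_bigr => k _; rewrite /a /p liftK; case: ifPn => [x0|]; first by rewrite ger0_norm.
  by rewrite -ltNge => x0; rewrite ltr0_norm// scalerN scaleNr opprK.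
apply: convex_sum => //.
- by move=> i; rewrite /a; case: unlift => // ; rewrite subr_ge0.
- rewrite big_ord_recl /a unlift_none; under [X in _ + X]eq_bigr do rewrite liftK.
  by rewrite subrK.
- by move=> i; rewrite /p; case: unlift => // k; case: ifP.
Qed.

End crosspolytope_set.

(** * The simplex in affine coordinates *)

Section simplex_set.
Context (R : realType) (d : nat) (v : 'I_d.+1 -> 'rV[R]_d).

Definition edge_mx : 'M[R]_d := \matrix_(i, j) (v (lift ord0 i) - v ord0) 0 j.

Lemma affine_simplexE (t : 'rV[R]_d) : t *m edge_mx + v ord0 =
  (1 - \sum_k t 0 k) *: v ord0 + \sum_k t 0 k *: v (lift ord0 k).
Proof.
have -> : t *m edge_mx = \sum_k t 0 k *: (v (lift ord0 k) - v ord0).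
  by apply/rowP => j; rewrite mxE summxE; apply: eq_bigr => k _; rewrite !mxE.
under eq_bigr do rewrite scalerBr.
rewrite sumrB -scaler_suml scalerBl scale1r; apply/rowP => j; rewrite !mxE; ring.
Qed.

(** The rows of [edge_mx] are the edges at vertex 0, so [t] holds the barycentric coordinates of the
    other vertices and 1 - sum t that of vertex 0. *)
Lemma convex_hull_simplexE : edge_mx \in unitmx ->
  convex_hull (range v) = [set x | let t := (x - v ord0) *m invmx edge_mx in
     (forall k, 0 <= t 0 k) /\ \sum_k t 0 k <= 1].
Proof.
move=> uE; apply/seteqP; split.
  apply: smallest_sub => [|x [i _ <-]] /=.
    apply/convex_setP => x y l l0 l1 /= [x0 x1] [y0 y1].
    have l1' : 0 <= 1 - l by rewrite subr_ge0.
    have -> : (l *: x + (1 - l) *: y - v ord0) *m invmx edge_mx =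
      l *: ((x - v ord0) *m invmx edge_mx) + (1 - l) *: ((y - v ord0) *m invmx edge_mx).
      rewrite !scalemxAl -mulmxDl; congr (_ *m _).
      by apply/rowP => j; rewrite !mxE; ring.
    move: x0 x1 y0 y1; set s := _ *m _; set t := _ *m _ => x0 x1 y0 y1; clearbody s t.
    split => [k|]; first by rewrite !mxE addr_ge0// mulr_ge0.
    under eq_bigr do rewrite !mxE.
    rewrite big_split/= -!mulr_sumr.
    have := ler_wpM2l l0 x1; have := ler_wpM2l l1' y1; rewrite !mulr1; lra.
  case: (unliftP ord0 i) => [j ->|->]; last first.
    by rewrite subrr mul0mx; split => [k|]; rewrite ?big1 ?mxE// => k; rewrite mxE.
  have -> : (v (lift ord0 j) - v ord0) *m invmx edge_mx = delta_mx 0 j.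
    have -> : v (lift ord0 j) - v ord0 = delta_mx 0 j *m edge_mx.
      by rewrite -rowE; apply/rowP => k; rewrite !mxE.
    by rewrite mulmxK.
  split => [k|]; first by rewrite mxE ler0n.
  by rewrite (bigD1 j)//= big1 ?addr0 ?mxE ?eqxx// => k kj; rewrite mxE (negbTE kj) andbF.
move=> x; set t := (x - v ord0) *m invmx edge_mx => -[/= t0 t1] B [cB BV].
have -> : x = t *m edge_mx + v ord0 by rewrite /t mulmxKV// subrK.
rewrite affine_simplexE.
pose a (i : 'I_d.+1) : R := if unlift ord0 i is Some k then t 0 k else 1 - \sum_k t 0 k.
have -> : (1 - \sum_k t 0 k) *: v ord0 + \sum_k t 0 k *: v (lift ord0 k) = \sum_i a i *: v i.
  rewrite big_ord_recl /a unlift_none; congr (_ + _).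
  by apply: eq_bigr => k _; rewrite liftK.
apply: convex_sum => //.
- by move=> i; rewrite /a; case: unlift => // ; rewrite subr_ge0.
- rewrite big_ord_recl /a unlift_none; under [X in _ + X]eq_bigr do rewrite liftK.
  by rewrite subrK.
- by move=> i; apply: BV; exists i.
Qed.

End simplex_set.

(** * Gram matrix and determinant of the regular simplex *)

Section regular_simplex_gram.
Context (R : realType).

(** One block matrix is factored in two ways, by eliminating either of its diagonal identity blocks;
    the determinants must agree. *)
Lemma det_1D_rank1 n (u : 'cV[R]_n) (w : 'rV[R]_n) : \det (1%:M + u *m w) = 1 + (w *m u) 0 0.
Proof.
have E1 : block_mx 1%:M w (- u) 1%:M =
    block_mx 1%:M 0 (- u) 1%:M *m block_mx 1%:M w 0 (1%:M + u *m w) :> 'M[R]_(1 + n).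
  rewrite mulmx_block !mul1mx !mul0mx ?mulmx0 !addr0 mulmx1 mulNmx.
  by rewrite (addrC 1%:M) addKr.
have E2 : block_mx 1%:M w (- u) 1%:M =
    block_mx 1%:M w 0 1%:M *m block_mx (1%:M + w *m u) 0 (- u) 1%:M :> 'M[R]_(1 + n).
  rewrite mulmx_block !mul1mx !mul0mx ?mulmx0 ?add0r ?mulmx1 mulmxN.
  by rewrite addrK.
have := congr1 determinant (etrans (esym E1) E2).
rewrite !det_mulmx !det_ublock !det_lblock !det1 !mulr1 !mul1r => ->.
by rewrite det_mx11 !mxE eqxx.
Qed.

End regular_simplex_gram.

Section regular_simplex.
Context (R : realType) (d : nat) (v : 'I_d.+1 -> 'rV[R]_d).
Hypotheses (d0 : (0 < d)%N) (vS : ideal_regular_simplex_vertices v).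

Let dot (x y : 'rV[R]_d) : R := (x *m y^T) 0 0.

Let dotE x y : dot x y = \sum_k x 0 k * y 0 k.
Proof. by rewrite /dot mxE; apply: eq_bigr => k _; rewrite mxE. Qed.

Let dotC x y : dot x y = dot y x.
Proof. by rewrite !dotE; apply: eq_bigr => k _; rewrite mulrC. Qed.

Let dotBl x y z : dot (x - y) z = dot x z - dot y z.
Proof. by rewrite !dotE -sumrB; apply: eq_bigr => k _; rewrite !mxE mulrBl. Qed.

Let dotBr x y z : dot z (x - y) = dot z x - dot z y.
Proof. by rewrite dotC dotBl !(dotC z). Qed.

Let sqr_enorm (x : 'rV[R]_d) : enorm x ^+ 2 = dot x x.
Proof.
rewrite /enorm sqr_sqrtr ?dotE; first by apply: eq_bigr => k _; rewrite expr2.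
by apply: sumr_ge0 => k _; exact: sqr_ge0.
Qed.

Let dot_self i : dot (v i) (v i) = 1.
Proof. by have [+ _ _] := vS; rewrite -sqr_enorm => ->; rewrite expr1n. Qed.

(** Equal distances force a common inner product c; pairing a vertex with the vanishing sum of all
    vertices gives 1 + d c = 0. *)
Let dot_distinct i j : i != j -> dot (v i) (v j) = - d%:R^-1.
Proof.
have [_ v0 [l l0 vl]] := vS.
have E i' j' : i' != j' -> dot (v i') (v j') = 1 - l ^+ 2 / 2.
  move=> /vl/(congr1 (fun x => x ^+ 2)); rewrite sqr_enorm dotBl !dotBr !dot_self (dotC (v j')) => <-.
  by field.
move=> ij; rewrite E//.
have : dot (v i) (\sum_j v j) = 0 by rewrite v0 /dot linear0 mulmx0 mxE.
rewrite /dot linear_sum mulmx_sumr summxE (bigD1 i)//= -/(dot _ _) dot_self.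
rewrite (eq_bigr (fun=> 1 - l ^+ 2 / 2)); last first.
  by move=> k ki; rewrite -/(dot _ _) E// eq_sym.
rewrite sumr_const cardC1 card_ord -[X in _ + X]mulr_natl /= => H.
have dn0 : d%:R != 0 :> R by rewrite pnatr_eq0 -lt0n.
apply: (mulfI dn0); rewrite mulrN mulfV//.
by apply/eqP; rewrite -addr_eq0 addrC H.
Qed.

Let K : R := 1 + d%:R^-1.

Let K0 : 0 < K. Proof. by rewrite ltr_wpDr// invr_ge0 ler0n. Qed.

Lemma gram_edge_mx : edge_mx v *m (edge_mx v)^T = K *: (1%:M + const_mx 1 *m (const_mx 1 : 'rV_d)).
Proof.
apply/matrixP => i j.
have -> : (edge_mx v *m (edge_mx v)^T) i j = dot (v (lift ord0 i) - v ord0) (v (lift ord0 j) - v ord0).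
  by rewrite dotE mxE; apply: eq_bigr => k _; rewrite !mxE.
have n0 (k : 'I_d) : lift ord0 k != ord0 by rewrite eq_sym neq_lift.
rewrite !dotBl !dotBr dot_self (dot_distinct (n0 i)).
rewrite (dotC (v ord0)) (dot_distinct (n0 j)).
rewrite !mxE big_ord1 !mxE mulr1.
have [->|ij] := eqVneq i j; first by rewrite dot_self mulr1n /K; ring.
by rewrite dot_distinct /K ?mulr0n; [ring|rewrite (inj_eq lift_inj)].
Qed.

Lemma sqr_det_edge_mx : \det (edge_mx v) ^+ 2 = K ^+ d * d.+1%:R.
Proof.
rewrite expr2 -[X in _ * X]det_tr -det_mulmx gram_edge_mx detZ det_1D_rank1 mxE.
congr (_ * _); under eq_bigr do rewrite !mxE mulr1.
by rewrite sumr_const card_ord -[d.+1]add1n natrD.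
Qed.

Lemma edge_mx_unit : edge_mx v \in unitmx.
Proof.
rewrite unitmxE unitfE; apply/eqP => E; have := sqr_det_edge_mx.
by rewrite E expr0n/= => /esym/eqP; rewrite mulf_eq0 expf_eq0 (gt_eqF K0) andbF pnatr_eq0.
Qed.

(** The quadratic part comes from the Gram matrix K (I + J), with J the all-ones matrix; each edge
    has inner product -K with vertex 0, which gives the linear part. *)
Lemma sqr_enorm_simplex (t : 'rV[R]_d) (s := \sum_k t 0 k) (q := \sum_k t 0 k ^+ 2) :
  enorm (t *m edge_mx v + v ord0) ^+ 2 = 1 - K * (2 * s - q - s ^+ 2).
Proof.
have n0 (k : 'I_d) : lift ord0 k != ord0 by rewrite eq_sym neq_lift.
rewrite sqr_enorm.
have -> : dot (t *m edge_mx v + v ord0) (t *m edge_mx v + v ord0) =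
    dot (t *m edge_mx v) (t *m edge_mx v) + 2 * dot (t *m edge_mx v) (v ord0) + dot (v ord0) (v ord0).
  rewrite !dotE mulr_sumr -!big_split/=; apply: eq_bigr => k _; rewrite !mxE; ring.
rewrite dot_self.
have -> : dot (t *m edge_mx v) (v ord0) = - K * s.
  rewrite /dot -mulmxA mxE mulr_sumr; apply: eq_bigr => k _.
  have -> : (edge_mx v *m (v ord0)^T) k 0 = dot (v (lift ord0 k) - v ord0) (v ord0).
    by rewrite dotE mxE; apply: eq_bigr => j _; rewrite !mxE.
  by rewrite dotBl dot_self dot_distinct// /K; ring.
have -> : dot (t *m edge_mx v) (t *m edge_mx v) = K * (q + s ^+ 2).
  rewrite /dot trmx_mul -mulmxA (mulmxA (edge_mx v)) gram_edge_mx -scalemxAl -scalemxAr mxE.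
  congr (_ * _); rewrite mulmxDl mul1mx mulmxDr mxE; congr (_ + _).
    by rewrite mxE; apply: eq_bigr => k _; rewrite mxE expr2.
  rewrite mulmxA mulmxA -mulmxA mxE big_ord1.
  by rewrite expr2; congr (_ * _); rewrite mxE; apply: eq_bigr => k _; rewrite !mxE ?mulr1 ?mul1r.
by rewrite /K; ring.
Qed.

End regular_simplex.

(** * Volumes as Gaussian integrals over an orthant *)

Section polytope_volumes.
Context (R : realType).
Let T := measurableTypeR R.
Local Notation leb := (@lebesgue_measure R).
Local Notation ltuple := (lebesgue_tuple R).
Local Notation hl := (`[0%R, +oo[%classic : set R).

Let mhl : measurable (hl : set T). Proof. exact: measurable_itv. Qed.

Let measurable_polar_integral n (A : set (n.-tuple T)) : measurable A ->
  measurable_fun setT ((fun t => \int[leb]_(r in hl) `|polar_density (r, t)|%:E)%E \_ A).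
Proof.
move=> mA; apply/(measurable_restrictT _ _).1 => //; apply: measurable_funTS.
pose F (p : T * n.-tuple T) : \bar R := `|polar_density p|%:E.
have mF : measurable_fun setT F.
  by apply/measurable_EFinP/measurableT_comp => //; exact: measurable_polar_density.
have F0 p : (0 <= F p)%E by rewrite lee_fin.
exact: (@measurable_fun_section_integral _ _ _ _ R leb hl setT F mhl measurableT mF F0).
Qed.

Let polar_integral_abs n (t : n.-tuple T) : (\int[leb]_(r in hl) (polar_density (r, t))%:E =
  \int[leb]_(r in hl) `|polar_density (r, t)|%:E)%E.
Proof.
apply: eq_integral => r; rewrite inE/= in_itv/= andbT => r0.
by rewrite ger0_norm ?polar_density_ge0.
Qed.

(** The power of 2 counts the orthants. In the cone coordinates r = s + t_1 + ... + t_d, the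
    integral of exp(-r^2/2) over s is the Gaussian tail. *)
Lemma hyp_vol_crosspolytope n (d := n.+1) : (hyp_vol (@ideal_crosspolytope R d) =
  (2 ^+ d / gmoment R d)%:E *
  \int[ltuple d]_(t in box hl d) (gtail (tsum t) * expR (tsqr t / 2))%:E)%E.
Proof.
have C0 := gmoment_gt0 R d.
set S := @row_of_tuple R d @^-1` @ideal_crosspolytope R d.
have SE : S = [set t : d.-tuple T | tsum (tuple_abs t) <= 1].
  apply/funext => t; rewrite /S /preimage/= crosspolytopeE/=; congr (_ <= 1 : Prop).
  by rewrite /tsum; apply: eq_bigr => k _; rewrite tnth_mktuple mxE.
have mS : measurable S.
  rewrite SE (_ : [set _ | _] = (fun t : d.-tuple T => tsum (tuple_abs t)) @^-1` [set` `]-oo, 1]]); last first.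
    by apply/seteqP; split => t /=; rewrite in_itv.
  rewrite -[X in measurable X]setTI.
  have mh : measurable_fun setT (fun t : d.-tuple T => tsum (tuple_abs t)).
    rewrite /tsum; apply: measurable_sum => k; under eq_fun do rewrite tnth_mktuple.
    by apply: measurableT_comp => //; exact: measurable_tnth.
  by apply: mh => //; exact: measurable_itv.
rewrite (hyp_vol_polar mS); last first.
  move=> x; rewrite crosspolytopeE/= => x1; rewrite -[leRHS]sqrtr1 ler_sqrt//.
  have s0 : 0 <= \sum_k `|x 0 k| by exact: sumr_ge0.
  apply: (@le_trans _ _ ((\sum_k `|x 0 k|) ^+ 2)); last by rewrite expr_le1.
  rewrite expr2 mulr_suml; apply: ler_sum => k _.
  rewrite -(real_normK (num_real (x 0 k))) expr2 ler_wpM2l// (bigD1 k)//= lerDl.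
  exact: sumr_ge0.
under eq_integral do rewrite polar_integral_abs.
rewrite -/S integral_mkcond (ge0_integral_orthant (measurable_polar_integral mS)); last 2 first.
- by move=> t; rewrite patchE; case: ifP => // _; apply: integral_ge0 => r _; rewrite lee_fin.
- move=> t; have absK : tuple_abs (tuple_abs t) = tuple_abs t.
    by apply: eq_from_tnth => k; rewrite !tnth_mktuple normr_id.
  have SaE : (tuple_abs t \in S) = (t \in S).
    by apply/idP/idP; rewrite !inE SE/= absK.
  have qE : tsqr (tuple_abs t) = tsqr t.
    by apply: eq_bigr => k _; rewrite tnth_mktuple real_normK ?num_real.
  have pE r : polar_density (r, tuple_abs t) = polar_density (r, t).
    by rewrite /polar_density /= qE.
  by rewrite !patchE SaE; under eq_integral do rewrite pE.
rewrite -integral_mkcondr.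
have -> : box hl d `&` S = [set t : d.-tuple T | box hl d t /\ tsum t <= 1].
  have E (t : d.-tuple T) : box hl d t -> tsum (tuple_abs t) = tsum t.
    move=> bt; apply: eq_bigr => k _; rewrite tnth_mktuple ger0_norm//.
    by have := bt k; rewrite /= in_itv/= andbT.
  by rewrite SE; apply/seteqP; split => t /= [bt st]; split => //; rewrite E in st *.
pose G (p : T * d.-tuple T) : R := (gmoment R d)^-1 * expR (- (p.1 ^+ 2 - tsqr p.2) / 2).
have mG : measurable_fun setT G.
  apply: measurable_funM => //; apply: measurableT_comp => //.
  apply: measurable_funM => //; apply: measurableT_comp => //; apply: measurable_funB.
    by apply: measurable_funX; exact: measurable_fst.
  by apply: (measurableT_comp (@measurable_tsqr R d)); exact: measurable_snd.
have G0 p : 0 <= G p by rewrite mulr_ge0 ?expR_ge0 ?invr_ge0 ?ltW.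
rewrite EFinM -muleA; congr (_ * _)%E.
transitivity (\int[ltuple d]_(t in [set t | box hl d t /\ (tsum t <= 1)%R])
     \int[leb]_(r in hl) (r ^+ d * G (r, tuple_of_row (r *: row_of_tuple t))%R)%:E)%E.
  apply: eq_integral => t _; rewrite -polar_integral_abs; apply: eq_integral => r _.
  congr EFin; rewrite /polar_density /G/= mulrCA; congr (_ * (_ * expR _)).
  rewrite (_ : tsqr (tuple_of_row _) = r ^+ 2 * tsqr t); first by ring.
  by rewrite /tsqr mulr_sumr; apply: eq_bigr => k _; rewrite tnth_mktuple !mxE exprMn.
rewrite ge0_integral_cone//.
transitivity (\int[ltuple d]_(t in box hl d) ((gmoment R d)^-1%:E *
    (gtail (tsum t) * expR (tsqr t / 2))%:E))%E.
  apply: eq_integral => t; rewrite inE => bt; have /andP[s0 _] := tsum_le_prod bt.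
  have ig := integrable_gauss_shift s0.
  transitivity (\int[leb]_(s in hl) (((gmoment R d)^-1 * expR (tsqr t / 2))%:E * (gauss (s + tsum t)%R)%:E))%E.
    apply: eq_integral => s _; rewrite -EFinM; congr EFin; rewrite /G/= -mulrA; congr (_ * _).
    by rewrite /gauss -expRD; congr expR; field.
  rewrite integralZl// -(fineK (integrable_fin_num mhl ig)) -!EFinM.
  by congr EFin; rewrite /gtail /Rintegral; ring.
rewrite ge0_integralZl//.
- exact: measurable_box.
- apply/measurable_EFinP/measurable_funTS/measurable_funM.
    by apply: (measurableT_comp (@measurable_gtail R)); exact: measurable_tsum.
  by apply: measurableT_comp => //; apply: measurable_funM => //; exact: measurable_tsqr.
- by move=> t _; rewrite lee_fin mulr_ge0 ?expR_ge0 ?gtail_ge0.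
- by rewrite lee_fin invr_ge0 ltW.
Qed.

(** In cone coordinates the slack s = r - (t_1 + ... + t_d) becomes one more orthant variable. The
    exponent is then symmetric in all d + 1 variables, as are the vertices. *)
Lemma hyp_vol_simplex n (d := n.+1) (v : 'I_d.+1 -> 'rV[R]_d) :
  ideal_regular_simplex_vertices v -> (hyp_vol (convex_hull (range v)) =
  (Num.sqrt d%:R / gmoment R d)%:E *
  \int[ltuple d.+1]_(t in box hl d.+1) (gauss (tsum t) * expR (tsqr t / 2))%:E)%E.
Proof.
move=> vS; have d0 : (0 < d)%N by [].
have C0 := gmoment_gt0 R d.
have uA := edge_mx_unit d0 vS; set A := edge_mx v in uA.
pose K : R := 1 + d%:R^-1; pose kappa := Num.sqrt K.
have K0 : 0 < K by rewrite ltr_wpDr// invr_ge0 ler0n.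
have k0 : 0 < kappa by rewrite sqrtr_gt0.
have k2 : kappa ^+ 2 = K by rewrite sqr_sqrtr// ltW.
pose y (t : d.-tuple T) : 'rV[R]_d := row_of_tuple t *m A + v ord0.
have yE (t : d.-tuple T) : enorm (y t) ^+ 2 = 1 - K * (2 * tsum t - tsqr t - tsum t ^+ 2).
  have s1 : \sum_k row_of_tuple t 0 k = tsum t by apply: eq_bigr => k _; rewrite mxE.
  have s2 : \sum_k row_of_tuple t 0 k ^+ 2 = tsqr t by apply: eq_bigr => k _; rewrite mxE.
  by rewrite /y sqr_enorm_simplex// s1 s2.
pose D := [set t : d.-tuple T | box hl d t /\ tsum t <= 1].
have mD : measurable D.
  apply: measurableI; first exact: measurable_box.
  by rewrite -[X in measurable X]setTI; apply: (@measurable_tsum R d _ [set` `]-oo, 1]]).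
set B := convex_hull (range v); pose S := @row_of_tuple R d @^-1` B.
have tE (x : 'rV[R]_d) : tsum (tuple_of_row x) = \sum_k x 0 k.
  by apply: eq_bigr => k _; rewrite tnth_mktuple.
have BE : B = [set x | D (tuple_of_row ((x - v ord0) *m invmx A))].
  rewrite /B convex_hull_simplexE//; apply/seteqP; split => x /= [x0 x1]; split.
  - by move=> k; rewrite /= in_itv/= andbT tnth_mktuple.
  - by rewrite tE.
  - by move=> k; have := x0 k; rewrite /= in_itv/= andbT tnth_mktuple.
  - by rewrite tE in x1.
have yB t : B (y t) <-> D t.
  by rewrite BE/= /y addrK mulmxK// row_of_tupleK.
have mS : measurable S.
  rewrite (_ : S = (fun t : d.-tuple T => tuple_of_row ((row_of_tuple t - v ord0) *m invmx A)) @^-1` D).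
    rewrite -[X in measurable X]setTI; move: D mD {BE yB} => D' mD'.
    have mh : measurable_fun setT (fun t : d.-tuple T => tuple_of_row ((row_of_tuple t - v ord0) *m invmx A)).
      have := measurableT_comp (@measurable_row_mulmx R d d (invmx A)) (@measurable_row_translate R d (- v ord0)).
      set f1 := _ \o _; rewrite (_ : f1 = (fun t => tuple_of_row ((row_of_tuple t - v ord0) *m invmx A)))//.
      by apply/funext => t; rewrite /f1 /= tuple_of_rowK.
    exact: mh.
  by rewrite /S BE.
have quad_ge0 (t : d.-tuple T) : D t -> 0 <= 2 * tsum t - tsqr t - tsum t ^+ 2.
  move=> [bt s1]; have /andP[s0 _] := tsum_le_prod bt.
  have qs : tsqr t <= tsum t ^+ 2.
    rewrite expr2 /tsqr {1}/tsum mulr_suml; apply: ler_sum => k _.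
    have t0 j : 0 <= tnth t j by have := bt j; rewrite /= in_itv/= andbT.
    by rewrite expr2 ler_wpM2l// /tsum (bigD1 k)//= lerDl sumr_ge0.
  by nra.
rewrite (hyp_vol_polar mS); last first.
  move=> x; have -> : x = y (tuple_of_row ((x - v ord0) *m invmx A)).
    by rewrite /y tuple_of_rowK mulmxKV// subrK.
  move=> /yB/quad_ge0 q0; rewrite -(@expr_le1 _ 2)// ?sqrtr_ge0//.
  by rewrite yE lerBlDr lerDl mulr_ge0// ltW.
under eq_integral do rewrite polar_integral_abs.
rewrite -/S integral_mkcond; set F := _ \_ S.
have mF : measurable_fun setT F by exact: measurable_polar_integral.
have F0 t : (0 <= F t)%E.
  by rewrite /F patchE; case: ifP => // _; apply: integral_ge0 => r _; rewrite lee_fin.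
rewrite -(ge0_integral_translate (v ord0) mF F0).
pose F1 (t : d.-tuple T) := F (tuple_of_row (row_of_tuple t + v ord0)).
have mF1 : measurable_fun setT F1 by apply: (measurableT_comp mF); exact: measurable_row_translate.
have F10 t : (0 <= F1 t)%E by exact: F0.
have det0 : 0 < `|\det A| by rewrite normr_gt0 -unitfE -unitmxE.
have detn0 : `|\det A| != 0 by rewrite gt_eqF.
have LL (f : d.-tuple T -> \bar R) : measurable_fun setT f -> (forall t, (0 <= f t)%E) ->
    (\int[ltuple d]_t f t = `|\det A|%:E * \int[ltuple d]_t f (tuple_of_row (row_of_tuple t *m A)))%E.
  by move=> mf f0; rewrite (ge0_integral_linear uA mf f0) muleA -EFinM (mulfV detn0) mul1e.
apply: (etrans (LL F1 mF1 F10)).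
(* Rescaling r by [kappa] removes K from the exponent; r^d and dr contribute d + 1 inverse
   factors. *)
pose c := (gmoment R d)^-1 * kappa ^- d.+1.
have c0 : 0 < c by rewrite mulr_gt0 ?invr_gt0 ?exprn_gt0.
pose G (p : T * d.-tuple T) : R := c * expR (- (2 * p.1 * tsum p.2 - tsqr p.2 - tsum p.2 ^+ 2) / 2).
have mG : measurable_fun setT G.
  have mts := measurableT_comp (@measurable_tsum R d) (@measurable_snd _ _ T (d.-tuple T)).
  apply: measurable_funM => //; apply: measurableT_comp => //.
  apply: measurable_funM => //; apply: measurableT_comp => //; apply: measurable_funB.
    apply: measurable_funB.
      by apply: measurable_funM => //; apply: measurable_funM => //; exact: measurable_fst.
    by apply: (measurableT_comp (@measurable_tsqr R d)); exact: measurable_snd.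
  exact: measurable_funX.
have G0 p : 0 <= G p by rewrite mulr_ge0 ?expR_ge0 ?ltW.
transitivity (`|\det A|%:E * \int[ltuple d]_(t in D)
     \int[leb]_(r in hl) (r ^+ d * G (r, tuple_of_row (r *: row_of_tuple t))%R)%:E)%E.
  congr (_ * _)%E; rewrite [RHS]integral_mkcond; apply: eq_integral => t _.
  rewrite /F1 /F tuple_of_rowK -/(y t) !patchE.
  have -> : (tuple_of_row (y t) \in S) = (t \in D).
    by apply/idP/idP; rewrite !inE /S /= tuple_of_rowK => /yB.
  case: ifPn => // tD.
  (* Absolute values make [h] nonnegative on the whole line, as the scaling lemma requires; they are
     invisible for r >= 0. *)
  pose h (r : R) : \bar R := (`|c * kappa| * (`|r| ^+ d * expR (- (2 * tsum t - tsqr t - tsum t ^+ 2) * r ^+ 2 / 2)))%:E.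
  have mh : measurable_fun setT h.
    apply/measurable_EFinP/measurable_funM => //; apply: measurable_funM.
      by apply: measurable_funX; exact: normr_measurable.
    apply: measurableT_comp => //; apply: measurable_funM => //.
    by apply: measurable_funM => //; exact: measurable_funX.
  have h0 r : (0 <= h r)%E by rewrite lee_fin !mulr_ge0 ?expR_ge0 ?exprn_ge0.
  have ck0 : 0 <= c * kappa by rewrite mulr_ge0 ?ltW.
  have hE r : 0 <= r -> h r = (c * kappa * (r ^+ d * expR (- (2 * tsum t - tsqr t - tsum t ^+ 2) * r ^+ 2 / 2)))%:E.
    by move=> r0; rewrite /h (ger0_norm ck0) (ger0_norm r0).
  have cE : c * kappa * kappa ^+ d = (gmoment R d)^-1.
    by rewrite /c exprS; field; rewrite expf_neq0 ?gt_eqF.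
  transitivity (\int[leb]_(r in hl) h (kappa * r)%R)%E.
    apply: eq_integral => r; rewrite inE/= in_itv/= andbT => r0.
    rewrite hE ?mulr_ge0 ?(ltW k0)// ger0_norm ?polar_density_ge0//; congr EFin.
    rewrite /polar_density /= -sqr_enorm_row_of_tuple tuple_of_rowK yE exprMn [in RHS]exprMn k2 -cE.
    rewrite mulrA -[c * kappa * kappa ^+ d * _]mulrA [RHS]mulrA; congr (_ * expR _); ring.
  rewrite (ge0_integral_scale_itv0y k0 mh h0) -ge0_integralZl//; last 2 first.
  - exact: measurable_funTS.
  - by rewrite lee_fin invr_ge0 ltW.
  apply: eq_integral => r; rewrite inE/= in_itv/= andbT => r0.
  rewrite hE// -EFinM; congr EFin; rewrite /G/=.
  have -> : tsum (tuple_of_row (r *: row_of_tuple t)) = r * tsum t.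
    by rewrite tE mulr_sumr; apply: eq_bigr => k _; rewrite !mxE.
  have -> : tsqr (tuple_of_row (r *: row_of_tuple t)) = r ^+ 2 * tsqr t.
    by rewrite /tsqr mulr_sumr; apply: eq_bigr => k _; rewrite tnth_mktuple !mxE exprMn.
  have swap (e : R) : kappa^-1 * (c * kappa * (r ^+ d * e)) = r ^+ d * (c * e).
    by clear -k0; field; rewrite gt_eqF.
  rewrite swap; congr (_ * (_ * expR _)); ring.
rewrite ge0_integral_cone//.
pose g (t : d.+1.-tuple T) : \bar R := (gauss (tsum t) * expR (tsqr t / 2))%:E.
have mg : measurable_fun setT g.
  apply/measurable_EFinP/measurable_funM.
    by apply: (measurableT_comp (@measurable_gauss R)); exact: measurable_tsum.
  by apply: measurableT_comp => //; apply: measurable_funM => //; exact: measurable_tsqr.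
have g0 t : (0 <= g t)%E by rewrite lee_fin mulr_ge0 ?expR_ge0.
have gE := ge0_integral_boxSr mhl mg g0.
transitivity ((Num.sqrt d%:R / gmoment R d)%:E *
    \int[ltuple d]_(t in box hl d) \int[leb]_(s in hl) g [tuple of s :: t])%E; last first.
  by congr (_ * _)%E; apply/esym; exact: gE.
transitivity (`|\det A|%:E * \int[ltuple d]_(t in box hl d) (c%:E * \int[leb]_(s in hl) g [tuple of s :: t]))%E.
  congr (_ * _)%E; apply: eq_integral => t _.
  rewrite -ge0_integralZl//; last 2 first.
  - by apply: measurable_funTS; apply: (measurableT_comp mg); exact: measurable_fun_consr.
  - by rewrite lee_fin ltW.
  apply: eq_integral => s _; rewrite /g -EFinM; congr EFin; rewrite /G/=; congr (_ * _).
  (* With S the sum and q the square sum of t, both exponents equal -(2 s S + S^2 - q)/2. *)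
  rewrite /gauss -expRD; congr expR; rewrite /tsum /tsqr (sum_tuple_cons id) (sum_tuple_cons (fun x => x ^+ 2)) -/(tsum t) -/(tsqr t) /=.
  by field.
rewrite ge0_integralZl//; last 4 first.
- exact: measurable_box.
- apply: measurable_funTS; pose Fg (p : T * d.-tuple T) := g [tuple of p.1 :: p.2].
  have mFg : measurable_fun setT Fg.
    by apply: (measurableT_comp mg); apply: measurable_cons; [exact: measurable_fst|exact: measurable_snd].
  have Fg0 p : (0 <= Fg p)%E by exact: g0.
  exact: (@measurable_fun_section_integral _ _ _ _ R leb hl setT Fg mhl measurableT mFg Fg0).
- by move=> t _; apply: integral_ge0.
- by rewrite lee_fin ltW.
rewrite muleA -EFinM; congr (_%:E * _)%E.
rewrite /c mulrCA [RHS]mulrC; congr (_ * _).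
have x0 : 0 <= `|\det A| * kappa ^- d.+1 by rewrite mulr_ge0// invr_ge0 exprn_ge0// ltW.
rewrite -(ger0_norm x0) -sqrtr_sqr; congr Num.sqrt.
rewrite exprMn real_normK ?num_real// sqr_det_edge_mx// -/K exprVn -exprM mulnC exprM k2 exprS.
have Kn0 : K ^+ d != 0 by rewrite expf_neq0 ?gt_eqF.
(* The squared determinant K^d (d + 1) divided by K^(d+1) leaves (d + 1)/K = d, the square of the
   claimed constant. *)
have KE : K * d%:R = d.+1%:R by rewrite /K mulrDl mul1r mulVf ?pnatr_eq0// -natr1 addrC.
rewrite -KE; move: (K ^+ d) Kn0 => Kd Kn0; field.
by rewrite Kn0 gt_eqF.
Qed.

End polytope_volumes.

(** * Passage to the complex form of the integrals *)

Section complex_integrals.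
Context (R : realType).
Local Notation leb := (@lebesgue_measure R).

Lemma Cintegral_scaler (D : set R) (f : R -> R) (z : R[i]) :
  measurable (D : set (measurableTypeR R)) -> leb.-integrable D (EFin \o f) ->
  Cintegrable D (fun y => (f y)%:C * z) /\
  Cintegral D (fun y => (f y)%:C * z) = (\int[leb]_(y in D) f y)%:C * z.
Proof.
move=> mD iF; case: z => a b.
have reE : (fun y => complex.Re ((f y)%:C * (a +i* b))) = (fun y => a * f y).
  by apply/funext => y; rewrite /= mul0r subr0 mulrC.
have imE : (fun y => complex.Im ((f y)%:C * (a +i* b))) = (fun y => b * f y).
  by apply/funext => y; rewrite /= mul0r addr0 mulrC.
rewrite /Cintegrable /Cintegral reE imE; split.
  rewrite (_ : (fun y => (complex.Re _)%:E) = EFin \o (fun y => a * f y)); last first.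
    by apply/funext => y; rewrite -reE.
  rewrite (_ : (fun y => (complex.Im _)%:E) = EFin \o (fun y => b * f y)); last first.
    by apply/funext => y; rewrite -imE.
  by split; exact: integrableZlR.
rewrite !(RintegralZl _ mD iF); apply/eqP; rewrite eq_complex /=.
by apply/andP; split; apply/eqP; ring.
Qed.

Lemma exp_i_even m : 'i%C ^+ m.*2 = ((-1) ^+ m)%:C :> R[i].
Proof. by rewrite -mul2n exprM complex.sqr_i rmorphXn rmorphN1. Qed.

End complex_integrals.

(** * The three volume formulas *)

Section polytopes.
Context (R : realType).
Let T := measurableTypeR R.
Local Notation leb := (@lebesgue_measure R).
Local Notation hl := (`[0%R, +oo[%classic : set R).
Local Notation s2p := (Num.sqrt (2 * pi) : R).

Let mhl : measurable (hl : set T). Proof. exact: measurable_itv. Qed.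

Let scaled d (f : R -> R) : (0 < d)%N -> measurable_fun setT f ->
  leb.-integrable hl (EFin \o f) ->
  leb.-integrable hl (EFin \o (fun y => f (y / Num.sqrt d%:R))) /\
  \int[leb]_(y in hl) f (y / Num.sqrt d%:R) = Num.sqrt d%:R * \int[leb]_(y in hl) f y.
Proof.
move=> d0 mf iF; have s0 : 0 < (Num.sqrt d%:R)^-1 :> R by rewrite invr_gt0 sqrtr_gt0 ltr0n.
have E : (fun y => f (y / Num.sqrt d%:R)) = (fun y => f ((Num.sqrt d%:R)^-1 * y)).
  by apply/funext => y; rewrite mulrC.
by rewrite E; split; [exact: integrable_scale_hl|rewrite Rintegral_scale_hl ?invrK].
Qed.

Let s0 : 0 < s2p. Proof. exact: sqrt_2pi_gt0. Qed.

Let omegaE d : (0 < d)%N -> omega R d.+1 = s2p ^+ d.+1 / gmoment R d.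
Proof. by move=> d0; rewrite -omega_gmoment// mulfK// gt_eqF// gmoment_gt0. Qed.

(** The cube integrand is a real function times i^d, which cancels the power of i in the prefactor
    for either parity of d. *)
Lemma ideal_cube_volume d : (2 <= d)%N -> 
  Cintegrable hl (@cube_integrand R d) /\
      exists2 V : R, hyp_vol (@ideal_cube R d) = V%:E &
        V%:C = (omega R d.+1)%:C / ('i%C ^+ d * s2p%:C) * Cintegral hl (cube_integrand d).
Proof.
move=> d2; have d0 : (0 < d)%N by exact: ltnW.
pose f y : R := (2 / s2p) ^+ d * sing (y / Num.sqrt d%:R) ^+ d.
have mS : measurable_fun setT (fun u : R => sing u ^+ d).
  by apply: measurable_funX; exact: measurable_sing.
have [iS _] := scaled d0 mS (integrable_singX R d2).
have iF : leb.-integrable hl (EFin \o f) by exact: integrableZlR.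
have cE : @cube_integrand R d = (fun y => (f y)%:C * 'i%C ^+ d).
  by apply/funext => y; rewrite cube_integrandE.
have [ci cI] := Cintegral_scaler ('i%C ^+ d) mhl iF.
rewrite cE; split => //; exists ((gmoment R d)^-1 * \int[leb]_(r in hl) (2 * sing (r / Num.sqrt d%:R)) ^+ d).
  exact: hyp_vol_cube.
have i0 : 'i%C ^+ d != 0 :> R[i].
  by rewrite expf_neq0// eq_complex /= oner_eq0 andbF.
rewrite cI.
transitivity ((omega R d.+1)%:C / s2p%:C * (\int[leb]_(y in hl) f y)%:C); last first.
  by move: (_%:C) (_%:C) => z w; rewrite mulrA [RHS]mulrAC; congr (_ * _); rewrite invfM mulrA mulrAC mulfVK.
rewrite -fmorphV -!rmorphM; congr (_%:C).
rewrite omegaE// (_ : \int[leb]_(y in hl) f y = s2p ^- d * \int[leb]_(r in hl) (2 * sing (r / Num.sqrt d%:R)) ^+ d).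
  by rewrite exprS; field; rewrite expf_neq0 ?gt_eqF// gmoment_gt0.
have i2 : leb.-integrable hl (EFin \o (fun r => (2 * sing (r / Num.sqrt d%:R)) ^+ d)).
  rewrite (_ : (fun r => _) = (fun r => 2 ^+ d * sing (r / Num.sqrt d%:R) ^+ d)); first exact: integrableZlR.
  by apply/funext => r; rewrite exprMn.
rewrite -(RintegralZl _ mhl i2); apply: eq_Rintegral => y _.
by rewrite /f !exprMn exprVn; ring.
Qed.

Lemma ideal_simplex_volume d (v : 'I_d.+1 -> 'rV[R]_d) : (2 <= d)%N -> ~~ odd d ->
  ideal_regular_simplex_vertices v ->
        Cintegrable setT (@simplex_integrand R d) /\
        exists2 V : R, hyp_vol (convex_hull (range v)) = V%:E &
          V%:C = (omega R d.+1)%:C / (2 * 'i%C ^+ d * s2p%:C)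
                 * Cintegral setT (simplex_integrand d).
Proof.
move=> d2 ev vS; have d0 : (0 < d)%N by exact: ltnW.
have [m dE] : exists m, d = m.*2 by exists d./2; rewrite even_halfK.
have m0 : (0 < m)%N by move: d0; rewrite dE double_gt0.
pose g u : R := complex.Re (gpair u ^+ d.+1) * egauss u.
have mg : measurable_fun setT g.
  apply: measurable_funM; last exact: measurable_egauss.
  by have [] := @measurable_gpairX R d.+1.
have ig : leb.-integrable hl (EFin \o g) by rewrite /g dE; exact: integrable_simplex_density.
have [is_ Is] := scaled d0 mg ig.
pose f y : R := 2 / s2p ^+ d.+1 * g (y / Num.sqrt d%:R).
have mf : measurable_fun setT f.
  by apply: measurable_funM => //; apply: (measurableT_comp mg); exact: measurable_funM.
have ge u : g (- u) = g u.
  rewrite /g gpairN -rmorphXn /egauss sqrrN; congr (_ * _).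
  by case: (gpair u ^+ d.+1).
have fe y : f (- y) = f y by rewrite /f mulNr ge.
have iF : leb.-integrable hl (EFin \o f) by exact: integrableZlR.
(* The integral over the line is twice the one over the half-line; this compensates the 2 in the
   denominator of the prefactor. *)
have [iT IT] := Rintegral_even iF mf fe.
have cE : @simplex_integrand R d = (fun y => (f y)%:C * 1).
  by apply/funext => y; rewrite simplex_integrandE// mulr1.
have [ci cI] := Cintegral_scaler 1 (measurableT : measurable (setT : set T)) iT.
rewrite cE; split => //.
exists (Num.sqrt d%:R / gmoment R d * ((-1) ^+ m * ((Num.sqrt (pi / 2))^-1 * \int[leb]_(x in hl) g x))).
  have : forall n (v : 'I_n.+1 -> 'rV[R]_n), (0 < n)%N -> ideal_regular_simplex_vertices v ->
      (hyp_vol (convex_hull (range v)) = (Num.sqrt n%:R / gmoment R n)%:E *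
      \int[lebesgue_tuple R n.+1]_(t in box hl n.+1) (gauss (tsum t) * expR (tsqr t / 2))%:E)%E.
    by move=> [|n]// w _; exact: hyp_vol_simplex.
  move=> /(_ d v d0 vS) ->; rewrite [RHS]EFinM; congr (_ * _)%E.
  by rewrite /g dE; exact: simplex_continuation.
rewrite cI mulr1 dE exp_i_even -dE.
have half : 2 = 2%:C :> R[i] by rewrite rmorph_nat.
rewrite half -!rmorphM -fmorphV -!rmorphM; congr (_%:C).
rewrite IT (RintegralZl _ mhl is_) Is -sqrt_2pi_half omegaE//.
have sg : ((-1) ^+ m) ^-1 = (-1) ^+ m :> R by rewrite invr_sign.
rewrite !invfM sg exprS; move: ((-1) ^+ m) => sgn; field.
by rewrite expf_neq0 ?gt_eqF// gmoment_gt0.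
Qed.

Lemma ideal_crosspolytope_volume d : (2 <= d)%N -> ~~ odd d ->
        leb.-integrable hl (fun y => (crosspolytope_integrand d y)%:E) /\
        exists2 V : R, hyp_vol (@ideal_crosspolytope R d) = V%:E &
          V%:C = (omega R d.+1)%:C / 'i%C ^+ d
                 * (2^-1 - 2 ^+ d / pi * \int[leb]_(y in hl) crosspolytope_integrand d y)%:C.
Proof.
move=> d2 ev; have d0 : (0 < d)%N by exact: ltnW.
have d10 : (0 < d.-1)%N by case: d d2 {ev d0} => [|[]].
have [m dE] : exists m, d = m.*2 by exists d./2; rewrite even_halfK.
have m0 : (0 < m)%N by move: d0; rewrite dE double_gt0.
pose h u : R := u^-1 * complex.Im (gpair u ^+ d) * egauss u.
have mh : measurable_fun setT h.
  apply: measurable_funM; last exact: measurable_egauss.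
  by apply: measurable_funM; [exact: measurable_invr|have [] := @measurable_gpairX R d].
have ih : leb.-integrable hl (EFin \o h) by rewrite /h dE; exact: integrable_crosspolytope_density.
have [is_ Is] := scaled d10 mh ih.
pose f y : R := (Num.sqrt d.-1%:R * s2p ^+ d)^-1 * h (y / Num.sqrt d.-1%:R).
have iF : leb.-integrable hl (EFin \o f) by exact: integrableZlR.
have cE y : y != 0 -> crosspolytope_integrand d y = f y.
  by move=> y0; rewrite crosspolytope_integrandE.
(* The value at 0 is a limit that is never computed: on the open half-line the integrand equals [f],
   and a single point affects neither measurability nor the integral. *)
have mhlo : measurable (`]0%R, +oo[ : set T) by exact: measurable_itv.
have hlo_hl : `]0%R, +oo[ `<=` hl by move=> y; rewrite /= !in_itv/= !andbT => /ltW.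
have iFo : leb.-integrable `]0%R, +oo[ (EFin \o f) by exact: integrableS iF.
have eqo : {in `]0%R, +oo[%classic, (EFin \o f) =1 (fun y => (crosspolytope_integrand d y)%:E)}.
  by move=> y; rewrite inE/= in_itv/= andbT => y0; rewrite cE// gt_eqF.
have iCo : leb.-integrable `]0%R, +oo[ (fun y => (crosspolytope_integrand d y)%:E).
  exact: eq_integrable iFo.
have iC : leb.-integrable hl (fun y => (crosspolytope_integrand d y)%:E).
  have /integrableP[mC Coo] := iCo; have mC' : measurable_fun hl (@crosspolytope_integrand R d).
    apply/measurable_fun_itv_obnd_cbndP; exact/measurable_EFinP.
  apply/integrableP; split; first exact/measurable_EFinP.
  rewrite -integral_itv_obnd_cbnd//.
  by apply/measurable_EFinP/measurableT_comp => //; exact/measurable_EFinP.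
split=> //.
have CI : \int[leb]_(y in hl) crosspolytope_integrand d y = s2p ^- d * \int[leb]_(y in hl) h y.
  rewrite -Rintegral_itv_obnd_cbnd//.
  transitivity (\int[leb]_(y in `]0%R, +oo[) f y).
    by apply: eq_Rintegral => y /eqo [].
  rewrite Rintegral_itv_obnd_cbnd// (RintegralZl _ mhl is_) Is; field.
  by rewrite expf_neq0 ?gt_eqF// sqrtr_gt0 ltr0n.
exists (2 ^+ d / gmoment R d * ((-1) ^+ m * (Num.sqrt (pi / 2) ^+ d.+1 - (Num.sqrt (pi / 2))^-1 *
     \int[leb]_(x in hl) h x))).
  have : forall n, (0 < n)%N ->
      (hyp_vol (@ideal_crosspolytope R n) = (2 ^+ n / gmoment R n)%:E *
      \int[lebesgue_tuple R n]_(t in box hl n) (gtail (tsum t) * expR (tsqr t / 2))%:E)%E.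
    by move=> [|n]// _; exact: hyp_vol_crosspolytope.
  move=> /(_ d d0) ->; rewrite [RHS]EFinM; congr (_ * _)%E.
  by rewrite /h dE; exact: crosspolytope_continuation.
have -> : 'i%C ^+ d = ((-1) ^+ m)%:C :> R[i] by rewrite dE exp_i_even.
rewrite -fmorphV -!rmorphM; congr (_%:C).
rewrite CI -sqrt_2pi_half omegaE// invr_sign.
(* With 1/pi expressed through sqrt(2 pi), both sides are rational expressions in the same
   quantities. The constant terms match because 2^d (s2p/2)^(d+1) is half of s2p^(d+1). *)
have -> : pi^-1 = 2 / s2p ^+ 2.
  by rewrite sqr_sqrtr ?mulr_ge0 ?pi_ge0// invfM mulrA mulfV ?mul1r.
rewrite exprMn exprVn !exprS; move: ((-1) ^+ m) => sgn; field.
by rewrite !expf_neq0 ?gt_eqF// gmoment_gt0.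
Qed.

End polytopes.

Theorem theorem1p5 (R : realType) (d : nat) (hd : (2 <= d)%N) :
  [/\ ~~ odd d ->
        forall v : 'I_d.+1 -> 'rV[R]_d, ideal_regular_simplex_vertices v ->
        Cintegrable setT (@simplex_integrand R d) /\
        exists2 V : R, hyp_vol (convex_hull (range v)) = V%:E &
          V%:C = (omega R d.+1)%:C / (2 * 'i%C ^+ d * (Num.sqrt (2 * pi))%:C)
                 * Cintegral setT (simplex_integrand d),
      Cintegrable `[0, +oo[ (@cube_integrand R d) /\
      exists2 V : R, hyp_vol (@ideal_cube R d) = V%:E &
        V%:C = (omega R d.+1)%:C / ('i%C ^+ d * (Num.sqrt (2 * pi))%:C)
               * Cintegral `[0, +oo[ (cube_integrand d) &
      ~~ odd d ->
        (@lebesgue_measure R).-integrable `[0, +oo[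
          (fun y => (crosspolytope_integrand d y)%:E) /\
        exists2 V : R, hyp_vol (@ideal_crosspolytope R d) = V%:E &
          V%:C = (omega R d.+1)%:C / 'i%C ^+ d
                 * (2^-1 - 2 ^+ d / pi
                    * \int[@lebesgue_measure R]_(y in `[0, +oo[)
                        crosspolytope_integrand d y)%:C ].
Proof.
split; [move=> ev v vS|exact: ideal_cube_volume|move=> ev].
- exact: ideal_simplex_volume.
- exact: ideal_crosspolytope_volume.
Qed.
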